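(* Let $\rho\ge 1$ and $d\ge 1$. Let $\{X_t\}_{t\ge 0}$ and $\{\tilde X_t\}_{t\ge 0}$ be $\mathbb{R}^d$-valued pure jump Markov processes with respective jump intensities $\lambda,\tilde\lambda$, jump kernels $k,\tilde k$, generators $L,\tilde L$ and marginal laws $\{P_t\}_{t\ge0}$, $\{\tilde P_t\}_{t\ge 0}$. Assume that $\bar\lambda:=\sup_{x\in\mathbb{R}^d}\max(\lambda(x),\tilde\lambda(x))<\infty$ and that, for some $\varepsilon>0$, $t\mapsto \mathbb{E}[|X_t|^{\rho(1+\varepsilon)}+|\tilde X_t|^{\rho(1+\varepsilon)}]$ is locally bounded on $[0,\infty)$. For each $t\ge 0$ let $(\psi_t,\tilde\psi_t)$ be a pair of Kantorovich potentials associated with $W_\rho(P_t,\tilde P_t)$. Then: (a) $t\mapsto \int_{\mathbb{R}^d}|L\psi_t(x)|P_t(dx)+\int_{\mathbb{R}^d}|\tilde L\tilde\psi_t(x)|\tilde P_t(dx)$ is locally bounded on $(0,+\infty)$; (b) $t\mapsto W_\rho^\rho(P_t,\tilde P_t)$ is locally Lipschitz on $(0,+\infty)$ and, for almost every $t\in(0,\infty)$, $$\frac{d}{dt}W_\rho^\rho(P_t,\tilde P_t)=-\int_{\mathbb{R}^d}L\psi_t(x)P_t(dx)-\int_{\mathbb{R}^d}\tilde L\tilde\psi_t(x)\tilde P_t(dx);$$ (c) $t\mapsto \int_{\mathbb{R}^d}|L\psi_t(x)|P_t(dx)+\int_{\mathbb{R}^d}|\tilde L\tilde\psi_t(x)|\tilde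 P_t(dx)$ is locally integrable on $[0,\infty)$ and, for every $t\ge0$, $$W_\rho^\rho(P_t,\tilde P_t)=W_\rho^\rho(P_0,\tilde P_0)-\int_0^t\left[\int_{\mathbb{R}^d}L\psi_r(x)P_r(dx)+\int_{\mathbb{R}^d}\tilde L\tilde\psi_r(x)\tilde P_r(dx)\right]dr.$$
   Context: Wasserstein distance: for probability measures $P,\tilde P$ on $\mathbb{R}^d$, $W_\rho(P,\tilde P)=\left(\inf_{\pi\in\Pi(P,\tilde P)}\int|x-y|^\rho\pi(dx,dy)\right)^{1/\rho}$, where $\Pi(P,\tilde P)$ is the set of couplings of $P$ and $\tilde P$. Kantorovich potentials: if $P,\tilde P$ have finite moments of order $\rho$, a pair of Kantorovich potentials associated with $W_\rho(P,\tilde P)$ is a pair $(\psi,\tilde\psi)\in L^1(P)\times L^1(\tilde P)$ of functions with values in $(-\infty,+\infty]$ such that $W_\rho^\rho(P,\tilde P)=-\int\psi\,dP-\int\tilde\psi\,d\tilde P$ and, for all $x,y\in\mathbb{R}^d$, $\psi(x)=-\inf_{y\in\mathbb{R}^d}\{|x-y|^\rho+\tilde\psi(y)\}$ and $\tilde\psi(y)=-\inf_{x\in\mathbb{R}^d}\{|x-y|^\rho+\psi(x)\}$. Such pairs exist. Pure jump Markov process: $\lambda:\mathbb{R}^d\to\mathbb{R}_+$ is measurable, $k(x,dy)$ is a Markov kernel on $\mathbb{R}^d$ with $\lambda(x)k(x,\{x\})=0$ for all $x$; from state $x$ the process waits an exponential time of parameter $\lambda(x)$ and then jumps to a new state drawn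 from $k(x,\cdot)$. Its generator is $Lf(x)=\lambda(x)\int_{\mathbb{R}^d}k(x,dy)(f(y)-f(x))$. Likewise $\tilde Lf(x)=\tilde\lambda(x)\int_{\mathbb{R}^d}\tilde k(x,dy)(f(y)-f(x))$ for $\tilde X$, with the same conditions on $(\tilde\lambda,\tilde k)$. The initial laws $P_0,\tilde P_0$ are arbitrary subject to the moment assumption. $Lf(x)$ is defined when $f(x)$ is finite and $\lambda(x)\int k(x,dy)|f(y)-f(x)|<\infty$; statements on integrals of $L\psi_t$ with respect to $P_t$ include that $L\psi_t$ is defined $P_t$-a.e. (and similarly for $\tilde L\tilde\psi_t$, $\tilde P_t$).
   Formalization: In (c), local integrability of the sum of integrals of |Lψ_t| and |L̃ψ̃_t| is claimed when that function of t is Lebesgue measurable (it may fail to be for arbitrary choices of potentials); without this, it is shown to be dominated by a locally integrable function. *)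

(* Defs.v *)
From HB Require Import structures.
From mathcomp Require Import all_boot all_order all_algebra.
From mathcomp Require Import all_classical all_reals all_analysis.
From mathcomp Require Import measurable_realfun.
Set Implicit Arguments.
Unset Strict Implicit.
Unset Printing Implicit Defensive.
Import Order.TTheory GRing.Theory Num.Theory.
Import numFieldNormedType.Exports.
Local Open Scope classical_set_scope.
Local Open Scope ring_scope.

(* R^d is the type of d-tuples, whose product sigma-algebra is the Borel one.
   The norm has to be spelled out: the library norm on vectors is the sup norm. *)
Definition enorm (R : realType) (d : nat) (x : d.-tuple R) : R :=
  Num.sqrt (\sum_(i < d) tnth x i ^+ 2).

Definition tsub (R : realType) (d : nat) (x y : d.-tuple R) : d.-tuple R :=
  [tuple tnth x i - tnth y i | i < d].

Section Wasserstein.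
Context (R : realType) (d : nat).
Local Notation E := (d.-tuple R).
Local Open Scope ereal_scope.
Implicit Types (rho : R) (P Q : probability E R).

Definition cost rho (x y : E) : R := (enorm (tsub x y) `^ rho)%R.

Definition is_coupling P Q (pi : probability (E * E)%type R) : Prop :=
  (forall A : set E, measurable A -> pi (A `*` setT) = P A) /\
  (forall B : set E, measurable B -> pi (setT `*` B) = Q B).

Definition wasserstein rho P Q : \bar R :=
  (ereal_inf [set \int[pi]_z (cost rho z.1 z.2)%:E
              | pi in [set pi | is_coupling P Q pi]]) `^ rho^-1.

(* psi and phi take their values in ]-oo, +oo] *)
Record kantorovich_potentials rho P Q (psi phi : E -> \bar R) : Prop := {
  kp_ninfty_l : forall x, psi x != -oo ;
  kp_ninfty_r : forall y, phi y != -oo ;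
  kp_integrable_l : P.-integrable setT psi ;
  kp_integrable_r : Q.-integrable setT phi ;
  kp_dual : wasserstein rho P Q `^ rho
            = - (\int[P]_x psi x) - \int[Q]_y phi y ;
  kp_conj_l : forall x,
    psi x = - ereal_inf (range (fun y => (cost rho x y)%:E + phi y)) ;
  kp_conj_r : forall y,
    phi y = - ereal_inf (range (fun x => (cost rho x y)%:E + psi x)) }.

End Wasserstein.

Section JumpProcess.
Context (R : realType) (dT : measure_display) (T : measurableType dT).
Local Open Scope ereal_scope.
Implicit Types (lam : T -> R) (k : R.-pker T ~> T) (f : T -> \bar R).

Definition jump_characteristics lam k : Prop :=
  [/\ measurable_fun setT lam,
      (forall x, (0 <= lam x)%R) &
      (forall x, (lam x)%:E * k x [set x] = 0)].

Definition generator lam k f (x : T) : \bar R :=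
  (lam x)%:E * \int[k x]_y (f y - f x).

(* 0 * +oo = 0, so that only finiteness of f x is asked where lam vanishes;
   elsewhere f y = +oo is allowed on a k x-negligible set of y's only. *)
Definition generator_defined lam k f (x : T) : Prop :=
  f x \is a fin_num /\ (lam x)%:E * \int[k x]_y `|f y - f x| < +oo.

Context (dO : measure_display) (Omega : measurableType dO).
Context (Pr : probability Omega R).
Implicit Types (Y : nat -> {RV Pr >-> T}) (S : nat -> {RV Pr >-> \bar R}).

(* Events of sigma(Y_0, S_0, ..., Y_(n-1), S_(n-1), Y_n). *)
Definition history Y S (n : nat) : set (set Omega) :=
  <<s [set A | (exists i B, [/\ (i <= n)%N, measurable B & A = Y i @^-1` B])
            \/ (exists i C, [/\ (i < n)%N, measurable C & A = S i @^-1` C])] >>.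

(* Given the history up to the arrival in Y_n, the sojourn time S_n is
   exponential with parameter lam (Y_n) and, unless lam (Y_n) = 0, Y_(n+1) has
   law k (Y_n) and is independent of S_n. Where lam (Y_n) = 0 (absorption), S_n
   is a.s. +oo and Y_(n+1) is not constrained, since it is never visited.
   Taking s = 0 in the first clause shows that S_n is a.s. positive. *)
Definition jump_chain lam k Y S : Prop :=
  (forall (n : nat) (H : set Omega) (s : R),
     history Y S n H -> (0 <= s)%R ->
     Pr (H `&` [set w | s%:E < S n w]) =
     \int[Pr]_(w in H) (expR (- (lam (Y n w) * s)))%:E) /\
  (forall (n : nat) (H : set Omega) (s : R) (B : set T),
     history Y S n H -> H `<=` [set w | (0 < lam (Y n w))%R] ->
     (0 <= s)%R -> measurable B ->
     Pr (H `&` [set w | s%:E < S n w] `&` Y n.+1 @^-1` B) =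
     \int[Pr]_(w in H) ((expR (- (lam (Y n w) * s)))%:E * k (Y n w) B)).

Definition jump_time S (n : nat) (w : Omega) : \bar R := \sum_(i < n) S i w.

(* Explosion has probability zero when lam is bounded. The values of X at
   negative times are irrelevant. *)
Definition pure_jump_process lam k (X : R -> {RV Pr >-> T}) : Prop :=
  jump_characteristics lam k /\
  exists Y S, jump_chain lam k Y S /\
    {ae Pr, forall w, forall (n : nat) (t : R), (0 <= t)%R ->
       jump_time S n w <= t%:E < jump_time S n.+1 w -> X t w = Y n w}.

Definition marginal (X : R -> {RV Pr >-> T}) (t : R) : probability T R :=
  distribution Pr (X t).

End JumpProcess.

Section Local.
Context (R : realType).
Local Open Scope ereal_scope.
Implicit Types (J : set R) (F G : R -> \bar R).

(* For J an interval, local properties on J are stated on the compact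
   subintervals of J. *)
Definition locally_bounded_on J F : Prop :=
  forall a b : R, `[a, b] `<=` J ->
    exists M : R, forall t, t \in `[a, b]%R -> `|F t| <= M%:E.

Definition locally_lipschitz_on J (w : R -> R) : Prop :=
  forall a b : R, `[a, b] `<=` J -> [lipschitz (w t : R^o) | t in `[a, b]].

(* Measurability and integrability in time are meant for the Lebesgue (i.e.
   completed) sigma-algebra; measurable_fun on a bare R would mean Borel. *)
Definition lebesgue_measurable_on J F : Prop :=
  @measurable_fun _ _ (caratheodory_type (R := R) (wlength idfun)^*%mu) _ J F.

Definition locally_integrable_on J F : Prop :=
  forall a b : R, `[a, b] `<=` J ->
    completed_lebesgue_measure.-integrable `[a, b] F.

(* Finiteness of the upper integrals of |F| over compact subintervals: the
   notion available when F need not be measurable. *)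
Definition locally_dominated_on J F : Prop :=
  exists G, locally_integrable_on J G /\ forall t, J t -> `|F t| <= G t.

End Local.

(* Main.v *)
(** If L bounds both jump intensities, the law P_t is a Poisson mixture with
    parameter L t of the laws of a discrete-time chain (uniformization, deduced
    from the Dynkin formula for nonnegative functions). A function with a moment of
    order 1 + eps under P_t thus has an expectation under P_s that is smooth in s,
    with derivative the expectation of its generator, of size O(t^(-1/(1+eps))) at
    s = t and with a second derivative that is bounded when t stays away from 0.

    Centred Kantorovich potentials have such moments, uniformly for bounded t:
    along a coupling of cost at most W + delta, the gap c + psi + phi is
    nonnegative with mean at most delta, and psi is controlled by the gap and by
    the moments of the marginals.

    Since the potentials at time t stay admissible in the dual problem at time s,
    w(s) >= w(t) - (s - t) D(t) - C (s - t)^2 with D the drift. Using this at two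
    times makes 2 C t - D(t) nondecreasing; so D is Borel and w is the integral of
    -D, first away from 0 and then, D being O(t^(-q)) with q < 1 and w continuous
    at 0, on every [0, t]. *)

Require Import Defs.
From HB Require Import structures.
From mathcomp Require Import all_boot all_order all_algebra.
From mathcomp Require Import all_classical all_reals all_analysis.
From mathcomp Require Import measurable_realfun ring lra.
Set Implicit Arguments.
Unset Strict Implicit.
Unset Printing Implicit Defensive.
Import Order.TTheory GRing.Theory Num.Theory.
Import numFieldNormedType.Exports.
Local Open Scope classical_set_scope.
Local Open Scope ring_scope.

(** * Mixtures of measures and conditioning *)

(** The potentials are unbounded, may take the value +oo, and are chosen at each time with no
    relation to the choices at other times. A function must therefore be followed along the
    evolution with one moment at one time as its only regularity. Stated for nonnegative functions,
    with sums in place of differences, the Dynkin formula asks for no integrability. Passing from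
    time t to time s multiplies the n-th Poisson weight, up to a common factor, by (s / t)^n; the
    spare [eps] in the moment pays for this, through a splitting level that depends on n. The
    comparison degenerates as t tends to 0: hence the singular power of t, and the separate
    treatment of the initial time. There the potentials of time 0, which have no known moment at
    later times, are truncated; this keeps them admissible in the dual problem and makes them
    bounded. Since nothing gives measurability in time of the integrals of absolute values, these
    are dominated by an integrable function, and are shown integrable under a measurability
    assumption. *)

Section measurable_induction.
Context d (T : measurableType d) (R : realType).
Local Open Scope ereal_scope.
Import HBNNSimple.

(** Functional form of the monotone class argument: simple functions are nonnegative combinations of
    indicators, and [nnsfun_approx] increases to f. It serves both for mixtures and for weighted
    laws. *)
Lemma ge0_measurable_fun_ind (Q : (T -> \bar R) -> Prop) :
  (forall A, measurable A -> Q (fun x => (\1_A x)%:E)) ->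
  (forall (r : R) f, (0 <= r)%R -> measurable_fun setT f -> (forall x, 0 <= f x) ->
    Q f -> Q (fun x => r%:E * f x)) ->
  (forall f g, measurable_fun setT f -> (forall x, 0 <= f x) -> Q f ->
    measurable_fun setT g -> (forall x, 0 <= g x) -> Q g ->
    Q (fun x => f x + g x)) ->
  (forall f_ : (T -> \bar R)^nat, (forall n, measurable_fun setT (f_ n)) ->
    (forall n x, 0 <= f_ n x) ->
    (forall x, {homo f_ ^~ x : m n / (m <= n)%N >-> m <= n}) ->
    (forall n, Q (f_ n)) -> Q (fun x => limn (f_ ^~ x))) ->
  forall f, measurable_fun setT f -> (forall x, 0 <= f x) -> Q f.
Proof.
move=> Qi QZ QD Ql f mf f0.
have Q0 : Q (cst 0).
  have := Qi _ (@measurable0 _ T).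
  by congr Q; apply/funext => x /=; rewrite indic0.
have Qs (h : {nnsfun T >-> R}) : Q (EFin \o h).
  have -> : EFin \o h = fun x => \sum_(r <- finmap.enum_fset (fset_set (range h))) (r * \1_(h @^-1` [set r]) x)%:E.
    by apply/funext => x /=; rewrite fimfunE fsbig_finite//= -sumEFin.
  have r0 (r : R) : r \in finmap.enum_fset (fset_set (range h)) -> (0 <= r)%R.
    by rewrite [_ \in _](in_fset_set (fimfunP h)) inE => -[x _ <-].
  move: r0; elim: (finmap.enum_fset (fset_set (range h))) => [|r s IH] r0.
    by rewrite (_ : (fun _ => _) = cst 0)//; apply/funext => x; rewrite big_nil.
  under [X in Q X]eq_fun do rewrite big_cons.
  have r0' : (0 <= r)%R by apply: r0; rewrite inE eqxx.
  have s0 r' : r' \in s -> (0 <= r')%R by move=> r's; apply: r0; rewrite inE r's orbT.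
  have mi (r' : R) : measurable_fun setT (fun x : T => (r' * \1_(h @^-1` [set r']) x)%:E).
    exact/measurable_EFinP/measurable_funM.
  apply: QD => //.
  - by move=> x; rewrite lee_fin mulr_ge0.
  - under [X in Q X]eq_fun do rewrite EFinM.
    apply: QZ => //; last exact: Qi.
    exact/measurable_EFinP.
  - exact: emeasurable_sum.
  - move=> x; rewrite big_seq sume_ge0// => i /s0 i0.
    by rewrite lee_fin mulr_ge0.
  - exact: IH.
pose g := nnsfun_approx measurableT mf.
have -> : f = fun x => limn (fun n => (g n x)%:E).
  by apply/funext => x; apply/esym/cvg_lim => //; exact: cvg_nnsfun_approx.
apply: (Ql (fun n => EFin \o g n)) => //.
- by move=> n; exact/measurable_EFinP.
- by move=> n x; rewrite /= lee_fin.
- by move=> x m n mn; rewrite /= lee_fin; exact/lefP/nd_nnsfun_approx.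
Qed.

End measurable_induction.

Section mixture.
Context d1 d2 (X : measurableType d1) (Y : measurableType d2) (R : realType).
Variables (m : {measure set X -> \bar R}) (q : X -> {measure set Y -> \bar R}).
Hypothesis mq : forall U, measurable U -> measurable_fun setT (q ^~ U).
Local Open Scope ereal_scope.

(** The term carries the measurability proof, so that the measure structure declared on
    [mixture mq], which rests on it, can be inferred. *)
Definition mixture of (forall U, measurable U -> measurable_fun setT (q ^~ U)) :=
  fun U : set Y => \int[m]_x q x U.

Let mixture0 : mixture mq set0 = 0.
Proof. by rewrite /mixture integral0_eq. Qed.

Let mixture_ge0 U : 0 <= mixture mq U.
Proof. exact: integral_ge0. Qed.

Let mixture_additive : semi_sigma_additive (mixture mq).
Proof.
move=> U mU tU mUU; rewrite [X in _ --> X](_ : _ =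
  \int[m]_x (\sum_(n <oo) q x (U n))); last first.
  apply: eq_integral => V _.
  by apply/esym/cvg_lim => //; exact/measure_semi_sigma_additive.
apply/cvg_closeP; split.
  by apply: is_cvg_nneseries => n _ _; exact: integral_ge0.
by rewrite closeE// integral_nneseries// => n; exact: mq.
Qed.

HB.instance Definition _ := isMeasure.Build _ _ _ (mixture mq)
  mixture0 mixture_ge0 mixture_additive.

Lemma ge0_integral_mixture (nu : {measure set Y -> \bar R}) :
  (forall U, measurable U -> nu U = \int[m]_x q x U) ->
  forall f, measurable_fun setT f -> (forall y, 0 <= f y) ->
  \int[nu]_y f y = \int[m]_x \int[q x]_y f y.
Proof.
move=> nuE; apply: ge0_measurable_fun_ind.
- move=> A mA; rewrite integral_indic// setIT nuE//.
  by apply: eq_integral => x _; rewrite integral_indic// setIT.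
- move=> r f r0 mf f0 IH; rewrite ge0_integralZl_EFin// IH.
  rewrite -ge0_integralZl_EFin//; last 2 first.
  - by move=> x _; exact: integral_ge0.
  - exact: measurable_fun_integral_kernel.
  by apply: eq_integral => x _; rewrite ge0_integralZl_EFin.
- move=> f g mf f0 IHf mg g0 IHg; rewrite ge0_integralD// IHf IHg.
  rewrite -ge0_integralD//; last 4 first.
  - by move=> x _; exact: integral_ge0.
  - exact: measurable_fun_integral_kernel.
  - by move=> x _; exact: integral_ge0.
  - exact: measurable_fun_integral_kernel.
  by apply: eq_integral => x _; rewrite ge0_integralD.
- move=> f_ mf f0 nd IH.
  rewrite monotone_convergence//.
  under eq_fun do rewrite IH.
  rewrite -monotone_convergence//; last 3 first.
  - by move=> n; exact: measurable_fun_integral_kernel.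
  - by move=> n x _; exact: integral_ge0.
  - by move=> x _ i j ij; apply: ge0_le_integral => // y _; exact: nd.
  by apply: eq_integral => x _; rewrite monotone_convergence.
Qed.

End mixture.

Section expR_bounds.
Context {R : realType}.

Lemma onem_expRN_ge0 (x : R) : 0 <= x -> 0 <= 1 - expR (- x).
Proof. by move=> x0; rewrite subr_ge0 -[leRHS]expR0 ler_expR oppr_le0. Qed.

Lemma onem_expRN_lip (x y : R) : 0 <= x -> x <= y ->
  1 - expR (- y) <= 1 - expR (- x) + (y - x).
Proof.
move=> x0 xy.
have -> : expR (- y) = expR (- x) * expR (- (y - x)) by rewrite -expRD; congr expR; ring.
have e1 : expR (- x) <= 1 by rewrite -[leRHS]expR0 ler_expR oppr_le0.
have e0 := expR_ge0 (- x).
have e2 : 1 - (y - x) <= expR (- (y - x)) by exact: expR_ge1Dx.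
have yx : 0 <= y - x by rewrite subr_ge0.
nra.
Qed.

End expR_bounds.

(** * Conditioning at a random time that is known from the past *)

Section freezing.
Context d (W : measurableType d) (R : realType) (Pr : probability W R).
Variables (Hs : set (set W)) (U l : W -> R) (S q : W -> \bar R) (D : set W) (L : R).
Hypotheses (Hsm : Hs `<=` measurable) (HsI : setI_closed Hs).
Hypothesis HsU : forall a b, Hs [set w | a <= U w < b].
Hypotheses (mU : measurable_fun setT U) (ml : measurable_fun setT l).
Hypotheses (mS : measurable_fun setT S) (mq : measurable_fun setT q).
Hypothesis mD : measurable D.
Hypotheses (l0 : forall w, 0 <= l w) (lL : forall w, l w <= L).
Hypotheses (q0 : forall w, (0 <= q w)%E) (q1 : forall w, (q w <= 1)%E).
Local Open Scope ereal_scope.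
Local Notation F u w := ((1 - expR (- (l w * u)))%:E * q w).
Hypothesis fixed : forall H (s : R), Hs H -> (0 <= s)%R ->
  Pr (H `&` [set w | S w <= s%:E] `&` D) = \int[Pr]_(w in H) F s w.

Let mF (H : set W) (u : W -> R) : measurable_fun setT u ->
  measurable_fun H (fun w => F (u w) w).
Proof.
move=> mu; apply: measurable_funTS; apply: emeasurable_funM => //.
apply/measurable_EFinP/measurable_funB => //.
apply: measurableT_comp => //; apply: measurableT_comp => //.
exact: measurable_funM.
Qed.

Let F0 (u : R) w : (0 <= u)%R -> 0 <= F u w.
Proof. by move=> u0; rewrite mule_ge0// lee_fin onem_expRN_ge0// mulr_ge0. Qed.

Let F_lip (u v e : R) w : (0 <= u)%R -> (u <= v)%R -> (v <= u + e)%R ->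
  F v w <= F u w + (L * e)%:E.
Proof.
move=> u0 uv vu.
have qf : q w \is a fin_num by rewrite ge0_fin_numE// (le_lt_trans (q1 w))// ltry.
move: (q0 w) (q1 w); rewrite -(fineK qf); set r := fine _ => r0 r1.
rewrite -!EFinM -EFinD lee_fin.
rewrite lee_fin in r0; rewrite lee_fin in r1.
have luv : (l w * u <= l w * v)%R by rewrite ler_wpM2l.
have := onem_expRN_lip (mulr_ge0 (l0 w) u0) luv.
have : (l w * (v - u) <= L * e)%R.
  by rewrite ler_pM// ?subr_ge0//; lra.
have : (0 <= l w * (v - u))%R by rewrite mulr_ge0// subr_ge0.
move: luv; set a := expR _; set b := expR _; set c := (l w * u)%R; set c' := (l w * v)%R.
rewrite mulrBr -/c -/c' => *; nra.
Qed.

Let mSU (u : W -> R) : measurable_fun setT u -> measurable [set w | S w <= (u w)%:E].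
Proof.
move=> mu; rewrite -[X in measurable X]setTI; apply: emeasurable_fun_le => //.
exact/measurable_EFinP.
Qed.

(** [fixed] handles deterministic thresholds only. The values of U are cut into slices of width e,
    which stay in [Hs] by [HsU] and [HsI]; on each slice the threshold is frozen at an end point.
    The integrand is L-Lipschitz in the threshold and the slices have total mass at most 1, so the
    total error is at most L e, and e is arbitrary. *)
Lemma freezing H : Hs H -> (forall w, H w -> 0 <= U w)%R ->
  Pr (H `&` [set w | S w <= (U w)%:E] `&` D) = \int[Pr]_(w in H) F (U w) w.
Proof.
move=> hH U0.
have mH : measurable H by exact: Hsm.
have L0 : (0 <= L)%R by exact: le_trans (l0 point) (lL point).
set lhs := Pr _; set rhs := \int[_]_(_ in _) _.
suff approx e : (0 < e)%R -> lhs <= rhs + (L * e)%:E /\ rhs <= lhs + (L * e)%:E.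
  apply/eqP; rewrite eq_le; apply/andP; split; apply/lee_addgt0Pr => e e0.
    (* L may be 0, hence the division by L + 1. *)
    have e' : (0 < e / (L + 1))%R by rewrite divr_gt0// ltr_wpDl.
    apply: le_trans (approx _ e').1 _; rewrite leeD2l// lee_fin.
    by rewrite mulrCA ler_piMr ?(ltW e0)// ler_pdivrMr ?ltr_wpDl// mul1r lerDl.
  have e' : (0 < e / (L + 1))%R by rewrite divr_gt0// ltr_wpDl.
  apply: le_trans (approx _ e').2 _; rewrite leeD2l// lee_fin.
  by rewrite mulrCA ler_piMr ?(ltW e0)// ler_pdivrMr ?ltr_wpDl// mul1r lerDl.
move=> e0.
pose J i := [set w | i%:R * e <= U w < i.+1%:R * e]%R.
pose G i := H `&` J i.
have hG i : Hs (G i) by apply: HsI => //; exact: HsU.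
have mG i : measurable (G i) by exact: Hsm.
have HG : H = \bigcup_i G i.
  rewrite -setI_bigcupr; apply/seteqP; split=> [w Hw|w []//]; split=> //.
  exists (Num.truncn (U w / e)) => //.
  have /andP[h1 h2] : ((Num.truncn (U w / e))%:R <= U w / e < (Num.truncn (U w / e)).+1%:R)%R.
    by apply: truncn_itv; rewrite divr_ge0 ?U0// ltW.
  by apply/andP; rewrite -ler_pdivlMr// -ltr_pdivrMr.
have tJ : trivIset setT J.
  apply/trivIsetP => i j _ _ ij; apply/seteqP; split=> // w [].
  rewrite /J /mkset -!ler_pdivlMr// -!ltr_pdivrMr// => hi hj.
  by move: ij; rewrite -(truncn_def hi) -(truncn_def hj) eqxx.
have tG : trivIset setT G by exact: trivIset_setIl.
have PH : \sum_(0 <= i <oo) Pr (G i) <= 1.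
  by rewrite -measure_semi_bigcup// -?HG//; exact: probability_le1.
have lhsE : lhs = \sum_(0 <= i <oo) Pr (G i `&` [set w | S w <= (U w)%:E] `&` D).
  rewrite /lhs {1}HG !setI_bigcupl measure_semi_bigcup//.
  - by move=> i; apply: measurableI => //; apply: measurableI => //; exact: mSU.
  - apply/trivIsetP => i j _ _ ij; have /trivIsetP/(_ i j I I ij) := tG.
    by rewrite -subset0 => GG; apply/seteqP; split=> // w [[[Gi _] _] [[Gj _] _]]; apply: (GG w).
  - by rewrite -!setI_bigcupl -HG; apply: measurableI => //; apply: measurableI => //; exact: mSU.
have rhsE : rhs = \sum_(0 <= i <oo) \int[Pr]_(w in G i) F (U w) w.
  rewrite /rhs {1}HG ge0_integral_bigcup//; first exact: mF.
  by rewrite -HG => w Hw; apply: F0; exact: U0.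
have sumL (x y : nat -> \bar R) : (forall i, 0 <= x i) -> (forall i, 0 <= y i) ->
    (forall i, x i <= y i + (L * e)%:E * Pr (G i)) ->
    \sum_(0 <= i <oo) x i <= \sum_(0 <= i <oo) y i + (L * e)%:E.
  move=> x0 y0 xy; apply: (@le_trans _ _ (\sum_(0 <= i <oo) (y i + (L * e)%:E * Pr (G i)))).
    by apply: lee_nneseries => // i _ _; exact: x0.
  rewrite nneseriesD//; last first.
    by move=> i _ _; rewrite mule_ge0// lee_fin mulr_ge0// ltW.
  rewrite leeD2l// nneseriesZl//.
  by rewrite -[leRHS]mule1 lee_wpmul2l// lee_fin mulr_ge0// ltW.
have G0 i w : G i w -> (0 <= i%:R * e)%R by move=> _; rewrite mulr_ge0// ltW.
have shift i (u v : W -> R) : measurable_fun setT u -> measurable_fun setT v ->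
    (forall w, G i w -> 0 <= u w /\ u w <= v w /\ v w <= u w + e)%R ->
    \int[Pr]_(w in G i) F (v w) w <=
      \int[Pr]_(w in G i) F (u w) w + (L * e)%:E * Pr (G i).
  move=> mu mv uv; rewrite -integral_cst// -ge0_integralD//; last 3 first.
  - by move=> w /uv[u0 _]; exact: F0.
  - exact: mF.
  - by move=> w _; rewrite lee_fin mulr_ge0// ltW.
  apply: ge0_le_integral => //.
  - by move=> w /uv[u0 [uv' _]]; apply: F0; exact: le_trans uv'.
  - exact: mF.
  - by apply: emeasurable_funD => //; exact: mF.
  - by move=> w /uv[u0 [uv' vu]]; exact: F_lip.
have step i : (i.+1%:R * e = i%:R * e + e)%R by rewrite -natr1 mulrDl mul1r.
split.
(* Upper bound: the threshold is raised to the right end of the slice. The lower bound in the next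
   bullet takes the left end. *)
- rewrite lhsE rhsE; apply: sumL => i; first exact: measure_ge0.
    by apply: integral_ge0 => w [Hw _]; apply: F0; exact: U0.
  apply: (@le_trans _ _ (Pr (G i `&` [set w | S w <= (i.+1%:R * e)%:E] `&` D))).
    apply: le_measure; rewrite ?inE.
    + by apply: measurableI => //; apply: measurableI => //; exact: mSU.
    + by apply: measurableI => //; apply: measurableI => //; exact: mSU.
    + move=> w [[[Hw Jw] Sw] Dw]; split=> //; split=> //=.
      by apply: le_trans Sw _; rewrite lee_fin; case/andP: Jw => _ /ltW.
  rewrite fixed//; last by rewrite mulr_ge0// ltW.
  apply: shift => // w [Hw /andP[J1 J2]]; split; [exact: U0|split]; first exact: ltW.
  by rewrite step lerD2r.
- rewrite lhsE rhsE; apply: sumL => i; last 2 first.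
  + exact: measure_ge0.
  + apply: (@le_trans _ _ (Pr (G i `&` [set w | S w <= (i%:R * e)%:E] `&` D)
       + (L * e)%:E * Pr (G i))).
      rewrite fixed//; last by rewrite mulr_ge0// ltW.
      apply: shift => // w [Hw /andP[J1 J2]]; split; first by rewrite mulr_ge0// ltW.
      by split=> //; rewrite -step ltW.
    rewrite leeD2r//; apply: le_measure; rewrite ?inE.
    * by apply: measurableI => //; apply: measurableI => //; exact: mSU.
    * by apply: measurableI => //; apply: measurableI => //; exact: mSU.
    * move=> w [[[Hw Jw] Sw] Dw]; split=> //; split=> //=.
      by apply: le_trans Sw _; rewrite lee_fin; case/andP: Jw.
  + by apply: integral_ge0 => w [Hw _]; apply: F0; exact: U0.
Qed.

End freezing.

(** * The jump chain and its arrival times *)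

Lemma measureD_null d (W : measurableType d) (R : realType) (m : {measure set W -> \bar R})
  (A N : set W) : measurable A -> measurable N -> m N = 0%E -> m (A `\` N) = m A.
Proof.
move=> mA mN N0; rewrite [RHS](measureDI m mA mN).
rewrite [X in (_ + X)%E](_ : _ = 0%E) ?adde0//.
by apply: (@subset_measure0 _ _ _ m _ N) => //; exact: measurableI.
Qed.

Lemma addeIr_fin (R : realType) (x y z : \bar R) : z \is a fin_num ->
  (x + z = y + z -> x = y)%E.
Proof. by move=> zf xy; rewrite -(addeK x zf) xy addeK. Qed.

Section jump_chain_step.
Context (R : realType) (dT : measure_display) (T : measurableType dT).
Context (dO : measure_display) (Omega : measurableType dO) (Pr : probability Omega R).
Variables (lam : T -> R) (k : R.-pker T ~> T).
Variables (Y : nat -> {RV Pr >-> T}) (S : nat -> {RV Pr >-> \bar R}) (L : R).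
Hypotheses (mlam : measurable_fun setT lam) (lam0 : forall x, 0 <= lam x).
Hypothesis lamL : forall x, lam x <= L.
Hypothesis chain : jump_chain lam k Y S.
Local Open Scope ereal_scope.

(** The generators of [history] are named in order to view Omega, with the sigma-algebra of the
    past, as a measurable type [hT n]; belonging to the past then becomes ordinary measurability. *)
Definition history_gen n : set (set Omega) :=
  [set A | (exists i B, [/\ (i <= n)%N, measurable B & A = Y i @^-1` B])
        \/ (exists i C, [/\ (i < n)%N, measurable C & A = S i @^-1` C])].

Local Notation hist n := (history Y S n).
Local Notation hT n := (g_sigma_algebraType (history_gen n)).

Lemma history_measurable n : hist n `<=` measurable.
Proof.
apply: smallest_sub; first exact: sigma_algebra_measurable.
move=> A [[i [B [_ mB ->]]]|[i [B [_ mB ->]]]]; rewrite -[_ @^-1` _]setTI;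
  exact: measurable_funP.
Qed.

Lemma historyI n : setI_closed (hist n).
Proof.
by move=> A B hA hB; apply: (@measurableI _ (hT n)).
Qed.

Lemma history_Y i n : (i <= n)%N -> measurable_fun (setT : set (hT n)) (Y i : hT n -> T).
Proof.
move=> ni _ B mB; rewrite setTI; apply: sub_sigma_algebra; left; by exists i, B.
Qed.

Lemma history_S i n : (i < n)%N ->
  measurable_fun (setT : set (hT n)) (S i : hT n -> \bar R).
Proof.
move=> ni _ B mB; rewrite setTI; apply: sub_sigma_algebra; right; by exists i, B.
Qed.

Lemma history_jump_time n :
  measurable_fun (setT : set (hT n)) (jump_time S n : hT n -> \bar R).
Proof. by apply: emeasurable_sum => i; exact: history_S. Qed.

Lemma measurable_jump_time n : measurable_fun setT (jump_time S n).
Proof. by apply: emeasurable_sum => i; exact: measurable_funP. Qed.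

Lemma jump_timeS n w : jump_time S n.+1 w = jump_time S n w + S n w.
Proof. by rewrite /jump_time big_ord_recr. Qed.

Lemma measurable_le_S n (s : R) : measurable [set w | S n w <= s%:E].
Proof.
by rewrite -[X in measurable X]setTI; apply: emeasurable_fun_infty_c.
Qed.

Lemma measurable_gt_S n (s : R) : measurable [set w | s%:E < S n w].
Proof.
by rewrite -[X in measurable X]setTI; apply: emeasurable_fun_o_infty.
Qed.

Lemma sojourn_gt0 n : Pr [set w | S n w <= 0] = 0.
Proof.
have := chain.1 n setT 0%R; rewrite setTI => /(_ _ (lexx _)).
have h : history Y S n setT by exact: (@measurableT _ (hT n)).
move=> /(_ h); under eq_integral do rewrite mulr0 oppr0 expR0.
have -> : \int[Pr]_(w in setT) (1%:E : \bar R) = 1 by rewrite integral_cst// mul1e; exact: probability_setT.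
move=> P1.
rewrite (_ : [set w | S n w <= 0] = ~` [set w | 0%:E < S n w]).
  by rewrite probability_setC ?P1 ?subee//; exact: measurable_gt_S.
by apply/seteqP; split => w /=; [move=> h'; apply/negP; rewrite -leNgt | move/negP; rewrite -leNgt].
Qed.

Lemma measurable_preY n (B : set T) : measurable B -> measurable (Y n @^-1` B).
Proof. by move=> mB; rewrite -[X in measurable X]setTI; exact: measurable_funP. Qed.

Lemma measurable_lamY n : measurable_fun setT (fun w => lam (Y n w)).
Proof. by apply: measurableT_comp => //; exact: measurable_funP. Qed.

Lemma measurable_kY n (B : set T) : measurable B ->
  measurable_fun setT (fun w => k (Y n w) B).
Proof.
by move=> mB; apply: (measurableT_comp (measurable_kernel k B mB)); exact: measurable_funP.
Qed.

Let mexp n (s : R) : measurable_fun setT (fun w => expR (- (lam (Y n w) * s))).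
Proof.
apply: measurableT_comp => //; apply: measurableT_comp => //.
apply: measurable_funM => //; exact: measurable_lamY.
Qed.

Lemma ker_le1 x (B : set T) : measurable B -> k x B <= 1.
Proof.
move=> mB; rewrite -(@prob_kernel _ _ _ _ _ k x).
by apply: le_measure; rewrite ?inE.
Qed.

(** Where [lam (Y n)] is positive, the second clause of [jump_chain] at s is subtracted from the
    same clause at 0, the sojourn being a.s. positive. Where it vanishes, the first clause makes S_n
    exceed s a.s., so both sides are 0 whatever Y_(n+1) is. *)
Lemma jump_step n (H : set Omega) (s : R) (B : set T) :
  hist n H -> (0 <= s)%R -> measurable B ->
  Pr (H `&` [set w | S n w <= s%:E] `&` Y n.+1 @^-1` B) =
  \int[Pr]_(w in H) ((1 - expR (- (lam (Y n w) * s)))%:E * k (Y n w) B).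
Proof.
move=> hH s0 mB.
have mH := history_measurable hH.
have mYB := measurable_preY n.+1 mB.
have mle := measurable_le_S n s.
have mgt := measurable_gt_S n s.
have ge0 w : 0 <= (1 - expR (- (lam (Y n w) * s)))%:E * k (Y n w) B.
  by rewrite mule_ge0// lee_fin onem_expRN_ge0// mulr_ge0.
have mI : measurable_fun setT
    (fun w => (1 - expR (- (lam (Y n w) * s)))%:E * k (Y n w) B).
  apply: emeasurable_funM; last exact: measurable_kY.
  by apply/measurable_EFinP/measurable_funB => //; exact: mexp.
pose P1 := [set w | (0 < lam (Y n w))%R].
have hP1 : hist n P1.
  have m1 : measurable_fun (setT : set (hT n)) (fun w : hT n => lam (Y n w)).
    by apply: measurableT_comp => //; exact: history_Y.
  have := m1 measurableT `]0%R, +oo[%classic (measurable_itv _).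
  by rewrite setTI /preimage /=; congr (hist n); apply/funext => w /=; rewrite in_itv/= andbT.
have hH1 : hist n (H `&` P1) by exact: historyI.
have hH0 : hist n (H `&` ~` P1).
  by apply: historyI => //; exact: (@measurableC _ (hT n)).
have mH1 := history_measurable hH1.
have mH0 := history_measurable hH0.
have HU : H = (H `&` P1) `|` (H `&` ~` P1) by rewrite -setIUr setUv setIT.
have dis : [disjoint H `&` P1 & H `&` ~` P1].
  by apply/disj_setPS => w [[_ ?] [_ ?]].
have E1 : Pr (H `&` P1 `&` [set w | S n w <= s%:E] `&` Y n.+1 @^-1` B) =
  \int[Pr]_(w in H `&` P1) ((1 - expR (- (lam (Y n w) * s)))%:E * k (Y n w) B).
  have lt0 (r : R) : (0 <= r)%R -> Pr (H `&` P1 `&` [set w | r%:E < S n w] `&` Y n.+1 @^-1` B) =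
     \int[Pr]_(w in H `&` P1) ((expR (- (lam (Y n w) * r)))%:E * k (Y n w) B).
    by move=> r0; apply: chain.2 => // w [].
  (* The event that the sojourn exceeds s is added to both sides, so that no difference of extended
     reals has to be manipulated. *)
  apply: (@addeIr_fin _ _ _ (Pr (H `&` P1 `&` [set w | s%:E < S n w] `&` Y n.+1 @^-1` B))).
    apply: fin_num_measure; do 2 apply: measurableI => //.
  rewrite {2}lt0// -ge0_integralD//; last 2 first.
  - exact: measurable_funTS.
  - apply: measurable_funTS; apply: emeasurable_funM; last exact: measurable_kY.
    exact/measurable_EFinP/mexp.
  transitivity (Pr (H `&` P1 `&` Y n.+1 @^-1` B)).
    rewrite (measureDI Pr (A := H `&` P1 `&` Y n.+1 @^-1` B) (B := [set w | s%:E < S n w]))//;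
      last exact: measurableI.
    congr (Pr _ + Pr _).
      apply/seteqP; split=> w /=.
        by move=> [[[Hw Pw] Sw] Yw]; split=> //; apply/negP; rewrite -leNgt.
      by move=> [[[Hw Pw] Yw] /negP]; rewrite -leNgt => Sw.
    by rewrite setIAC.
  transitivity (Pr (H `&` P1 `&` [set w | 0%:E < S n w] `&` Y n.+1 @^-1` B)).
    rewrite -(measureD_null (A := H `&` P1 `&` Y n.+1 @^-1` B) _ (measurable_le_S n 0) (sojourn_gt0 n));
      last exact: measurableI.
    congr (Pr _); apply/seteqP; split=> w /=.
      by move=> [[[Hw Pw] Yw] /negP]; rewrite -ltNge => Sw.
    by move=> [[[Hw Pw] Sw] Yw]; split=> //; apply/negP; rewrite -ltNge.
  rewrite lt0//; apply: eq_integral => w _.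
  rewrite mulr0 oppr0 expR0 mul1e -ge0_muleDl ?lee_fin ?expR_ge0//.
    by rewrite -EFinD subrK mul1e.
  by rewrite onem_expRN_ge0// mulr_ge0.
have E0 : Pr (H `&` ~` P1 `&` [set w | S n w <= s%:E] `&` Y n.+1 @^-1` B) =
  \int[Pr]_(w in H `&` ~` P1) ((1 - expR (- (lam (Y n w) * s)))%:E * k (Y n w) B).
  have l0 w : (H `&` ~` P1) w -> lam (Y n w) = 0%R.
    by move=> [_ /negP]; rewrite -leNgt => l0; apply/eqP; rewrite eq_le l0 lam0.
  rewrite [RHS]integral0_eq; last first.
    by move=> w /l0 ->; rewrite mul0r oppr0 expR0 subrr mul0e.
  have m1 : measurable (H `&` ~` P1 `&` [set w | S n w <= s%:E]) by exact: measurableI.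
  suff : Pr (H `&` ~` P1 `&` [set w | S n w <= s%:E]) = 0.
    by apply: subset_measure0 => //; exact: measurableI.
  have c0 := chain.1 n (H `&` ~` P1) s hH0 s0.
  have P0 : Pr (H `&` ~` P1 `&` [set w | s%:E < S n w]) = Pr (H `&` ~` P1).
    rewrite c0 (eq_integral (cst 1)); last first.
      by move=> w /[!inE] /l0 ->; rewrite mul0r oppr0 expR0.
    by rewrite integral_cst// mul1e.
  have : Pr (H `&` ~` P1) = Pr ((H `&` ~` P1) `\` [set w | s%:E < S n w]) + Pr (H `&` ~` P1).
    by rewrite -{2}P0; exact: measureDI.
  rewrite -{1}[Pr (H `&` ~` P1)]add0e => /addeIr_fin; rewrite fin_num_measure// => /(_ isT) E.
  rewrite [RHS]E; congr (Pr _); apply/seteqP; split=> w /=.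
    by move=> [[Hw Pw] Sw]; split=> //; apply/negP; rewrite -leNgt.
  by move=> [[Hw Pw] /negP]; rewrite -leNgt => Sw.
rewrite {2}HU ge0_integral_setU//; last by apply: measurable_funTS.
rewrite -E1 -E0 {1}HU !setIUl measureU//.
- by do 2 apply: measurableI => //.
- by do 2 apply: measurableI => //.
- by apply/seteqP; split=> // w [[[[_ ?] _] _] [[[_ ?] _] _]].
Qed.

(* Asking for positive sojourns discards the null set on which some S i is
   negative or -oo, so that jump_time is finite and nondecreasing here. *)
Definition arrived n (t : R) : set Omega :=
  [set w | (forall i, (i < n)%N -> 0 < S i w) /\ jump_time S n w <= t%:E].

Lemma arrivedP n t w : arrived n t w ->
  (0 <= fine (jump_time S n w) <= t)%R /\ (fine (jump_time S n w))%:E = jump_time S n w.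
Proof.
move=> [pos le_t].
have T0 : 0 <= jump_time S n w.
  by apply: sume_ge0 => i _; apply: ltW; exact: pos.
have Tf : jump_time S n w \is a fin_num.
  by rewrite ge0_fin_numE// (le_lt_trans le_t)// ltry.
by rewrite -!lee_fin fineK// T0 le_t.
Qed.

Lemma arrived0 t : (0 <= t)%R -> arrived 0 t = setT.
Proof.
move=> t0; apply/seteqP; split=> // w _; split=> //.
by rewrite /jump_time big_ord0 lee_fin.
Qed.

(** Puts the next arrival in the shape required by [freezing]: an event of the past, and S_n
    compared with the remaining time; the event removed is null by [sojourn_gt0]. *)
Lemma arrivedS n t : arrived n.+1 t =
  arrived n t `&` [set w | S n w <= (t - fine (jump_time S n w))%:E] `\` [set w | S n w <= 0].
Proof.
apply/seteqP; split=> w.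
- move=> [pos le_t].
  have Sn : 0 < S n w by exact: pos.
  have An : arrived n t w.
    split=> [i ni|]; first by apply: pos; rewrite ltnS ltnW.
    by apply: le_trans le_t; rewrite jump_timeS leeDl// ltW.
  split; last by apply/negP; rewrite -ltNge.
  split=> //=; have [_ Tf] := arrivedP An.
  have Tfin : jump_time S n w \is a fin_num by rewrite -Tf.
  by rewrite EFinB Tf leeBrDl// -jump_timeS.
- move=> [[An Sn] /negP]; rewrite -ltNge => S0.
  have [_ Tf] := arrivedP An.
  have Tfin : jump_time S n w \is a fin_num by rewrite -Tf.
  split=> [i|]; last by move: Sn => /=; rewrite EFinB Tf leeBrDl// -jump_timeS.
  by rewrite ltnS leq_eqVlt => /predU1P[->//|]; exact: An.1.
Qed.

Lemma arrivedW n t : arrived n.+1 t `<=` arrived n t.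
Proof. by rewrite arrivedS => w [[]]. Qed.

Lemma history_arrived n t : hist n (arrived n t).
Proof.
rewrite (_ : arrived n t = (\bigcap_(i in `I_n) [set w | 0%E < S i w]) `&`
    [set w | jump_time S n w <= t%:E]); last first.
  by apply/seteqP; split => w [].
apply: (@measurableI _ (hT n)).
  apply: (@fin_bigcap_measurable _ (hT n)) => // i ni.
  rewrite -[X in measurable X]setTI; apply: emeasurable_fun_o_infty => //.
  exact: history_S.
rewrite -[X in measurable X]setTI; apply: emeasurable_fun_infty_c => //.
exact: history_jump_time.
Qed.

Lemma measurable_arrived n t : measurable (arrived n t).
Proof. exact: history_measurable (@history_arrived n t). Qed.

Lemma measurable_remaining n (t : R) :
  measurable_fun setT (fun w => t - fine (jump_time S n w))%R.
Proof.
apply: measurable_funB => //; apply: measurableT_comp => //.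
exact: measurable_jump_time.
Qed.

(** [freezing] applied to [jump_step], U being the time left after the n-th arrival: it is random
    but known from the history, and nonnegative on [arrived n t]. *)
Lemma jump_arrival n (t : R) (A B : set T) : measurable A -> measurable B ->
  Pr (arrived n.+1 t `&` Y n @^-1` A `&` Y n.+1 @^-1` B) =
  \int[Pr]_(w in arrived n t `&` Y n @^-1` A)
    ((1 - expR (- (lam (Y n w) * (t - fine (jump_time S n w)))))%:E * k (Y n w) B).
Proof.
move=> mA mB.
have hA : hist n (arrived n t `&` Y n @^-1` A).
  apply: historyI; first exact: history_arrived.
  by have := history_Y (leqnn n) measurableT mA; rewrite setTI.
have mYB := measurable_preY n.+1 mB.
rewrite -(@freezing _ _ _ _ (hist n) (fun w => t - fine (jump_time S n w))%R
   (fun w => lam (Y n w)) (S n) (fun w => k (Y n w) B) (Y n.+1 @^-1` B) L)//.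
- rewrite arrivedS.
  have mD : measurable [set w | S n w <= (t - fine (jump_time S n w))%:E].
    rewrite -[X in measurable X]setTI; apply: emeasurable_fun_le => //.
    by apply/measurable_EFinP; exact: measurable_remaining.
  rewrite -[RHS](measureD_null _ (measurable_le_S n 0) (sojourn_gt0 n)).
    congr (Pr _); apply/seteqP; split=> w /=; first by move=> [[[[? ?] ?] ?] ?].
    by move=> [[[[? ?] ?] ?] ?].
  by apply: measurableI => //; apply: measurableI => //; exact: history_measurable hA.
- exact: history_measurable.
- exact: historyI.
- move=> a b.
  have m1 : measurable_fun (setT : set (hT n)) (fun w : hT n => t - fine (jump_time S n w))%R.
    by apply: measurable_funB => //; apply: measurableT_comp => //; exact: history_jump_time.
  have := m1 measurableT `[a, b[%classic (measurable_itv _).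
  by rewrite setTI /preimage /=; congr (hist n); apply/funext => w /=; rewrite in_itv.
- exact: measurable_remaining.
- exact: measurable_lamY.
- exact: measurable_kY.
- by move=> w; exact: ker_le1.
- by move=> H s hH s0; exact: jump_step.
- by move=> w [/arrivedP[/andP[_ ?] _] _]; rewrite subr_ge0.
Qed.

End jump_chain_step.

(** * The Dynkin formula *)

Section weighted_law.
Context d1 d2 (W : measurableType d1) (T : measurableType d2) (R : realType).
Variables (m : {measure set W -> \bar R}) (A A' : set W) (c : W -> R).
Variables (q : W -> {measure set T -> \bar R}) (Z : W -> T).
Hypotheses (mA : measurable A) (mA' : measurable A').
Hypotheses (mc : measurable_fun A c) (c0 : forall w, A w -> 0 <= c w).
Hypothesis mq : forall U, measurable U -> measurable_fun setT (q ^~ U).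
Hypothesis mZ : measurable_fun setT Z.
Local Open Scope ereal_scope.

(** Extends an identity between events to nonnegative functions. Three laws are treated in this way:
    the state being left, the next state, and the state occupied at time t; q is a Dirac mass or the
    jump kernel accordingly. *)
Lemma ge0_integral_weighted_law :
  (forall U, measurable U ->
    m (A' `&` Z @^-1` U) = \int[m]_(w in A) ((c w)%:E * q w U)) ->
  forall f, measurable_fun setT f -> (forall x, 0 <= f x) ->
  \int[m]_(w in A') f (Z w) = \int[m]_(w in A) ((c w)%:E * \int[q w]_x f x).
Proof.
have mker f : measurable_fun setT f -> (forall x, 0 <= f x) ->
    measurable_fun A (fun w => \int[q w]_x f x).
  by move=> mf f0; apply: measurable_funTS; exact: measurable_fun_integral_kernel.
have mck f : measurable_fun setT f -> (forall x, 0 <= f x) ->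
    measurable_fun A (fun w => (c w)%:E * \int[q w]_x f x).
  by move=> mf f0; apply: emeasurable_funM; [exact/measurable_EFinP|exact: mker].
have ck0 f : (forall x, 0 <= f x) ->
    forall w, A w -> 0 <= (c w)%:E * \int[q w]_x f x.
  by move=> f0 w Aw; rewrite mule_ge0 ?lee_fin ?c0//; exact: integral_ge0.
have mfZ (f : T -> \bar R) : measurable_fun setT f ->
    measurable_fun A' (fun w => f (Z w)).
  by move=> mf; apply: measurable_funTS; exact: measurableT_comp.
move=> mE; apply: ge0_measurable_fun_ind.
- move=> U mU; transitivity (m (A' `&` Z @^-1` U)).
    rewrite setIC -integral_indic// -[X in measurable X]setTI; exact: mZ.
  rewrite mE//; apply: eq_integral => w _.
  by rewrite integral_indic// setIT.
- move=> r f r0 mf f0 IH; rewrite ge0_integralZl_EFin//; last exact: mfZ.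
  rewrite IH -ge0_integralZl_EFin//; [|exact: ck0|exact: mck].
  apply: eq_integral => w _; rewrite ge0_integralZl_EFin//.
  by rewrite muleCA.
- move=> f g mf f0 IHf mg g0 IHg.
  rewrite ge0_integralD//; [|exact: mfZ|exact: mfZ].
  rewrite IHf IHg -ge0_integralD//; [|exact: ck0|exact: mck|exact: ck0|exact: mck].
  apply: eq_integral => w _; rewrite ge0_integralD//.
  by apply/esym/ge0_muleDr; apply: integral_ge0 => x _.
- move=> f_ mf f0 nd IH.
  rewrite monotone_convergence//; last by move=> n; exact: mfZ.
  under eq_fun do rewrite IH.
  rewrite -monotone_convergence//; last 3 first.
  - by move=> n; exact: mck.
  - by move=> n; exact: ck0.
  - move=> w Aw i j ij; apply: lee_wpmul2l; first by rewrite lee_fin c0.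
    by apply: ge0_le_integral => // x _; exact: nd.
  apply: eq_integral => w _; rewrite monotone_convergence//.
  rewrite limeMl//; apply: ereal_nondecreasing_is_cvgn => i j ij.
  by apply: ge0_le_integral => // x _; exact: nd.
Qed.

End weighted_law.

Section exponential_clock.
Context {R : realType}.
Local Notation leb := (@lebesgue_measure R).

Lemma integral_expRN_window (l s t : R) : s <= t ->
  (\int[leb]_(r in `[s, t]) (l * expR (- (l * (r - s))))%:E
   = (1 - expR (- (l * (t - s))))%:E)%E.
Proof.
rewrite le_eqVlt => /predU1P[->|st].
  by rewrite set_itv1 integral_set1 subrr mulr0 oppr0 expR0 subrr.
pose F r := - expR (- (l * (r - s))).
have dF r : is_derive r (1 : R) F (l * expR (- (l * (r - s)))).
  have h : is_derive r (1 : R) (fun r : R => - (l * (r - s))) (- l).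
    by apply: is_derive_eq; rewrite subr0 /GRing.scale/= mulr1.
  have hF := is_deriveN (@is_derive1_comp _ expR (fun r : R => - (l * (r - s))) r _ _ (is_derive_expR _) h).
  by apply: (is_derive_eq hF); rewrite mulrN opprK mulrC.
rewrite (@continuous_FTC2 _ _ F)//.
- by rewrite /F subrr mulr0 oppr0 expR0 -EFinB opprK addrC.
- apply: continuous_subspaceT => r.
  apply: cvgM; first exact: cvg_cst.
  apply: continuous_comp; last exact: continuous_expR.
  by apply: cvgN; apply: cvgM; [exact: cvg_cst|apply: cvgB => //; exact: cvg_cst].
- have cF r : {for r, continuous F}.
    by apply: differentiable_continuous; apply/derivable1_diffP; have [] := dF r.
  split; [by move=> r _; have [] := dF r | by apply: cvg_at_right_filter; exact: cF | by apply: cvg_at_left_filter; exact: cF].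
- by move=> r _; rewrite derive1E; apply: derive_val.
Qed.

End exponential_clock.

Lemma nneseries_shift1 (R : realType) (a : nat -> \bar R) :
  (forall n, 0 <= a n)%E ->
  (\sum_(1 <= n <oo) a n = \sum_(0 <= n <oo) a n.+1)%E.
Proof.
move=> a0; pose u N := (\sum_(1 <= n < N) a n)%E.
apply/esym/cvg_lim => //.
have : u @ \oo --> (\sum_(1 <= n <oo) a n)%E by apply: is_cvg_nneseries => n _ _.
rewrite -(cvg_shiftS u); apply: cvg_trans; apply: near_eq_cvg.
by apply: nearW => N /=; rewrite /u big_add1.
Qed.

Section dynkin.
Context (R : realType) (dT : measure_display) (T : measurableType dT).
Context (dO : measure_display) (Omega : measurableType dO) (Pr : probability Omega R).
Variables (lam : T -> R) (k : R.-pker T ~> T).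
Variables (Y : nat -> {RV Pr >-> T}) (S : nat -> {RV Pr >-> \bar R}) (L : R).
Hypotheses (mlam : measurable_fun setT lam) (lam0 : forall x, 0 <= lam x).
Hypothesis lamL : forall x, lam x <= L.
Hypothesis chain : jump_chain lam k Y S.
Local Open Scope ereal_scope.
Local Notation leb := (@lebesgue_measure R).
Local Notation arr := (arrived S).
Local Notation wt n t w := (expR (- (lam (Y n w) * (t - fine (jump_time S n w))))).
Implicit Types (f g : T -> \bar R).

Let mwt n t : measurable_fun setT (fun w => wt n t w).
Proof.
apply: measurableT_comp => //; apply: measurableT_comp => //.
apply: measurable_funM; first exact: (measurable_lamY Y mlam).
exact: (measurable_remaining S).
Qed.

Let wt_ge0 n t w : arr n t w -> (0 <= 1 - wt n t w)%R.
Proof.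
by move=> /arrivedP[/andP[_ Tt] _]; rewrite onem_expRN_ge0// mulr_ge0// subr_ge0.
Qed.

Let mfY f n : measurable_fun setT f -> measurable_fun setT (fun w => f (Y n w)).
Proof. by move=> mf; apply: measurableT_comp => //; exact: measurable_funP. Qed.

Let mdirac U n : measurable U -> measurable_fun setT (fun w => (\d_(Y n w))%R U : \bar R).
Proof.
move=> mU; rewrite [X in measurable_fun _ X](_ : _ = EFin \o \1_(Y n @^-1` U)).
  by apply/measurable_EFinP; apply: measurable_indic; exact: (measurable_preY Y).
by apply/funext => w; rewrite diracE.
Qed.

Let diracYE U n w :
  ((\d_(Y n w))%R : {measure set T -> \bar R}) U = (w \in Y n @^-1` U)%:R%:E.
Proof. exact: diracE. Qed.

Let integral_diracY f n w : measurable_fun setT f ->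
  \int[(\d_(Y n w))%R]_x f x = f (Y n w).
Proof. by move=> mf; rewrite integral_dirac// diracT mul1e. Qed.

Let measurable_arr n t : measurable (arr n t). Proof. exact: (measurable_arrived Y). Qed.

(** Given the past up to the n-th arrival, [1 - wt n t] is the probability of leaving Y n by time t.
    Since Y n is already known, its conditional law is a Dirac mass. *)
Lemma integral_arrivedS f n t : measurable_fun setT f -> (forall x, 0 <= f x) ->
  \int[Pr]_(w in arr n.+1 t) f (Y n w) =
  \int[Pr]_(w in arr n t) ((1 - wt n t w)%:E * f (Y n w)).
Proof.
move=> mf f0.
rewrite (@ge0_integral_weighted_law _ _ _ _ _ Pr (arr n t) (arr n.+1 t)
  (fun w => 1 - wt n t w)%R (fun w => (\d_(Y n w))%R) (Y n))//.
- by apply: eq_integral => w _; rewrite integral_diracY.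
- by apply: measurable_funTS; apply: measurable_funB => //; exact: mwt.
- by move=> w; exact: wt_ge0.
- by move=> U mU; exact: mdirac.
- move=> U mU; have := jump_arrival mlam lam0 lamL chain n t mU measurableT.
  rewrite preimage_setT setIT => E; apply: (etrans E) => {E}.
  rewrite integral_mkcondr; apply: eq_integral => w _.
  rewrite diracYE /patch prob_kernel mule1.
  by case: ifPn => _; rewrite ?mule1// mule0.
Qed.

Lemma integral_arrived_next f n t : measurable_fun setT f -> (forall x, 0 <= f x) ->
  \int[Pr]_(w in arr n.+1 t) f (Y n.+1 w) =
  \int[Pr]_(w in arr n t) ((1 - wt n t w)%:E * \int[k (Y n w)]_x f x).
Proof.
move=> mf f0.
apply: (@ge0_integral_weighted_law _ _ _ _ _ Pr (arr n t) (arr n.+1 t)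
  (fun w => 1 - wt n t w)%R (fun w => k (Y n w)) (Y n.+1)) => //.
- by apply: measurable_funTS; apply: measurable_funB => //; exact: mwt.
- by move=> w; exact: wt_ge0.
- by move=> U mU; exact: (measurable_kY k Y).
- move=> U mU; have := jump_arrival mlam lam0 lamL chain n t measurableT mU.
  by rewrite preimage_setT !setIT.
Qed.

(** The difference of two consecutive arrival events is the event of sitting in Y n at time t; its
    conditional probability is complementary to that of [integral_arrivedS]. *)
Lemma integral_present f n t : measurable_fun setT f -> (forall x, 0 <= f x) ->
  \int[Pr]_(w in arr n t `\` arr n.+1 t) f (Y n w) =
  \int[Pr]_(w in arr n t) ((wt n t w)%:E * f (Y n w)).
Proof.
move=> mf f0.
rewrite (@ge0_integral_weighted_law _ _ _ _ _ Pr (arr n t) (arr n t `\` arr n.+1 t)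
  (fun w => wt n t w)%R (fun w => (\d_(Y n w))%R) (Y n))//.
- by apply: eq_integral => w _; rewrite integral_diracY.
- exact: measurableD.
- by apply: measurable_funTS; exact: mwt.
- by move=> U mU; exact: mdirac.
- move=> U mU.
  have mYU : measurable (Y n @^-1` U) by exact: (measurable_preY Y).
  apply: (@addeIr_fin _ _ _ (Pr (arr n.+1 t `&` Y n @^-1` U))).
    by apply: fin_num_measure; exact: measurableI.
  have mU1 : measurable_fun setT (fun x : T => (\1_U x)%:E : \bar R).
    exact/measurable_EFinP/measurable_indic.
  have E1 : Pr (arr n.+1 t `&` Y n @^-1` U) = \int[Pr]_(w in arr n.+1 t) (\1_U (Y n w))%:E.
    by rewrite setIC -integral_indic.
  have E2 := integral_arrivedS n t mU1.
  rewrite [in RHS]E1 E2//.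
  have -> : \int[Pr]_(w in arr n t) ((1 - wt n t w)%:E * (\1_U (Y n w))%:E) =
     \int[Pr]_(w in arr n t) ((1 - wt n t w)%:E * (\d_(Y n w))%R U).
    by apply: eq_integral => w _; rewrite diracE.
  rewrite -ge0_integralD//; last 3 first.
  - by apply: measurable_funTS; apply: emeasurable_funM; [exact/measurable_EFinP/mwt|exact: mdirac].
  - by move=> w aw; rewrite mule_ge0// lee_fin wt_ge0.
  - apply: measurable_funTS; apply: emeasurable_funM; last exact: mdirac.
    by apply/measurable_EFinP/measurable_funB => //; exact: mwt.
  transitivity (Pr (arr n t `&` Y n @^-1` U)).
    rewrite -measureU//; last 3 first.
    + by apply: measurableI => //; exact: measurableD.
    + exact: measurableI.
    + by apply/seteqP; split=> // w [[[_ ?] _] [? _]].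
    rewrite -setIUl; congr (Pr (_ `&` _)); apply/seteqP; split => w.
      by move=> [[]//|]; exact: arrivedW.
    by move=> aw; have [?|?] := pselect (arr n.+1 t w); [right|left].
  rewrite setIC -integral_indic//; apply: eq_integral => w /[!inE] aw.
  rewrite diracE -ge0_muleDl ?lee_fin ?expR_ge0//.
    by rewrite -EFinD addrC subrK mul1e.
  exact: wt_ge0.
Qed.

(** Joint measurability in the outcome and the time, needed to exchange the two integrals by
    Tonelli's theorem. *)
Lemma measurable_arrived_time n : measurable [set z : Omega * R | arr n z.2 z.1].
Proof.
pose pos := [set w : Omega | forall i, (i < n)%N -> 0 < S i w].
have mpos : measurable pos.
  rewrite (_ : pos = \bigcap_(i in `I_n) [set w | 0%E < S i w])//.
  by apply: fin_bigcap_measurable => // i _; exact: (measurable_gt_S S i 0).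
rewrite (_ : [set _ | _] = (pos `*` setT) `&` [set z | jump_time S n z.1 <= (z.2)%:E]);
  last by apply/seteqP; split=> -[w r] /=; [move=> [? ?]|move=> [[? _] ?]].
apply: measurableI; first exact: measurableX.
rewrite -[X in measurable X]setTI; apply: emeasurable_fun_le => //.
  by apply: measurableT_comp => //; exact: measurable_jump_time.
by apply/measurable_EFinP; exact: measurable_snd.
Qed.

(* Fubini: the jump rate integrated along the sojourn in Y n equals the
   conditional probability of having left Y n by time t. *)
Lemma integral_time_present f n t : (0 <= t)%R ->
  measurable_fun setT f -> (forall x, 0 <= f x) ->
  \int[Pr]_(w in arr n t) ((1 - wt n t w)%:E * f (Y n w)) =
  \int[leb]_(r in `[0%R, t]) \int[Pr]_(w in arr n r `\` arr n.+1 r)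
     ((lam (Y n w))%:E * f (Y n w)).
Proof.
move=> t0 mf f0.
have mlf : measurable_fun setT (fun x => (lam x)%:E * f x).
  by apply: emeasurable_funM => //; exact/measurable_EFinP.
have lf0 x : 0 <= (lam x)%:E * f x by rewrite mule_ge0// lee_fin.
pose G := [set z : Omega * R | arr n z.2 z.1 /\ (0 <= z.2 <= t)%R].
have mT := measurable_jump_time S n.
have mG : measurable G.
  rewrite (_ : G = [set z : Omega * R | arr n z.2 z.1] `&` snd @^-1` `[0%R, t]%classic).
    apply: measurableI; first exact: measurable_arrived_time.
    by rewrite -[X in measurable X]setTI; exact: measurable_snd.
  by apply/seteqP; split => -[w r] /=; rewrite in_itv.
pose h (z : Omega * R) := (expR (- (lam (Y n z.1) * (z.2 - fine (jump_time S n z.1)))))%:E *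
  ((lam (Y n z.1))%:E * f (Y n z.1)).
have mh : measurable_fun setT h.
  have mY1 : measurable_fun setT (fun z : Omega * R => Y n z.1).
    by apply: measurableT_comp; [exact: measurable_funP|exact: measurable_fst].
  apply: emeasurable_funM; last first.
    exact: (measurableT_comp mlf mY1).
  apply/measurable_EFinP; apply: measurableT_comp => //; apply: measurableT_comp => //.
  apply: measurable_funM; first exact: (measurableT_comp mlam mY1).
  apply: measurable_funB; first exact: measurable_snd.
  apply: measurableT_comp; first exact: fine_measurable.
  by apply: measurableT_comp => //; exact: measurable_fst.
have h0 z : 0 <= h z by rewrite mule_ge0// lee_fin expR_ge0.
have mhG : measurable_fun setT (h \_ G).
  by apply/(measurable_restrictT _ mG); exact: measurable_funTS.
have hG0 z : 0 <= (h \_ G) z by rewrite /patch; case: ifPn.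
transitivity (\int[Pr]_w \int[leb]_r (h \_ G) (w, r)); last first.
  rewrite fubini_tonelli// [RHS]integral_mkcond; apply: eq_integral => r _.
  rewrite [RHS]/patch; case: ifPn => [|r0].
    rewrite inE/= in_itv/= => r0.
    rewrite (integral_present _ _ mlf lf0) [RHS]integral_mkcond; apply: eq_integral => w _.
    rewrite /patch; have [aw|aw] := pselect (arr n r w).
      by rewrite !mem_set.
    by rewrite !memNset// => -[].
  rewrite integral0_eq// => w _; rewrite /patch memNset// => -[_ /= r0'].
  by move: r0; rewrite notin_setE; apply; rewrite /= in_itv.
rewrite integral_mkcond; apply: eq_integral => w _.
rewrite [LHS]/patch; case: ifPn => [|aw]; last first.
  rewrite integral0_eq// => r _; rewrite /patch memNset// => -[[p /= Tr] /andP[_ rt]].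
  move: aw; rewrite notin_setE; apply; split=> //.
  by apply: (le_trans Tr); rewrite lee_fin.
rewrite inE => aw; have [/andP[T0 Tt] TE] := arrivedP aw.
set T1 := fine _ in T0 Tt TE *.
(* For a fixed outcome, the times r selected by G form the window from the n-th arrival to t, over
   which the exponential density is integrated. *)
rewrite -(integral_expRN_window (lam (Y n w)) Tt) -ge0_integralZr//; last 2 first.
- apply: measurable_funTS; apply/measurable_EFinP.
  apply: measurable_funM => //; apply: measurableT_comp => //; apply: measurableT_comp => //.
  by apply: measurable_funM => //; exact: measurable_funB.
- by move=> r; rewrite /= in_itv/= => /andP[Tr _]; rewrite lee_fin mulr_ge0// expR_ge0.
rewrite [LHS]integral_mkcond; apply: eq_integral => r _.
rewrite /patch; case: ifPn => [|rT].
  rewrite inE/= in_itv/= => /andP[Tr rt].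
  rewrite mem_set /h/= -/T1 ?EFinM ?muleA ?[in LHS](muleC (lam _)%:E)//.
  split=> /=; last by rewrite rt (le_trans T0 Tr).
  by split; [case: aw|rewrite -TE lee_fin].
rewrite memNset// => -[[_ /= Tr] /andP[_ rt]].
move: rT; rewrite notin_setE; apply; rewrite /= in_itv/= rt andbT.
by rewrite -lee_fin TE.
Qed.

Lemma measurable_time_present f n : measurable_fun setT f -> (forall x, 0 <= f x) ->
  measurable_fun setT (fun r : R => \int[Pr]_(w in arr n r `\` arr n.+1 r) f (Y n w)).
Proof.
move=> mf f0.
pose G := [set z : Omega * R | arr n z.2 z.1] `\` [set z : Omega * R | arr n.+1 z.2 z.1].
have mG : measurable G by apply: measurableD; exact: measurable_arrived_time.
pose h (z : Omega * R) := f (Y n z.1).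
have mh : measurable_fun setT h.
  by apply: (measurableT_comp (mfY n mf)); exact: measurable_fst.
have mhG : measurable_fun setT (h \_ G).
  by apply/(measurable_restrictT _ mG); exact: measurable_funTS.
have hG0 z : 0 <= (h \_ G) z by rewrite /patch; case: ifPn => // _; exact: f0.
have := measurable_fun_fubini_tonelli_G (m1 := Pr) (h \_ G) mhG hG0.
apply: eq_measurable_fun => r _; rewrite /fubini_G [RHS]integral_mkcond.
apply: eq_integral => w _; rewrite /patch.
have [aw|aw] := pselect ((arr n r `\` arr n.+1 r) w); first by rewrite !mem_set.
by rewrite !memNset.
Qed.

Lemma arrived_le m n t : (m <= n)%N -> arr n t `<=` arr m t.
Proof.
move=> /subnKC <-; elim: (n - m)%N => [|i IH]; first by rewrite addn0.
by rewrite addnS => w /arrivedW; exact: IH.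
Qed.

(** Each further arrival costs a factor at most 1 - exp(- L t), since the intensity is at most L and
    the remaining time at most t. The geometric decay rules out explosion. *)
Lemma measure_arrived n t : (0 <= t)%R ->
  Pr (arr n t) <= ((1 - expR (- (L * t))) ^+ n)%:E.
Proof.
move=> t0; have L0 : (0 <= L)%R by exact: le_trans (lam0 point) (lamL point).
set rho := (1 - _)%R.
have rho0 : (0 <= rho)%R by rewrite onem_expRN_ge0// mulr_ge0.
elim: n => [|n IH]; first by rewrite expr0 probability_le1.
have := integral_arrivedS (f := cst 1) n t (measurable_cst _) (fun=> lee01).
rewrite integral_cst// mul1e => ->.
apply: (@le_trans _ _ (\int[Pr]_(w in arr n t) rho%:E)); last first.
  by rewrite integral_cst// exprS EFinM lee_wpmul2l.
apply: ge0_le_integral => //.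
- by move=> w aw; rewrite mule1 lee_fin wt_ge0.
- apply: emeasurable_funM => //; apply/measurable_EFinP/measurable_funTS.
  by apply: measurable_funB => //; exact: mwt.
- move=> w aw; rewrite mule1 lee_fin /rho lerB// ler_expR lerN2.
  have [/andP[T0 Tt] _] := arrivedP aw.
  by rewrite ler_pM// ?subr_ge0// gerBl.
Qed.

Lemma measure_explosion t : (0 <= t)%R -> Pr (\bigcap_n arr n t) = 0.
Proof.
move=> t0; have L0 : (0 <= L)%R by exact: le_trans (lam0 point) (lamL point).
have mN : measurable (\bigcap_n arr n t) by exact: bigcapT_measurable.
have Nfin : Pr (\bigcap_n arr n t) \is a fin_num by exact: fin_num_measure.
apply/eqP; rewrite eq_le measure_ge0 andbT -(fineK Nfin) lee_fin.
have rho1 : (`|1 - expR (- (L * t))| < 1)%R.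
  by rewrite ger0_norm ?onem_expRN_ge0 ?mulr_ge0// gtrBl expR_gt0.
have := cvg_expr rho1 => /cvg_lim => /(_ (@Rhausdorff R)) <-.
apply: limr_ge; first by apply/cvg_ex; exists 0%R; exact: cvg_expr.
apply: nearW => n; rewrite -lee_fin (fineK Nfin).
apply: (le_trans _ (measure_arrived n t0)).
by apply: le_measure; rewrite ?inE//; exact: bigcap_inf.
Qed.

Variable X : R -> {RV Pr >-> T}.
Hypothesis visits : {ae Pr, forall w, forall (n : nat) (t : R), (0 <= t)%R ->
  jump_time S n w <= t%:E < jump_time S n.+1 w -> X t w = Y n w}.

Lemma sojourns_gt0 : {ae Pr, forall w, forall n, 0 < S n w}.
Proof.
apply: ae_foralln => n; exists [set w | S n w <= 0]; split.
- exact: measurable_le_S.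
- exact: sojourn_gt0 chain n.
- by move=> w /= /negP; rewrite -leNgt.
Qed.

(** Off the null explosion event, exactly one n has its arrival, but not the next one, before t;
    there the process is a.e. equal to Y n. *)
Lemma integral_process f t : (0 <= t)%R ->
  measurable_fun setT f -> (forall x, 0 <= f x) ->
  \int[Pr]_w f (X t w) =
  \sum_(0 <= n <oo) \int[Pr]_(w in arr n t `\` arr n.+1 t) f (Y n w).
Proof.
move=> t0 mf f0.
have mfX : measurable_fun setT (fun w => f (X t w)).
  by apply: measurableT_comp => //; exact: measurable_funP.
have mN : measurable (\bigcap_n arr n t) by exact: bigcapT_measurable.
rewrite (ge0_negligible_integral mN measurableT mfX)//; last exact: measure_explosion.
have -> : [set: Omega] `\` \bigcap_n arr n t = \bigcup_n (arr n t `\` arr n.+1 t).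
  apply/seteqP; split=> [w [_ Nw]|w [n _ [_ aw]]]; last by split=> // /(_ n.+1 I).
  have [m Nm] : exists m, ~ arr m t w.
    by apply: contrapT => /forallNP h; apply: Nw => n _; apply: contrapT; exact: h.
  elim: m Nm => [|m IH] Nm; first by exfalso; apply: Nm; rewrite arrived0.
  by have [am|/IH//] := pselect (arr m t w); exists m.
rewrite ge0_integral_bigcup//; last 3 first.
- by move=> n; exact: measurableD.
- exact: measurable_funTS.
- apply/trivIsetP => i j _ _ ij; apply/seteqP; split=> // w [[ai nai] [aj naj]].
  by move: ij; rewrite neq_ltn => /orP[ij|ji];
    [apply: nai; exact: arrived_le aj|apply: naj; exact: arrived_le ai].
apply: eq_eseriesr => n _.
apply: ge0_ae_eq_integral => //.
- exact: measurableD.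
- exact: measurable_funTS.
- by apply: measurable_funTS; exact: mfY.
(* Once all sojourns are positive, failing to belong to [arr n.+1 t] can only mean that the next
   jump time exceeds t, as [visits] requires. *)
apply: filterS2 visits sojourns_gt0 => w vis pos [[_ Tt] naw].
rewrite (vis n)// Tt ltNge; apply/negP => Tt'.
by apply: naw; split=> // i _; exact: pos.
Qed.

Let measurable_int_ker f : measurable_fun setT f -> (forall x, 0 <= f x) ->
  measurable_fun setT (fun x => \int[k x]_y f y).
Proof.
by move=> mf f0; apply: measurable_fun_integral_kernel => // U; exact: measurable_kernel.
Qed.

(** Both sides are the mean of the sum, over the jumps made by time t, of f at the state that is
    left. *)
Lemma integral_time_process f t : (0 <= t)%R ->
  measurable_fun setT f -> (forall x, 0 <= f x) ->
  \int[leb]_(r in `[0%R, t]) \int[Pr]_w ((lam (X r w))%:E * f (X r w)) =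
  \sum_(0 <= n <oo) \int[Pr]_(w in arr n t) ((1 - wt n t w)%:E * f (Y n w)).
Proof.
move=> t0 mf f0.
have mlf : measurable_fun setT (fun x => (lam x)%:E * f x).
  by apply: emeasurable_funM => //; exact/measurable_EFinP.
have lf0 x : 0 <= (lam x)%:E * f x by rewrite mule_ge0// lee_fin.
transitivity (\int[leb]_(r in `[0%R, t]) \sum_(0 <= n <oo)
    \int[Pr]_(w in arr n r `\` arr n.+1 r) ((lam (Y n w))%:E * f (Y n w))).
  apply: eq_integral => r; rewrite inE/= in_itv/= => /andP[r0 _].
  exact: (integral_process r0 mlf lf0).
rewrite integral_nneseries//; last 2 first.
- by move=> n; apply: measurable_funTS; exact: (measurable_time_present n mlf lf0).
- by move=> n r _; apply: integral_ge0 => w _; exact: lf0.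
by apply: eq_eseriesr => n _; rewrite integral_time_present.
Qed.

(** Both sides equal the sum over n of the integrals of f(Y_n) over [arr n t]. On the left each
    state reached is either still occupied or already left; on the right it is either the initial
    state or the target of a jump. All terms being nonnegative, infinite values are allowed. *)
Lemma dynkin_formula f t : (0 <= t)%R -> measurable_fun setT f -> (forall x, 0 <= f x) ->
  \int[Pr]_w f (X t w) +
    \int[leb]_(r in `[0%R, t]) \int[Pr]_w ((lam (X r w))%:E * f (X r w)) =
  \int[Pr]_w f (X 0%R w) +
    \int[leb]_(r in `[0%R, t]) \int[Pr]_w ((lam (X r w))%:E * \int[k (X r w)]_y f y).
Proof.
move=> t0 mf f0.
have mkf := measurable_int_ker mf f0.
have kf0 x : 0 <= \int[k x]_y f y by exact: integral_ge0.
have int0 n (A : set Omega) g : (forall x, 0 <= g x) -> 0 <= \int[Pr]_(w in A) g (Y n w).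
  by move=> g0; apply: integral_ge0.
rewrite (integral_time_process t0 mf f0) (integral_time_process t0 mkf kf0).
under eq_eseriesr do rewrite -integral_arrivedS//.
under [in RHS]eq_eseriesr do rewrite -integral_arrived_next//.
rewrite (integral_process t0 mf f0) -nneseriesD//; [|by move=> n _ _; exact: int0..].
have X0 : \int[Pr]_w f (X 0%R w) = \int[Pr]_(w in arr 0 t) f (Y 0 w).
  rewrite (integral_process (lexx 0%R) mf f0) nneseries_recl//; last by move=> n _; exact: int0.
  (* At time 0 only the initial state has been reached, because [arrived] asks for positive
     sojourns. *)
  have arr0 n : arr n.+1 0%R = set0.
    apply/seteqP; split=> // w [pos]; rewrite leNgt => /negP; apply.
    rewrite jump_timeS (@lt_le_trans _ _ (S n w)) ?pos// leeDr//.
    by apply: sume_ge0 => i _; apply: ltW; apply: pos; rewrite ltnS ltnW.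
  rewrite eseries0 ?adde0; last first.
    by move=> [//|n] _ _; rewrite arr0 set0D integral_set0.
  by rewrite arr0 setD0 !arrived0.
rewrite X0.
transitivity (\sum_(0 <= n <oo) \int[Pr]_(w in arr n t) f (Y n w)).
  apply: eq_eseriesr => n _; rewrite -ge0_integral_setU//.
  - congr (integral _ _ _); apply/seteqP; split=> w.
      by move=> [[]//|]; exact: arrivedW.
    by move=> aw; have [?|?] := pselect (arr n.+1 t w); [right|left].
  - exact: measurableD.
  - by apply: measurable_funTS; exact: mfY.
  - by apply/disj_setPS => w [[_ ?] ?].
rewrite nneseries_recl//; last by move=> n _; exact: int0.
by rewrite nneseries_shift1// => n; exact: int0.
Qed.

End dynkin.

(** * Poisson series and uniformization *)

Lemma lebesgue_itv_lty (R : realType) (ba bb : bool) (a b : R) :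
  (@lebesgue_measure R [set` Interval (BSide ba a) (BSide bb b)] < +oo)%E.
Proof. by rewrite lebesgue_measure_itv; case: ifP => // _; rewrite -EFinB ltry. Qed.

Section exp_coeff_facts.
Context {R : realType}.
Implicit Types (L t x : R) (c : nat -> R).

Lemma is_derive_exp_coeffS L n t :
  is_derive t (1 : R) (fun s => exp_coeff (L * s) n.+1 : R) (L * exp_coeff (L * t) n).
Proof.
have h : is_derive t (1 : R) (fun s : R => L * s) L.
  by apply: is_derive_eq; rewrite /GRing.scale/= mulr1.
have hX := is_deriveX n.+1 h.
have -> : (fun s => exp_coeff (L * s) n.+1 : R) = (n.+1)`!%:R^-1 *: ((fun s : R => L * s) ^+ n.+1).
  by apply/funext => s; rewrite /exp_coeff /= /GRing.scale/= exprfctE mulrC.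
apply: is_derive_eq; rewrite /exp_coeff /= /GRing.scale/= factS natrM invfM.
have n0 : n.+1%:R != 0 :> R by rewrite pnatr_eq0.
have f0 : n`!%:R != 0 :> R by rewrite pnatr_eq0 -lt0n fact_gt0.
by move: (n.+1%:R : R) (n`!%:R : R) n0 f0 => a b a0 b0; field; rewrite a0 b0.
Qed.

Lemma is_derive_exp_coeff_sum L c N t :
  is_derive t (1 : R) (fun s => \sum_(n < N.+1) exp_coeff (L * s) n * c n)
    (L * \sum_(n < N) exp_coeff (L * t) n * c n.+1).
Proof.
elim: N => [|N IH].
  rewrite big_ord0 mulr0 (_ : (fun _ => _) = cst (c 0%N)); first exact: is_derive_cst.
  by apply/funext => s; rewrite big_ord1 /exp_coeff /= expr0 fact0 divr1 mul1r.
have -> : (fun s => \sum_(n < N.+2) exp_coeff (L * s) n * c n) =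
   (fun s => \sum_(n < N.+1) exp_coeff (L * s) n * c n) +
   c N.+1 *: (fun s => exp_coeff (L * s) N.+1).
  by apply/funext => s; rewrite big_ord_recr /=; congr (_ + _); exact: mulrC.
have h := is_derive_exp_coeffS L N t.
apply: (is_derive_eq (is_deriveD IH (is_deriveZ (c N.+1) h))).
rewrite [in RHS]big_ord_recr /= mulrDr /GRing.scale/=; congr (_ + _).
by rewrite mulrA mulrC.
Qed.

Lemma lipschitz_fun_continuous (f : R -> R) L : (forall x y, `|f x - f y| <= L * `|x - y|) ->
  continuous f.
Proof.
move=> lip x; apply/cvgrPdist_le => e e0.
have L1 : 0 < `|L| + 1 by rewrite ltr_wpDl.
near=> y; apply: (le_trans (lip x y)).
have : `|x - y| <= e / (`|L| + 1).
  near: y; apply: cvgr_dist_le; first exact: cvg_id.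
  exact: divr_gt0.
rewrite ler_pdivlMr// => /(le_trans _); apply.
by rewrite mulrC ler_wpM2l// (le_trans (ler_norm L))// lerDl.
Unshelve. all: by end_near. Qed.

End exp_coeff_facts.

Section poisson_expansion.
Context {R : realType}.
Local Notation leb := (@lebesgue_measure R).
Variables (L : R) (u : nat -> R -> R).
Hypothesis L0 : 0 < L.
Hypothesis u01 : forall j t, 0 <= t -> 0 <= u j t <= 1.
Hypothesis meas_u : forall j, measurable_fun (`[0, +oo[%classic : set R) (u j).
Hypothesis uE : forall j t, 0 <= t ->
  u j t + L * \int[leb]_(r in `[0, t]) u j r =
  u j 0 + L * \int[leb]_(r in `[0, t]) u j.+1 r.

Let integrable_u j t : leb.-integrable `[0, t] (EFin \o u j).
Proof.
apply: measurable_bounded_integrable => //.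
- exact: lebesgue_itv_lty.
- apply: measurable_funS (meas_u j) => // r /=.
  by rewrite !in_itv/= => /andP[-> _].
- exists 1; split=> // M M1 r; rewrite /= in_itv/= => /andP[r0 _].
  have /andP[a b] := u01 j r0.
  by rewrite ger0_norm// (le_trans b)// ltW.
Qed.

Let window j s t : 0 <= s -> s <= t ->
  0 <= \int[leb]_(r in `]s, t]) u j r <= t - s.
Proof.
move=> s0 st.
have int_u : leb.-integrable `]s, t] (EFin \o u j).
  apply: integrableS (integrable_u j t) => // r; rewrite /= !in_itv/= => /andP[sr ->].
  by rewrite (le_trans s0 (ltW sr)).
have mst : fine (leb `]s, t]%classic) = t - s.
  rewrite lebesgue_measure_itv/= lte_fin; case: ltP => [_|ts] //=.
  by have -> : s = t by [apply/eqP; rewrite eq_le st ts]; rewrite subrr.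
apply/andP; split.
  apply: Rintegral_ge0 => r; rewrite /= in_itv/= => /andP[sr _].
  by have /andP[] := u01 j (le_trans s0 (ltW sr)).
rewrite -mst -[leRHS]mul1r -Rintegral_cst//; apply: le_Rintegral => //.
  apply: measurable_bounded_integrable => //; first exact: lebesgue_itv_lty.
  by exists 1; split=> // M M1 r _; rewrite /= normr1 ltW.
move=> r; rewrite /= in_itv/= => /andP[sr _].
by have /andP[] := u01 j (le_trans s0 (ltW sr)).
Qed.

(** Only measurability in time is assumed; the integral equation upgrades it to a Lipschitz bound,
    hence to the continuity needed to differentiate the integrals. *)
Let u_lip j s t : 0 <= s -> s <= t -> `|u j t - u j s| <= L * (t - s).
Proof.
move=> s0 st.
have t0 := le_trans s0 st.
have w1 := window j s0 st; have w2 := window j.+1 s0 st.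
have E i : \int[leb]_(r in `[0, t]) u i r =
    \int[leb]_(r in `[0, s]) u i r + \int[leb]_(r in `]s, t]) u i r.
  by rewrite -(@Rintegral_itvB _ _ _ _ s (integrable_u i t)) ?bnd_simp// addrC subrK.
have := uE j t0; have := uE j s0; rewrite !E.
move: (\int[leb]_(r in `]s, t]) u j r) (\int[leb]_(r in `]s, t]) u j.+1 r) w1 w2.
move=> a b /andP[a0 a1] /andP[b0 b1] es et.
have -> : u j t - u j s = L * (b - a) by lra.
rewrite normrM (gtr0_norm L0) ler_wpM2l ?(ltW L0)// ler_norml; apply/andP; split; lra.
Qed.

(** Prolonging u j by its value at 0 gives a function continuous on the whole line, so that no
    one-sided limit occurs at 0. *)
Let v j (t : R) := u j (Num.max 0 t).

Let v_lip j x y : `|v j x - v j y| <= L * `|x - y|.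
Proof.
wlog xy : x y / y <= x => [hw|].
  by have [/hw//|/ltW/hw] := leP y x; rewrite distrC [`|y - x|]distrC.
have m0 (z : R) : 0 <= Num.max 0 z by rewrite le_max lexx.
have mxy : Num.max 0 y <= Num.max 0 x by rewrite ge_max !le_max lexx xy orbT.
apply: (le_trans (u_lip j (m0 y) mxy)).
rewrite ler_wpM2l ?(ltW L0)// ger0_norm ?subr_ge0//.
by case: (leP 0 x); case: (leP 0 y) => ? ?; lra.
Qed.

Let v_cont j : continuous (v j).
Proof. exact: lipschitz_fun_continuous (v_lip j). Qed.

Let vu j t : 0 <= t -> v j t = u j t.
Proof. by move=> t0; rewrite /v max_r. Qed.

Let v_derive j (t : R) : 0 < t -> is_derive t (1 : R) (v j) (L * (v j.+1 t - v j t)).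
Proof.
move=> t0.
pose F i x := \int[leb]_(r in `[0, x]) v i r.
have intv i b : leb.-integrable `[0, b] (EFin \o v i).
  apply: eq_integrable (integrable_u i b) => //.
  by move=> r; rewrite inE/= in_itv/= => /andP[r0 _]; rewrite /= vu.
have dF i : is_derive t (1 : R) (F i) (v i t).
  have tt : t < t + 1 by rewrite ltrDl.
  have [df <-] := continuous_FTC1_closed tt (intv i (t + 1)) t0 (@v_cont i t).
  by rewrite derive1E; exact: DeriveDef.
have hd := is_deriveD (is_derive_cst (v j 0) t (1 : R)) (is_deriveZ L (is_deriveB (dF j.+1) (dF j))).
apply: (near_eq_is_derive _ (is_derive_eq hd _)); last by rewrite add0r.
near=> x; have x0' : 0 < x by near: x; exact: lt_nbhsr.
have x0 := ltW x0'.
have := uE j x0; rewrite -!vu//.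
have E i : \int[leb]_(r in `[0, x]) u i r = F i x.
  apply: eq_Rintegral => r; rewrite inE/= in_itv/= => /andP[r0 _].
  by rewrite vu.
rewrite !E => e; transitivity (v j 0 + L * (F j.+1 x - F j x)); first by [].
by rewrite mulrBr; move: e; lra.
Unshelve. all: by end_near. Qed.

(** Taylor remainder at 0 of exp(L t) v_j(t), by induction on N for all j at once: the derivative of
    the remainder of order N + 1 for j is L times that of order N for j + 1. The bound obeys the
    same recursion because its factor exp(L b) is constant, and both vanish at 0. *)
Let remainder (b : R) N j (t : R) : 0 <= t <= b ->
  `|expR (L * t) * v j t - \sum_(n < N) exp_coeff (L * t) n * v (j + n)%N 0| <=
  expR (L * b) * exp_coeff (L * t) N.
Proof.
elim: N j t => [|N IH] j t /andP[t0 tb].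
  rewrite big_ord0 subr0 /exp_coeff /= expr0 fact0 divr1 mulr1.
  rewrite normrM (ger0_norm (expR_ge0 _)) vu//.
  have /andP[a c] := u01 j t0.
  rewrite (ger0_norm a) (le_trans (ler_piMr (expR_ge0 _) c))// ler_expR.
  by rewrite ler_wpM2l// ltW.
pose r i M x := expR (L * x) * v i x - \sum_(n < M) exp_coeff (L * x) n * v (i + n)%N 0.
have dr (x : R) : 0 < x -> is_derive x (1 : R) (r j N.+1) (L * r j.+1 N x).
  move=> x0.
  have d1 := v_derive j x0.
  have d2 := is_derive_exp_coeff_sum L (fun n => v (j + n)%N 0) N x.
  have d0 : is_derive x (1 : R) (fun y : R => L * y) L.
    by apply: is_derive_eq; rewrite /GRing.scale/= mulr1.
  have d3 := @is_derive1_comp _ expR (fun y : R => L * y) x _ _ (is_derive_expR _) d0.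
  have hd := is_deriveB (is_deriveM d3 d1) d2.
  apply: (is_derive_eq hd); rewrite /GRing.scale/= /r.
  under [in RHS]eq_bigr do rewrite addSnnS.
  ring.
have ct : continuous (r j N.+1).
  move=> x; apply: cvgB.
    apply: cvgM; last exact: v_cont.
    by apply: continuous_comp; [exact: mulrl_continuous|exact: continuous_expR].
  apply: differentiable_continuous; apply/derivable1_diffP.
  by have [] := is_derive_exp_coeff_sum L (fun n => v (j + n)%N 0) N x.
pose g x := expR (L * b) * exp_coeff (L * x) N.+1.
have dg (x : R) : is_derive x (1 : R) g (expR (L * b) * (L * exp_coeff (L * x) N)).
  by have h := is_derive_exp_coeffS L N x; apply: (is_deriveZ (expR (L * b)) h).
have cg : continuous g.
  by move=> x; apply: differentiable_continuous; apply/derivable1_diffP; have [] := dg x.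
have r0 : r j N.+1 0 = 0.
  rewrite /r mulr0 expR0 mul1r big_ord_recl big1 ?addr0.
    by rewrite /exp_coeff /= expr0 fact0 divr1 mul1r addn0 subrr.
  by move=> i _; rewrite /exp_coeff /= expr0n mul0r mul0r.
have g0 : g 0 = 0 by rewrite /g mulr0 /exp_coeff /= expr0n mul0r mulr0.
have mono (h dh : R -> R) : (forall x : R, 0 < x -> is_derive x (1 : R) h (dh x)) -> continuous h ->
    (forall x, 0 < x < b -> 0 <= dh x) -> h 0 = 0 -> 0 <= h t.
  move=> hd hc dh0 h0; rewrite -h0.
  apply: (@ger0_derive1_le_cc _ h 0 b).
  - by move=> x; rewrite in_itv/= => /andP[x0 _]; have [] := hd x x0.
  - move=> x; rewrite in_itv/= => /andP[x0 xb]; have hx := hd x x0.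
    by rewrite derive1E derive_val dh0// x0 xb.
  - exact: continuous_subspaceT.
  - by rewrite in_itv/= lexx (le_trans t0 tb).
  - by rewrite in_itv/= t0 tb.
  - exact: t0.
rewrite ler_norml -/(r j N.+1 t) -/(g t); apply/andP; split.
  rewrite -subr_ge0 opprK.
  apply: (mono (r j N.+1 + g) (fun x => L * r j.+1 N x + expR (L * b) * (L * exp_coeff (L * x) N))).
  - by move=> x x0; exact: (is_deriveD (dr x x0) (dg x)).
  - by move=> x; apply: cvgD; [exact: ct|exact: cg].
  - move=> x /andP[x0 xb]; have := IH j.+1 x; rewrite (ltW x0) (ltW xb) => /(_ isT).
    rewrite ler_norml -/(r j.+1 N x) => /andP[h _].
    by rewrite mulrCA -mulrDr mulr_ge0 ?(ltW L0)// -lerBlDr sub0r.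
  - by transitivity (r j N.+1 0 + g 0); [|rewrite r0 g0 addr0].
rewrite -subr_ge0.
apply: (mono (g - r j N.+1) (fun x => expR (L * b) * (L * exp_coeff (L * x) N) - L * r j.+1 N x)).
- by move=> x x0; exact: (is_deriveB (dg x) (dr x x0)).
- by move=> x; apply: cvgB; [exact: cg|exact: ct].
- move=> x /andP[x0 xb]; have := IH j.+1 x; rewrite (ltW x0) (ltW xb) => /(_ isT).
  rewrite ler_norml -/(r j.+1 N x) => /andP[_ h].
  by rewrite mulrCA -mulrBr mulr_ge0 ?(ltW L0)// subr_ge0.
- by transitivity (g 0 - r j N.+1 0); [|rewrite r0 g0 subrr].
Qed.

(** The equations say that u_j' = L (u_(j+1) - u_j), so the n-th derivative of exp(L t) u_j is L^n
    exp(L t) u_(j+n). The series is the Taylor series at 0; it converges because all u_j are bounded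
    by 1. *)
Lemma poisson_expansion j t : 0 <= t ->
  series (fun n => expR (- (L * t)) * exp_coeff (L * t) n * u (j + n)%N 0) @ \oo --> u j t.
Proof.
move=> t0.
apply/cvgrPdist_le => e e0.
have cv : (exp_coeff (L * t) : R^nat) @ \oo --> 0 by exact: cvg_exp_coeff.
near=> N.
have := @remainder t N j t; rewrite t0 lexx => /(_ isT); rewrite vu// => h.
rewrite /series/= big_mkord.
have -> : u j t - \sum_(k < N) expR (- (L * t)) * exp_coeff (L * t) k * u (j + k)%N 0 =
  expR (- (L * t)) * (expR (L * t) * u j t - \sum_(n < N) exp_coeff (L * t) n * v (j + n)%N 0).
  rewrite mulrBr mulrA -expRD addNr expR0 mul1r; congr (_ - _).
  by rewrite big_distrr /=; apply: eq_bigr => i _; rewrite -mulrA; congr (_ * (_ * _)); rewrite vu.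
rewrite normrM (ger0_norm (expR_ge0 _)) (le_trans (ler_wpM2l (expR_ge0 _) h))//.
rewrite mulrA -expRD addNr expR0 mul1r (le_trans (ler_norm _))//.
near: N; have /cvgrPdist_le/(_ _ e0) := cv.
by apply: filterS => n; rewrite sub0r normrN.
Unshelve. all: by end_near. Qed.

End poisson_expansion.

Lemma cvg_nneseries_EFin (R : realType) (a : R^nat) (l : R) :
  series a @ \oo --> l -> (\sum_(0 <= n <oo) (a n)%:E = l%:E)%E.
Proof.
move=> al; apply/cvg_lim => //.
have -> : (fun N => \sum_(0 <= n < N) (a n)%:E)%E = EFin \o series a.
  by apply/funext => N /=; rewrite /series /= sumEFin.
by apply: cvg_EFin; [exact: nearW|exact: al].
Qed.

(** * Uniformization: marginal laws as Poisson mixtures of a discrete chain *)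

Section uniformization.
Context (R : realType) (dT : measure_display) (T : measurableType dT).
Variables (lam : T -> R) (k : R.-pker T ~> T) (L : R).
Hypotheses (mlam : measurable_fun setT lam) (lam0 : forall x, 0 <= lam x).
Hypotheses (lamL : forall x, lam x <= L) (L0 : 0 < L).
Local Open Scope ereal_scope.
Local Notation leb := (@lebesgue_measure R).
Implicit Types (f g : T -> \bar R).

(** Transition operator K of the chain that attempts a jump at each tick of a Poisson clock of rate
    L and accepts it with probability lam x / L; the generator is L (K - 1). *)
Definition uniformized f x : \bar R :=
  (1 - lam x / L)%:E * f x + (lam x / L)%:E * \int[k x]_y f y.

Let w1 x : (0 <= 1 - lam x / L)%R.
Proof. by rewrite subr_ge0 ler_pdivrMr// mul1r. Qed.

Let w2 x : (0 <= lam x / L)%R.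
Proof. by rewrite divr_ge0// ltW. Qed.

Let mkf f : measurable_fun setT f -> (forall x, 0 <= f x) ->
  measurable_fun setT (fun x => \int[k x]_y f y).
Proof.
by move=> mf f0; apply: measurable_fun_integral_kernel => // U; exact: measurable_kernel.
Qed.

Let mw2 : measurable_fun setT (fun x => lam x / L)%R.
Proof. exact: measurable_funM. Qed.

Let mw1 : measurable_fun setT (fun x => 1 - lam x / L)%R.
Proof. exact: measurable_funB. Qed.

Lemma measurable_uniformized f : measurable_fun setT f -> (forall x, 0 <= f x) ->
  measurable_fun setT (uniformized f).
Proof.
move=> mf f0; apply: emeasurable_funD.
  by apply: emeasurable_funM => //; exact/measurable_EFinP.
by apply: emeasurable_funM; [exact/measurable_EFinP|exact: mkf].
Qed.

Lemma uniformized_ge0 f : (forall x, 0 <= f x) -> forall x, 0 <= uniformized f x.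
Proof.
move=> f0 x; rewrite adde_ge0// mule_ge0 ?lee_fin//; exact: integral_ge0.
Qed.

Lemma uniformized_le1 f : measurable_fun setT f -> (forall x, 0 <= f x) ->
  (forall x, f x <= 1) -> forall x, uniformized f x <= 1.
Proof.
move=> mf f0 f1 x.
have kf1 : \int[k x]_y f y <= 1.
  apply: (@le_trans _ _ (\int[k x]_y (cst 1 y))).
    by apply: ge0_le_integral => // y _; rewrite lee_fin.
  by rewrite integral_cst// mul1e prob_kernel.
apply: (@le_trans _ _ ((1 - lam x / L)%:E * 1 + (lam x / L)%:E * 1)).
  by apply: leeD; apply: lee_wpmul2l; rewrite ?lee_fin.
by rewrite !mule1 -EFinD subrK.
Qed.

Definition uniform_kernel x : {measure set T -> \bar R} :=
  measure_add (mscale (NngNum (w1 x)) (\d_x)%R) (mscale (NngNum (w2 x)) (k x)).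

Let uniform_kernelE x U :
  uniform_kernel x U = (1 - lam x / L)%:E * (\d_x)%R U + (lam x / L)%:E * k x U.
Proof. exact: measure_addE. Qed.

Lemma measurable_uniform_kernel U : measurable U ->
  measurable_fun setT (uniform_kernel ^~ U).
Proof.
move=> mU; rewrite (_ : (fun _ => _) =
  fun x => (1 - lam x / L)%:E * (\1_U x)%:E + (lam x / L)%:E * k x U); last first.
  by apply/funext => x; rewrite uniform_kernelE.
apply: emeasurable_funD; apply: emeasurable_funM.
- exact/measurable_EFinP.
- by apply/measurable_EFinP; exact: measurable_indic.
- exact/measurable_EFinP.
- exact: measurable_kernel.
Qed.

Lemma integral_uniform_kernel f x : measurable_fun setT f -> (forall x, 0 <= f x) ->
  \int[uniform_kernel x]_y f y = uniformized f x.
Proof.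
move=> mf f0; rewrite ge0_integral_measure_add// !ge0_integral_mscale//.
by rewrite integral_dirac// diracT mul1e.
Qed.

Fixpoint uniform_chain (m : {measure set T -> \bar R}) n : {measure set T -> \bar R} :=
  if n is n'.+1 then mixture (uniform_chain m n') measurable_uniform_kernel else m.

Lemma integral_uniform_chainS m n f : measurable_fun setT f -> (forall x, 0 <= f x) ->
  \int[uniform_chain m n.+1]_x f x = \int[uniform_chain m n]_x uniformized f x.
Proof.
move=> mf f0.
rewrite (@ge0_integral_mixture _ _ _ _ _ (uniform_chain m n) uniform_kernel)//.
- by apply: eq_integral => x _; rewrite integral_uniform_kernel.
- exact: measurable_uniform_kernel.
Qed.

Lemma integral_uniform_chain m n f : measurable_fun setT f -> (forall x, 0 <= f x) ->
  \int[uniform_chain m n]_x f x = \int[m]_x iter n uniformized f x.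
Proof.
elim: n f => [//|n IH] f mf f0.
rewrite integral_uniform_chainS// IH; last 2 first.
- exact: measurable_uniformized.
- exact: uniformized_ge0.
by rewrite -iterSr.
Qed.

Lemma uniform_chainT (m : {measure set T -> \bar R}) n : m setT = 1 -> uniform_chain m n setT = 1.
Proof.
move=> m1; elim: n => [//|n IH].
have := @integral_uniform_chainS m n (cst 1) (measurable_cst _) (fun=> lee01).
rewrite integral_cst// mul1e => ->.
have -> : uniformized (cst 1) = cst 1.
  apply/funext => x.
  by rewrite /uniformized integral_cst// prob_kernel !mule1 -EFinD subrK.
by rewrite integral_cst// mul1e.
Qed.

Variable P : R -> probability T R.
Hypothesis mP : forall f, measurable_fun setT f -> (forall x, 0 <= f x) ->
  measurable_fun (`[0%R, +oo[%classic : set R) (fun r => \int[P r]_x f x).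
Hypothesis dynkinP : forall f (t : R), (0 <= t)%R ->
  measurable_fun setT f -> (forall x, 0 <= f x) ->
  \int[P t]_x f x + \int[leb]_(r in `[0%R, t]) \int[P r]_x ((lam x)%:E * f x) =
  \int[P 0%R]_x f x +
    \int[leb]_(r in `[0%R, t]) \int[P r]_x ((lam x)%:E * \int[k x]_y f y).

Let mP0 t f : measurable_fun setT f -> (forall x, 0 <= f x) ->
  measurable_fun (`[0%R, t]%classic : set R) (fun r => \int[P r]_x f x).
Proof.
move=> mf f0; apply: measurable_funS (mP mf f0) => // r /=.
by rewrite !in_itv/= => /andP[-> _].
Qed.

Let int_time_add t f g : measurable_fun setT f -> (forall x, 0 <= f x) ->
  measurable_fun setT g -> (forall x, 0 <= g x) ->
  \int[leb]_(r in `[0%R, t]) \int[P r]_x f x + \int[leb]_(r in `[0%R, t]) \int[P r]_x g x =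
  \int[leb]_(r in `[0%R, t]) \int[P r]_x (f x + g x).
Proof.
move=> mf f0 mg g0; rewrite -ge0_integralD//.
- by apply: eq_integral => r _; rewrite ge0_integralD.
- by move=> r _; exact: integral_ge0.
- exact: mP0.
- by move=> r _; exact: integral_ge0.
- exact: mP0.
Qed.

(** Adding the integral of (L - lam) f to both sides of the Dynkin formula makes the rate constant:
    the left integrand becomes L f, the right one L times [uniformized f]. *)
Let uniformized_dynkin f t : (0 <= t)%R -> measurable_fun setT f -> (forall x, 0 <= f x) ->
  \int[P t]_x f x + L%:E * \int[leb]_(r in `[0%R, t]) \int[P r]_x f x =
  \int[P 0%R]_x f x + L%:E * \int[leb]_(r in `[0%R, t]) \int[P r]_x uniformized f x.
Proof.
move=> t0 mf f0.
have mLl : measurable_fun setT (fun x => (L - lam x)%:E * f x).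
  by apply: emeasurable_funM => //; apply/measurable_EFinP; exact: measurable_funB.
have Ll0 x : 0 <= (L - lam x)%:E * f x by rewrite mule_ge0// lee_fin subr_ge0.
have mlf : measurable_fun setT (fun x => (lam x)%:E * f x).
  by apply: emeasurable_funM => //; exact/measurable_EFinP.
have lf0 x : 0 <= (lam x)%:E * f x by rewrite mule_ge0// lee_fin.
have kf0 x : 0 <= \int[k x]_y f y by exact: integral_ge0.
have mlkf : measurable_fun setT (fun x => (lam x)%:E * \int[k x]_y f y).
  by apply: emeasurable_funM; [exact/measurable_EFinP|exact: mkf].
have lkf0 x : 0 <= (lam x)%:E * \int[k x]_y f y by rewrite mule_ge0// lee_fin.
have scale g : measurable_fun setT g -> (forall x, 0 <= g x) ->
    L%:E * \int[leb]_(r in `[0%R, t]) \int[P r]_x g x =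
    \int[leb]_(r in `[0%R, t]) \int[P r]_x (L%:E * g x).
  move=> mg g0; rewrite -ge0_integralZl_EFin//; last 3 first.
  - by move=> r _; exact: integral_ge0.
  - exact: mP0.
  - exact: ltW.
  by apply: eq_integral => r _; rewrite ge0_integralZl_EFin// ltW.
rewrite (scale _ mf f0) (scale _ (measurable_uniformized mf f0) (uniformized_ge0 f0)).
have e1 : (fun x => L%:E * f x) = (fun x => (lam x)%:E * f x + (L - lam x)%:E * f x).
  apply/funext => x; rewrite -ge0_muleDl ?lee_fin ?subr_ge0//.
  by rewrite -EFinD addrC subrK.
have e2 : (fun x => L%:E * uniformized f x) =
    (fun x => (lam x)%:E * \int[k x]_y f y + (L - lam x)%:E * f x).
  apply/funext => x; rewrite /uniformized ge0_muleDr ?mule_ge0 ?lee_fin//.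
  rewrite !muleA -!EFinM addeC; congr (_%:E * _ + _%:E * _).
    by rewrite mulrCA divff ?mulr1// gt_eqF.
  by rewrite mulrBr mulr1 mulrCA divff ?mulr1// gt_eqF.
rewrite (_ : \int[leb]_(r in _) \int[P r]_x (L%:E * f x) =
  \int[leb]_(r in `[0%R, t]) \int[P r]_x ((lam x)%:E * f x + (L - lam x)%:E * f x));
  last by apply: eq_integral => r _; rewrite e1.
rewrite (_ : \int[leb]_(r in _) \int[P r]_x (L%:E * uniformized f x) =
  \int[leb]_(r in `[0%R, t]) \int[P r]_x ((lam x)%:E * \int[k x]_y f y + (L - lam x)%:E * f x));
  last by apply: eq_integral => r _; rewrite e2.
have a1 := int_time_add t mlf lf0 mLl Ll0.
have a2 := int_time_add t mlkf lkf0 mLl Ll0.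
have d := dynkinP t0 mf f0.
have addA (x a b z y c : \bar R) : a + b = z -> x + a = y + c -> x + z = y + (c + b).
  by move=> <- xa; rewrite addeA xa addeA.
apply: etrans (addA _ _ _ _ _ _ a1 d) _.
by congr (_ + _); exact: a2.
Qed.

(** For an indicator, all iterates of the transition operator stay in [0, 1], and their means
    satisfy the hierarchy of [poisson_expansion]. *)
Let uniformization_set t (A : set T) : (0 <= t)%R -> measurable A ->
  P t A = \sum_(0 <= n <oo)
    (expR (- (L * t)) * exp_coeff (L * t) n)%:E * uniform_chain (P 0%R) n A.
Proof.
move=> t0 mA.
pose f j := iter j uniformized (fun x => (\1_A x)%:E).
have fP j : [/\ measurable_fun setT (f j), forall x, 0 <= f j x & forall x, f j x <= 1].
  elim: j => [|j [mf f0 f1]].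
    split; first by apply/measurable_EFinP; exact: measurable_indic.
      by move=> x; rewrite lee_fin.
    by move=> x; rewrite lee_fin indicE; case: (_ \in _).
  split; [exact: measurable_uniformized|exact: uniformized_ge0|exact: uniformized_le1].
pose u j r := fine (\int[P r]_x f j x).
have fin_u j r : \int[P r]_x f j x = (u j r)%:E.
  have [mf f0 f1] := fP j.
  rewrite fineK// ge0_fin_numE; last exact: integral_ge0.
  apply: (@le_lt_trans _ _ (\int[P r]_x cst 1 x)); first exact: ge0_le_integral.
  by rewrite integral_cst// mul1e (le_lt_trans (probability_le1 _ _))// ltry.
have u01 j r : (0 <= r)%R -> (0 <= u j r <= 1)%R.
  have [mf f0 f1] := fP j.
  move=> _; rewrite -!lee_fin -fin_u; apply/andP; split; first exact: integral_ge0.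
  apply: (@le_trans _ _ (\int[P r]_x cst 1 x)); first exact: ge0_le_integral.
  by rewrite integral_cst// mul1e probability_le1.
have mu j : measurable_fun (`[0%R, +oo[%classic : set R) (u j).
  have [mf f0 f1] := fP j.
  by apply: (measurableT_comp (f := fine)) => //; exact: mP.
have uE j r : (0 <= r)%R ->
    (u j r + L * \int[leb]_(s in `[0%R, r]) u j s =
     u j 0 + L * \int[leb]_(s in `[0%R, r]) u j.+1 s)%R.
  move=> r0; have [mf f0 _] := fP j.
  have intu i : \int[leb]_(s in `[0%R, r]) \int[P s]_x f i x =
      (\int[leb]_(s in `[0%R, r]) u i s)%:E.
    rewrite /Rintegral fineK; first by apply: eq_integral => s _; rewrite fin_u.
    apply: integrable_fin_num => //; apply: measurable_bounded_integrable => //.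
    - exact: lebesgue_itv_lty.
    - apply: measurable_funS (mu i) => // s /=.
      by rewrite !in_itv/= => /andP[-> _].
    - exists 1%R; split=> // M M1 s; rewrite /= in_itv/= => /andP[s0 _].
      have /andP[a b] := u01 i _ s0.
      by rewrite ger0_norm// (le_trans b)// ltW.
  have d := uniformized_dynkin r0 mf f0.
  have e1 := intu j.
  have e2 : \int[leb]_(s in `[0%R, r]) \int[P s]_x uniformized (f j) x =
      (\int[leb]_(s in `[0%R, r]) u j.+1 s)%:E := intu j.+1.
  have addE (a b c e : R) (x y z w : \bar R) : x + L%:E * y = z + L%:E * w ->
      x = a%:E -> y = b%:E -> z = c%:E -> w = e%:E -> (a + L * b = c + L * e)%R.
    by move=> h xa yb zc we; move: h; rewrite xa yb zc we -!EFinM -!EFinD; exact: EFin_inj.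
  by apply: (addE _ _ _ _ _ _ _ _ d) => //; exact: fin_u.
have := @poisson_expansion _ _ _ L0 u01 mu uE 0%N _ t0.
move=> /cvg_nneseries_EFin.
rewrite -fin_u /f /= integral_indic// setIT => <-.
apply: eq_eseriesr => n _; rewrite add0n EFinM; congr (_ * _).
rewrite -fin_u -integral_uniform_chain//.
- by rewrite integral_indic// setIT.
- by apply/measurable_EFinP; exact: measurable_indic.
Qed.

Lemma uniformization t f : (0 <= t)%R -> measurable_fun setT f -> (forall x, 0 <= f x) ->
  \int[P t]_x f x = \sum_(0 <= n <oo)
    (expR (- (L * t)) * exp_coeff (L * t) n)%:E * \int[uniform_chain (P 0%R) n]_x f x.
Proof.
move=> t0 mf f0.
have w0 n : (0 <= expR (- (L * t)) * exp_coeff (L * t) n)%R.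
  by rewrite mulr_ge0 ?expR_ge0// exp_coeff_ge0// mulr_ge0// ltW.
pose m n : {measure set T -> \bar R} := mscale (NngNum (w0 n)) (uniform_chain (P 0%R) n).
(* Two measures that agree on measurable sets have the same integrals; this also covers functions
   with infinite integral. *)
transitivity (\int[mseries m 0]_x f x).
  by apply: eq_measure_integral => A mA _; exact: (uniformization_set t0 mA).
rewrite ge0_integral_measure_series//; apply: eq_eseriesr => n _.
by rewrite ge0_integral_mscale.
Qed.

End uniformization.

Section process_uniformization.
Context (R : realType) (dT : measure_display) (T : measurableType dT).
Context (dO : measure_display) (Omega : measurableType dO) (Pr : probability Omega R).
Local Open Scope ereal_scope.

(** Everything later used about the dynamics is contained here: [mu n] is the law of the uniformized
    chain after n ticks, started from the law of X at time 0. *)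
Theorem pure_jump_uniformization (lam : T -> R) (k : R.-pker T ~> T)
    (X : R -> {RV Pr >-> T}) (L : R) :
  pure_jump_process lam k X -> (0 < L)%R -> (forall x, lam x <= L)%R ->
  exists mu : nat -> {measure set T -> \bar R},
    (forall n, mu n setT = 1) /\
    (forall n f, measurable_fun setT f -> (forall x, 0 <= f x) ->
      \int[mu n.+1]_x f x = \int[mu n]_x uniformized lam k L f x) /\
    (forall (t : R) f, (0 <= t)%R -> measurable_fun setT f -> (forall x, 0 <= f x) ->
      \int[marginal X t]_x f x = \sum_(0 <= n <oo)
        (expR (- (L * t)) * exp_coeff (L * t) n)%:E * \int[mu n]_x f x).
Proof.
move=> [[mlam lam0 _] [Y [S [chain visits]]]] L0 lamL.
have mX f : measurable_fun setT f -> (forall x, 0 <= f x) ->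
    measurable_fun (`[0%R, +oo[%classic : set R) (fun r => \int[Pr]_w f (X r w)).
  move=> mf f0.
  apply: (eq_measurable_fun (fun r : R => \sum_(0 <= n <oo)
    \int[Pr]_(w in arrived S n r `\` arrived S n.+1 r) f (Y n w))).
    move=> r; rewrite inE/= in_itv/= andbT => r0.
    by rewrite (integral_process mlam lam0 lamL chain visits r0 mf f0).
  apply: (ge0_emeasurable_sum (P := xpredT)) => //.
    by move=> n r _ _; exact: integral_ge0.
  by move=> n _; apply: measurable_funTS; exact: (measurable_time_present Y S n mf f0).
have PE t f : measurable_fun setT f -> (forall x, 0 <= f x) ->
    \int[marginal X t]_x f x = \int[Pr]_w f (X t w).
  by move=> mf f0; rewrite ge0_integral_distribution.
exists (uniform_chain k mlam lam0 lamL L0 (marginal X 0%R)); split.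
  by move=> n; apply: uniform_chainT; exact: probability_setT.
split.
  by move=> n f mf f0; exact: integral_uniform_chainS.
apply: uniformization.
- move=> f mf f0; apply: (eq_measurable_fun (fun r => \int[Pr]_w f (X r w))).
    by move=> r _; rewrite PE.
  exact: mX.
- move=> f t t0 mf f0.
  have kf0 x : 0 <= \int[k x]_y f y by exact: integral_ge0.
  have mkf : measurable_fun setT (fun x => \int[k x]_y f y).
    by apply: measurable_fun_integral_kernel => // U; exact: measurable_kernel.
  rewrite !PE//.
  rewrite (_ : \int[_]_(r in _) \int[_]_x ((lam x)%:E * f x) =
    \int[lebesgue_measure]_(r in `[0%R, t]) \int[Pr]_w ((lam (X r w))%:E * f (X r w)));
    last first.
    apply: eq_integral => r _; rewrite PE//; last by move=> x; rewrite mule_ge0// lee_fin.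
    by apply: emeasurable_funM => //; exact/measurable_EFinP.
  rewrite (_ : \int[_]_(r in _) \int[_]_x ((lam x)%:E * \int[k x]_y f y) =
    \int[lebesgue_measure]_(r in `[0%R, t]) \int[Pr]_w
      ((lam (X r w))%:E * \int[k (X r w)]_y f y)); last first.
    apply: eq_integral => r _.
    rewrite (PE _ (fun x => (lam x)%:E * \int[k x]_y f y))//; last by move=> x; rewrite mule_ge0// lee_fin.
    by apply: emeasurable_funM => //; exact/measurable_EFinP.
  exact: (dynkin_formula mlam lam0 lamL chain visits t0 mf f0).
Qed.

End process_uniformization.

(** * Expectation of a fixed function along the process *)

Section mean_value.
Context {R : realType}.
Implicit Types (f g h : R -> R).

Lemma is_derive_continuous f g : (forall x, is_derive x (1 : R) f (g x)) -> continuous f.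
Proof.
move=> fg x; apply: differentiable_continuous; apply/derivable1_diffP.
by have [] := fg x.
Qed.

Lemma mean_value_between f g (a b s t : R) : (forall x, is_derive x (1 : R) f (g x)) ->
  a <= s <= b -> a <= t <= b ->
  exists2 c, a <= c <= b /\ `|c - t| <= `|s - t| & f s - f t = g c * (s - t).
Proof.
move=> fg /andP[as_ sb] /andP[at_ tb].
have cf A : {within A, continuous f}.
  by apply: continuous_subspaceT; exact: is_derive_continuous fg.
have [st|ts|<-] := ltgtP s t.
- have [c] := @MVT _ f g s t st (fun x _ => fg x) (cf _).
  rewrite in_itv/= => /andP[sc ct] E; exists c.
    split; first by rewrite (le_trans as_ (ltW sc)) (le_trans (ltW ct) tb).
    rewrite distrC [leRHS]distrC !ger0_norm ?subr_ge0 ?(ltW st) ?(ltW ct)//.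
    by rewrite lerD2l lerN2 ltW.
  by rewrite -opprB E -mulrN opprB.
- have [c] := @MVT _ f g t s ts (fun x _ => fg x) (cf _).
  rewrite in_itv/= => /andP[tc cs] E; exists c => //.
  split; first by rewrite (le_trans at_ (ltW tc)) (le_trans (ltW cs) sb).
  by rewrite !ger0_norm ?subr_ge0 ?(ltW ts) ?(ltW tc)// lerD2r ltW.
- by exists s; rewrite ?as_ ?sb ?lexx// !subrr mulr0.
Qed.

(** Two uses of the mean value theorem, for f and then for g between c and t; this is why the
    constant is C and not C / 2. *)
Lemma taylor_order2 f g h (a b C s t : R) :
  (forall x, is_derive x (1 : R) f (g x)) -> (forall x, is_derive x (1 : R) g (h x)) ->
  (forall x, a <= x <= b -> `|h x| <= C) ->
  a <= s <= b -> a <= t <= b ->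
  `|f s - f t - (s - t) * g t| <= C * (s - t) ^+ 2.
Proof.
move=> fg gh hC sab tab.
have [c [cab ct] ->] := mean_value_between fg sab tab.
rewrite [_ * (s - t)]mulrC -mulrBr normrM.
have [e [eab et] ->] := mean_value_between gh cab tab.
have C0 : 0 <= C by exact: le_trans (hC _ tab).
rewrite -(real_normK (num_real (s - t))) expr2 [C * _]mulrCA ler_wpM2l// normrM ler_pM//.
  exact: hC.
Qed.

Lemma mean_value_bound f g (a b C s t : R) :
  (forall x, is_derive x (1 : R) f (g x)) -> (forall x, a <= x <= b -> `|g x| <= C) ->
  a <= s <= b -> a <= t <= b -> `|f s - f t| <= C * `|s - t|.
Proof.
move=> fg gC sab tab; have [c [cab _] ->] := mean_value_between fg sab tab.
by rewrite normrM ler_wpM2r// gC.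
Qed.

End mean_value.

Section poisson_mixture.
Context {R : realType}.
Variables (L : R) (b : nat -> R).
Hypothesis L0 : 0 < L.

(** Truncated mean at time s, when b n is the mean of psi under [mu n]; the shift j stands for j
    applications of the transition operator to psi. Estimates are proved for these finite sums,
    uniformly in N, and only then passed to the limit. *)
Definition poisson_sum N j (s : R) : R :=
  expR (- (L * s)) * \sum_(n < N) exp_coeff (L * s) n * b (n + j)%N.

(** Differentiating the exponential coefficients lowers their index by one, which shifts b and loses
    the last term; hence the lengths N.+2, N.+1 and N in the second order estimate. *)
Lemma is_derive_poisson_sum N j s : is_derive s (1 : R) (poisson_sum N.+1 j)
  (L * (poisson_sum N j.+1 s - poisson_sum N.+1 j s)).
Proof.
have h : is_derive s (1 : R) (fun r : R => - (L * r)) (- L).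
  by apply: is_derive_eq; rewrite /GRing.scale/= mulr1.
have hE := @is_derive1_comp _ expR (fun r : R => - (L * r)) s _ _ (is_derive_expR _) h.
have hS := is_derive_exp_coeff_sum L (fun n => b (n + j)%N) N s.
apply: (is_derive_eq (is_deriveM hE hS)); rewrite /poisson_sum /GRing.scale/=.
under [in RHS]eq_bigr do rewrite -addSnnS.
ring.
Qed.

Lemma poisson_sum_le N j (s t : R) : 0 <= s <= t ->
  `|poisson_sum N j s| <= \sum_(n < N) exp_coeff (L * t) n * `|b (n + j)%N|.
Proof.
move=> /andP[s0 st].
have Ls0 : 0 <= L * s by rewrite mulr_ge0// ltW.
rewrite /poisson_sum normrM (ger0_norm (expR_ge0 _)).
rewrite -[leRHS]mul1r ler_pM//.
  by rewrite -[leRHS]expR0 ler_expR oppr_le0.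
apply: (le_trans (ler_norm_sum _ _ _)); apply: ler_sum => n _.
rewrite normrM (ger0_norm (exp_coeff_ge0 _ Ls0)) ler_wpM2r//.
rewrite /exp_coeff /= ler_wpM2r ?invr_ge0// lerXn2r ?nnegrE ?mulr_ge0 ?(ltW L0) ?(le_trans s0 st)//.
by rewrite ler_wpM2l// ltW.
Qed.

(** The second derivative is L^2 times a second difference w - 2 v + u of sums bounded by Q, hence
    the factor 4. *)
Lemma poisson_sum_taylor N (B Q s t : R) :
  (forall j M, (j <= 2)%N -> \sum_(n < M) exp_coeff (L * B) n * `|b (n + j)%N| <= Q) ->
  0 <= s <= B -> 0 <= t <= B ->
  `|poisson_sum N.+2 0 s - poisson_sum N.+2 0 t
      - (s - t) * (L * (poisson_sum N.+1 1 t - poisson_sum N.+2 0 t))| <=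
  4 * L ^+ 2 * Q * (s - t) ^+ 2.
Proof.
move=> bQ sB tB.
pose g r := L * (poisson_sum N.+1 1 r - poisson_sum N.+2 0 r).
pose h r := L * (L * (poisson_sum N 2 r - poisson_sum N.+1 1 r)
  - L * (poisson_sum N.+1 1 r - poisson_sum N.+2 0 r)).
apply: (@taylor_order2 _ _ g h 0 B) => //.
- by move=> x; exact: is_derive_poisson_sum.
- move=> x; apply: (is_deriveZ L (is_deriveB _ _)); exact: is_derive_poisson_sum.
- move=> x xB.
  have bd M j : (j <= 2)%N -> `|poisson_sum M j x| <= Q.
    by move=> j2; apply: le_trans (poisson_sum_le M j xB) _; exact: bQ.
  have [] := (bd N 2%N isT, bd N.+1 1%N isT, bd N.+2 0%N isT).
  rewrite /h; move: (poisson_sum _ _ _) (poisson_sum _ _ _) (poisson_sum _ _ _) => u v w.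
  move=> [hu hv] hw.
  have -> : L * (L * (w - v) - L * (v - u)) = L ^+ 2 * (w - v - (v - u)) by ring.
  have -> : 4 * L ^+ 2 * Q = L ^+ 2 * (4 * Q) by ring.
  rewrite normrM (ger0_norm (sqr_ge0 L)) ler_wpM2l ?sqr_ge0//.
  move: hu hv hw; rewrite !ler_norml => /andP[? ?] /andP[? ?] /andP[? ?].
  by apply/andP; split; lra.
Qed.

Lemma poisson_sum_increment N (t C : R) : 0 <= t ->
  (\sum_(n < N) exp_coeff (L * t) n * `|b (n + 1)%N| <= C) ->
  (\sum_(n < N.+1) exp_coeff (L * t) n * `|b (n + 0)%N| <= C) ->
  `|poisson_sum N.+1 0 0 - poisson_sum N.+1 0 t| <= 2 * L * C * t.
Proof.
move=> t0 C1 C0; rewrite -[X in _ * X](ger0_norm t0) -(normrN t) -(sub0r t).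
apply: (@mean_value_bound _ _ (fun r => L * (poisson_sum N 1 r - poisson_sum N.+1 0 r)) 0 t).
- by move=> x; exact: is_derive_poisson_sum.
- move=> x xt; rewrite normrM gtr0_norm// [2 * L]mulrC -mulrA ler_wpM2l ?(ltW L0)//.
  have := le_trans (poisson_sum_le N 1 xt) C1.
  have := le_trans (poisson_sum_le N.+1 0 xt) C0.
  rewrite !ler_norml => /andP[? ?] /andP[? ?].
  by apply/andP; split; lra.
- by rewrite lexx.
- by rewrite lexx t0.
Qed.

End poisson_mixture.

(** Amounts to n + 1 <= 2^(n+1): a shift by one in the sequence b is paid by doubling the Poisson
    parameter. *)
Lemma exp_coeff_shift {R : realType} (v : R) n : 0 < v ->
  exp_coeff v n <= v^-1 * exp_coeff (2 * v) n.+1.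
Proof.
move=> v0; rewrite /exp_coeff /= exprMn [v ^+ n.+1]exprS factS natrM invfM.
have n0 : n.+1%:R != 0 :> R by rewrite pnatr_eq0.
have f0 : n`!%:R != 0 :> R by rewrite pnatr_eq0 -lt0n fact_gt0.
have -> : v^-1 * (2 ^+ n.+1 * (v * v ^+ n) * (n.+1%:R^-1 / n`!%:R)) =
   2 ^+ n.+1 / n.+1%:R * (v ^+ n / n`!%:R).
  by move: (n.+1%:R : R) (n`!%:R : R) n0 f0 => a c a0 c0; field; rewrite a0 c0 gt_eqF.
rewrite ler_peMl ?divr_ge0 ?exprn_ge0 ?(ltW v0)//.
rewrite ler_pdivlMr ?ltr0n// mul1r -natrX ler_nat.
exact/ltnW/ltn_expl.
Qed.

Lemma nneseries_exp_coeff (R : realType) (v : R) :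
  (\sum_(0 <= n <oo) (exp_coeff v n)%:E = (expR v)%:E)%E.
Proof.
by apply: cvg_nneseries_EFin; exact: (@is_cvg_series_exp_coeff R v).
Qed.

Section young.
Context {R : realType}.
Variable eps : R.
Hypothesis eps0 : 0 < eps.
Local Open Scope ereal_scope.

(** If x > y then x = x^(1+eps) / x^eps <= x^(1+eps) / y^eps. The level y is free and will be chosen
    separately for each term of the Poisson series. *)
Lemma le_cut_power (x : \bar R) (y : R) : 0 <= x -> (0 < y)%R ->
  x <= y%:E + ((y `^ eps)^-1)%:E * x `^ (1 + eps).
Proof.
move=> x0 y0.
have ye0 : (0 < y `^ eps)%R by exact: powR_gt0.
case: x x0 => [x| |//] x0.
- rewrite lee_fin in x0; rewrite poweR_EFin -EFinM -EFinD lee_fin.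
  have [xy|yx] := leP x y.
    by rewrite (le_trans xy)// lerDl mulr_ge0// ?invr_ge0 ?powR_ge0.
  have xpos : (0 < x)%R by exact: lt_trans yx.
  rewrite powRD; last by rewrite gt_eqF ?implybT// addr_gt0.
  rewrite powRr1//; apply: ler_wpDl; first exact: ltW.
  rewrite mulrCA ler_peMr// ler_pdivlMl// mulr1.
  by rewrite ge0_ler_powR ?nnegrE ?ltW.
- rewrite poweRyr; last by rewrite gt_eqF// addr_gt0.
  by rewrite gt0_muley ?lte_fin ?invr_gt0// addey.
Qed.

(** From eps x <= exp(eps x). It lets levels growing like n^(1/eps) be absorbed by exp(n), hence by
    a larger Poisson parameter. *)
Lemma powR_le_expR (x : R) : (0 <= x)%R ->
  (x `^ eps^-1 <= eps `^ (- eps^-1) * expR x)%R.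
Proof.
move=> x0.
have h : ((eps * x) `^ eps^-1 <= expR x)%R.
  have e1 : (eps * x <= expR (eps * x))%R.
    by apply: le_trans (expR_ge1Dx _); rewrite lerDr.
  apply: (@le_trans _ _ (expR (eps * x) `^ eps^-1)%R).
    by rewrite ge0_ler_powR ?nnegrE ?invr_ge0 ?mulr_ge0 ?expR_ge0 ?(ltW eps0).
  by rewrite -expRM mulrAC divff ?mul1r// gt_eqF.
rewrite powRN ler_pdivlMl ?powR_gt0//.
by rewrite -powRM// ltW.
Qed.

End young.

(** * Poisson series controlled by one moment at one positive time *)

Section poisson_moments.
Context (R : realType) (dT : measure_display) (T : measurableType dT).
Variables (L eps : R) (mu : nat -> {measure set T -> \bar R}) (P : R -> probability T R).
Hypotheses (L0 : 0 < L) (eps0 : 0 < eps).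
Local Open Scope ereal_scope.
Hypothesis mu1 : forall n, mu n setT = 1.
Hypothesis mixP : forall (t : R) f, (0 <= t)%R -> measurable_fun setT f -> (forall x, 0 <= f x) ->
  \int[P t]_x f x = \sum_(0 <= n <oo)
    (expR (- (L * t)) * exp_coeff (L * t) n)%:E * \int[mu n]_x f x.
Variable psi : T -> \bar R.
Hypothesis mpsi : measurable_fun setT psi.

Local Notation beta n := (\int[mu n]_x `|psi x|).
Local Notation alpha n := (\int[mu n]_x (`|psi x| `^ (1 + eps))).
Local Notation q := ((1 + eps)^-1)%R.

Let mabs : measurable_fun setT (fun x => `|psi x|).
Proof. exact: measurableT_comp. Qed.

Let mpow : measurable_fun setT (fun x => `|psi x| `^ (1 + eps)).
Proof. by apply: (measurableT_comp (measurable_poweR _)). Qed.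

Let beta0 n : 0 <= beta n. Proof. exact: integral_ge0. Qed.

Let alpha0 n : 0 <= alpha n.
Proof. by apply: integral_ge0 => x _; exact: poweR_ge0. Qed.

Let exp_coeff0 (v : R) n : (0 <= v)%R -> (0 <= exp_coeff v n)%R.
Proof. exact: exp_coeff_ge0. Qed.

Lemma moment_split (m : {measure set T -> \bar R}) (y : R) : m setT = 1 -> (0 < y)%R ->
  \int[m]_x `|psi x| <=
  y%:E + ((y `^ eps)^-1)%:E * \int[m]_x (`|psi x| `^ (1 + eps)).
Proof.
move=> m1 y0.
have ye0 : (0 <= (y `^ eps)^-1)%R by rewrite invr_ge0 powR_ge0.
have pow0 x : setT x -> 0 <= `|psi x| `^ (1 + eps) by move=> _; exact: poweR_ge0.
have mc : measurable_fun setT (fun x => ((y `^ eps)^-1)%:E * `|psi x| `^ (1 + eps)).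
  exact: emeasurable_funM.
have c0 x : setT x -> 0 <= ((y `^ eps)^-1)%:E * `|psi x| `^ (1 + eps).
  by move=> _; rewrite mule_ge0 ?lee_fin// poweR_ge0.
rewrite -(ge0_integralZl_EFin m measurableT pow0 mpow ye0).
have <- : \int[m]_x (cst y%:E x) = y%:E by rewrite integral_cst// m1 mule1.
rewrite -(ge0_integralD m measurableT _ _ c0 mc)//; last first.
  by move=> x _; rewrite lee_fin ltW.
apply: ge0_le_integral => //.
- exact: emeasurable_funD.
- by move=> x _; exact: le_cut_power.
Qed.

Let sum_split (c y : nat -> R) (a b : nat -> \bar R) : (forall n, 0 <= c n)%R ->
  (forall n, 0 < y n)%R -> (forall n, 0 <= a n) -> (forall n, 0 <= b n) ->
  (forall n, b n <= (y n)%:E + ((y n `^ eps)^-1)%:E * a n) ->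
  \sum_(0 <= n <oo) (c n)%:E * b n <=
  \sum_(0 <= n <oo) (c n * y n)%:E + \sum_(0 <= n <oo) (c n * (y n `^ eps)^-1)%:E * a n.
Proof.
move=> c0 y0 a0 b0 ba.
have ye0 n : (0 <= (y n `^ eps)^-1)%R by rewrite invr_ge0 powR_ge0.
rewrite -nneseriesD; last 2 first.
- by move=> n _ _; rewrite lee_fin mulr_ge0// ltW.
- by move=> n _ _; rewrite mule_ge0// lee_fin mulr_ge0.
apply: lee_nneseries => [n _ _|n _]; first by rewrite mule_ge0// lee_fin.
apply: (@le_trans _ _ ((c n)%:E * ((y n)%:E + ((y n `^ eps)^-1)%:E * a n))).
  by apply: lee_wpmul2l; rewrite ?lee_fin.
rewrite ge0_muleDr ?mule_ge0 ?lee_fin ?(ltW (y0 n))//.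
by rewrite muleA.
Qed.

Variables (t M : R).
Hypotheses (t0 : (0 < t)%R) (momt : \int[P t]_x (`|psi x| `^ (1 + eps)) <= M%:E).

Let Lt0 : (0 < L * t)%R. Proof. exact: mulr_gt0. Qed.

Lemma moment_bound_ge0 : (0 <= M)%R.
Proof.
rewrite -lee_fin; apply: le_trans momt.
by apply: integral_ge0 => x _; exact: poweR_ge0.
Qed.

Lemma series_moment : \sum_(0 <= n <oo) (exp_coeff (L * t) n)%:E * alpha n
  <= (expR (L * t) * M)%:E.
Proof.
have := momt; rewrite (mixP (ltW t0) mpow); last by move=> x; exact: poweR_ge0.
under eq_eseriesr do rewrite EFinM -muleA.
rewrite nneseriesZl; last first.
  by move=> n _; rewrite mule_ge0// lee_fin exp_coeff0// ltW.
move=> h; have e0 := expR_gt0 (L * t).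
rewrite EFinM -lee_pdivrMl//.
by rewrite -expRN.
Qed.

Lemma integral_abs_le : \int[P t]_x `|psi x| <= (1 + M)%:E.
Proof.
apply: (le_trans (moment_split (probability_setT _) ltr01)).
rewrite powR1 invr1 mul1e EFinD leeD2l//; exact: momt.
Qed.

(* The Poisson weights change from parameter L t to v: splitting |psi| at the
   geometric level r^(n/eps), r = v / (L t), turns v^n into (L t)^n in front of
   the moment of order 1 + eps. *)
Lemma series_abs (v : R) : (0 < v)%R ->
  \sum_(0 <= n <oo) (exp_coeff v n)%:E * beta n <=
  (expR (v * (v / (L * t)) `^ eps^-1) + expR (L * t) * M)%:E.
Proof.
move=> v0; set r := (v / (L * t))%R.
have r0 : (0 < r)%R by rewrite divr_gt0.
set c := (r `^ eps^-1)%R.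
have c0 : (0 < c)%R by exact: powR_gt0.
have cpow n : ((c ^+ n) `^ eps = r ^+ n)%R.
  have ce : (c `^ eps = r)%R.
    by rewrite /c -(powRrM r eps^-1 eps) mulVf ?gt_eqF// powRr1// ltW.
  rewrite -(powR_mulrn n (ltW c0)) -(powRrM c n%:R eps) mulrC (powRrM c eps) ce.
  exact: (powR_mulrn n (ltW r0)).
have h := @sum_split (exp_coeff v) (fun n => c ^+ n)%R (fun n => alpha n) (fun n => beta n).
apply: (le_trans (h _ _ _ _ _)) => //.
- by move=> n; rewrite exp_coeff0// ltW.
- by move=> n; rewrite exprn_gt0.
- by move=> n; apply: moment_split => //; rewrite exprn_gt0.
rewrite EFinD; apply: leeD.
  rewrite -nneseries_exp_coeff le_eqVlt; apply/orP; left; apply/eqP.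
  by apply: eq_eseriesr => n _; rewrite /exp_coeff /= exprMn mulrAC.
apply: le_trans series_moment.
rewrite le_eqVlt; apply/orP; left; apply/eqP.
apply: eq_eseriesr => n _; congr (_%:E * _).
have ev : (v = r * (L * t))%R by rewrite /r divfK// gt_eqF.
rewrite cpow /exp_coeff /= [X in (X ^+ n / _ / _)%R]ev exprMn mulrAC [(r ^+ n * _)%R]mulrC mulfK//.
by rewrite expf_neq0// gt_eqF.
Qed.

(* Here the level ((n + 1) / L)^(1/eps) t^(-q) compensates the ratio
   (n + 1) / (L t) of consecutive Poisson weights; it produces the integrable
   singularity t^(-q), q = 1 / (1 + eps). *)
Lemma series_abs_shift (B : R) : (t <= B)%R ->
  \sum_(0 <= n <oo) (exp_coeff (L * t) n)%:E * beta n.+1 <=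
  (((eps * L) `^ (- eps^-1) * expR 1 * expR (L * B * expR 1) + expR (L * B) * M)
    * t `^ (- q))%:E.
Proof.
move=> tB.
have p0 : (0 < 1 + eps)%R by rewrite addr_gt0.
pose y (n : nat) : R := ((n.+1%:R / L) `^ eps^-1 * t `^ (- q))%R.
have y0 n : (0 < y n)%R by rewrite mulr_gt0// powR_gt0// divr_gt0.
have ypow n : (y n `^ eps = n.+1%:R / L * t `^ (- q * eps))%R.
  rewrite powRM ?powR_ge0// -!powRrM mulVf ?gt_eqF// powRr1//.
  by rewrite divr_ge0// ltW.
have h := @sum_split (exp_coeff (L * t)) y (fun n => alpha n.+1) (fun n => beta n.+1).
apply: (le_trans (h _ _ _ _ _)) => //.
- by move=> n; rewrite exp_coeff0// ltW.
- by move=> n; exact: moment_split.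
have LtB : (L * t <= L * B)%R by rewrite ler_wpM2l// ltW.
rewrite mulrDl EFinD; apply: leeD.
(* The levels: [powR_le_expR] bounds (n+1)^(1/eps) by a multiple of exp(n+1), and exp(n) turns the
   parameter L t into L t exp(1). *)
- pose K : R := ((eps * L) `^ (- eps^-1) * expR 1 * t `^ (- q))%R.
  have K0 : (0 <= K)%R by rewrite !mulr_ge0 ?powR_ge0 ?expR_ge0.
  apply: (@le_trans _ _ (\sum_(0 <= n <oo) K%:E * (exp_coeff (L * t * expR 1) n)%:E)).
    apply: lee_nneseries => [n _ _|n _].
      by rewrite lee_fin mulr_ge0 ?exp_coeff0 ?(ltW Lt0)// ltW.
    rewrite -EFinM lee_fin.
    have -> : (exp_coeff (L * t * expR 1) n = exp_coeff (L * t) n * expR n%:R)%R.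
      by rewrite /exp_coeff /= exprMn mulrAC -[n%:R in RHS]mul1r expRM_natr.
    rewrite [leRHS]mulrCA ler_wpM2l ?exp_coeff0 ?(ltW Lt0)//.
    rewrite /y /K mulrAC ler_wpM2r ?powR_ge0// -mulrA -expRD nat1r.
    have := powR_le_expR eps0 (ler0n R n.+1).
    move=> hn.
    have iL : (L^-1 `^ eps^-1 = L `^ (- eps^-1))%R.
      by rewrite -(powR_inv1 (ltW L0)) -(powRrM L) mulN1r.
    have -> : ((eps * L) `^ (- eps^-1) * expR n.+1%:R =
      (eps `^ (- eps^-1) * expR n.+1%:R) * L^-1 `^ eps^-1)%R.
      by rewrite iL (powRM _ (ltW eps0) (ltW L0)) mulrAC.
    rewrite (powRM eps^-1 (ler0n R n.+1)) ?invr_ge0 ?(ltW L0)//.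
    by rewrite ler_wpM2r ?powR_ge0.
  rewrite nneseriesZl; last by move=> n _; rewrite lee_fin exp_coeff0// mulr_ge0 ?expR_ge0 ?(ltW Lt0).
  rewrite nneseries_exp_coeff -EFinM lee_fin /K mulrAC ler_wpM2r ?powR_ge0//.
  rewrite ler_wpM2l ?mulr_ge0 ?powR_ge0 ?expR_ge0// ler_expR.
  by rewrite ler_wpM2r ?expR_ge0.
- apply: (@le_trans _ _ ((t `^ (- q))%:E *
      \sum_(0 <= n <oo) (exp_coeff (L * t) n.+1)%:E * alpha n.+1)).
    rewrite -nneseriesZl; last first.
      by move=> n _; rewrite mule_ge0// lee_fin exp_coeff0// ltW.
    rewrite le_eqVlt; apply/orP; left; apply/eqP.
    apply: eq_eseriesr => n _; rewrite muleA -EFinM; congr (_%:E * _).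
    rewrite ypow /exp_coeff /= factS natrM exprS.
    (* The exponents match because q (1 + eps) = 1. *)
    have -> : (t `^ (- q) = t^-1 * t `^ (q * eps))%R.
      rewrite -(powR_inv1 (ltW t0)) -powRD; last by rewrite (gt_eqF t0) ?implybT.
      congr (_ `^ _)%R; have : (q * (1 + eps) = 1)%R by rewrite mulVf// gt_eqF.
      by rewrite mulrDr mulr1; lra.
    rewrite mulNr powRN.
    have n0 : (n.+1%:R != 0 :> R)%R by rewrite pnatr_eq0.
    have f0 : (n`!%:R != 0 :> R)%R by rewrite pnatr_eq0 -lt0n fact_gt0.
    have z0 : (t `^ (q * eps) != 0)%R by rewrite gt_eqF// powR_gt0.
    move: (n.+1%:R : R)%R (n`!%:R : R)%R (t `^ (q * eps))%R n0 f0 z0 => a b z a0 b0 z0.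
    by field; rewrite a0 b0 z0 !gt_eqF.
  rewrite [(_ * M * _)%R]mulrC EFinM; apply: lee_wpmul2l; first by rewrite lee_fin powR_ge0.
  apply: (@le_trans _ _ (expR (L * t) * M)%:E); last first.
    by rewrite lee_fin ler_wpM2r ?moment_bound_ge0// ler_expR.
  apply: le_trans series_moment.
  rewrite -(@nneseries_shift1 _ (fun n => (exp_coeff (L * t) n)%:E * alpha n)); last first.
    by move=> n; rewrite mule_ge0// lee_fin exp_coeff0// ltW.
  rewrite [leRHS]nneseries_recl//; last first.
    by move=> n _; rewrite mule_ge0// lee_fin exp_coeff0// ltW.
  by rewrite leeDr// mule_ge0// lee_fin exp_coeff0// ltW.
Qed.

End poisson_moments.

Section generator_uniformized.
Context (R : realType) (dT : measure_display) (T : measurableType dT).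
Variables (lam : T -> R) (k : R.-pker T ~> T) (L : R).
Hypotheses (mlam : measurable_fun setT lam) (lam0 : forall x, 0 <= lam x).
Hypotheses (lamL : forall x, lam x <= L) (L0 : 0 < L).
Local Open Scope ereal_scope.
Implicit Types (f : T -> \bar R).

Lemma measurable_generator f : measurable_fun setT f ->
  measurable_fun setT (generator lam k f).
Proof.
move=> mf; apply: emeasurable_funM; first exact/measurable_EFinP.
have mg : measurable_fun setT (fun z : T * T => f z.2 - f z.1).
  by apply: emeasurable_funB; apply: measurableT_comp.
rewrite (_ : (fun x => _) = (fun x => \int[k x]_y ((fun z : T * T => f z.2 - f z.1)^\+ (x, y))
   - \int[k x]_y ((fun z : T * T => f z.2 - f z.1)^\- (x, y)))); last first.
  apply/funext => x; rewrite integralE; congr (_ - _); apply: eq_integral => y _.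
    by rewrite !funeposE.
  by rewrite !funenegE.
apply: emeasurable_funB; apply: measurable_fun_integral_finite_kernel => //.
- exact: measurable_funepos.
- exact: measurable_funeneg.
Qed.

(** The jump part of L times the uniformized |f| is exactly lam times the mean of |f| after a jump,
    and lam <= L handles the subtracted term |f x|. *)
Lemma generator_abs_le f x : measurable_fun setT f ->
  (lam x)%:E * \int[k x]_y `|f y - f x| <=
  L%:E * (uniformized lam k L (fun y => `|f y|) x + `|f x|).
Proof.
move=> mf.
have mabs : measurable_fun setT (fun y => `|f y|) by exact: measurableT_comp.
have h1 : \int[k x]_y `|f y - f x| <= \int[k x]_y `|f y| + `|f x|.
  have <- : \int[k x]_y (cst `|f x| y) = `|f x|.
    by rewrite integral_cst// prob_kernel mule1.
  rewrite -(ge0_integralD (k x) measurableT (fun y _ => abse_ge0 (f y)) mabs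
    (fun y _ => abse_ge0 (f x)) (measurable_cst _)).
  apply: ge0_le_integral => //.
  - by apply: measurableT_comp => //; exact: emeasurable_funB.
  - exact: emeasurable_funD.
  - by move=> y _; exact: lee_abs_sub.
have lx0 : 0 <= (lam x)%:E by rewrite lee_fin.
apply: (le_trans (lee_wpmul2l lx0 h1)).
have I0 : 0 <= \int[k x]_y `|f y| by exact: integral_ge0.
rewrite ge0_muleDr//.
have L0e : 0 <= L%:E by rewrite lee_fin ltW.
have w0 : (0 <= 1 - lam x / L)%R by rewrite subr_ge0 ler_pdivrMr// mul1r.
have w2 : (0 <= lam x / L)%R by rewrite divr_ge0// ltW.
have U0 : 0 <= uniformized lam k L (fun y => `|f y|) x.
  by apply: uniformized_ge0 => //.
rewrite (ge0_muleDr L%:E U0)//.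
apply: leeD; last by apply: lee_wpmul2r => //; rewrite lee_fin.
rewrite /uniformized.
move: (\int[k x]_y `|f y|) I0 => A A0.
rewrite ge0_muleDr ?mule_ge0 ?lee_fin//.
rewrite [X in _ + X]muleA -EFinM mulrCA divff ?gt_eqF// mulr1 leeDr//.
by rewrite !mule_ge0// lee_fin.
Qed.

Lemma generator_defined_uniformized f x : measurable_fun setT f -> f x \is a fin_num ->
  uniformized lam k L (fun y => `|f y|) x < +oo -> generator_defined lam k f x.
Proof.
move=> mf fx Kx; split=> //; apply: (le_lt_trans (generator_abs_le x mf)).
rewrite lte_mul_pinfty ?lee_fin ?(ltW L0)//.
by rewrite lte_add_pinfty// -fin_num_abs.
Qed.

Lemma abse_generator_le f x : measurable_fun setT f ->
  `|generator lam k f x| <= L%:E * (uniformized lam k L (fun y => `|f y|) x + `|f x|).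
Proof.
move=> mf; apply: le_trans (generator_abs_le x mf).
rewrite /generator abseM (gee0_abs (_ : 0 <= (lam x)%:E)) ?lee_fin//.
apply: lee_wpmul2l; rewrite ?lee_fin//; apply: le_abse_integral => //.
exact: emeasurable_funB.
Qed.

(** The identity of the generator with L (K - 1). Positive and negative parts are kept apart because
    K is handled on nonnegative functions only. *)
Lemma generator_uniformized f x : measurable_fun setT f -> f x \is a fin_num ->
  uniformized lam k L (fun y => `|f y|) x < +oo ->
  generator lam k f x =
  L%:E * (uniformized lam k L f^\+ x - uniformized lam k L f^\- x - f x).
Proof.
move=> mf fx Kx.
have fE : f^\+ x - f^\- x = f x by rewrite [in RHS](funeposneg f).
have fpx : f^\+ x \is a fin_num.
  by rewrite funeposE; case: (f x) fx => [r _|//|//]; rewrite -fine_max.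
have fmx : f^\- x \is a fin_num.
  by rewrite funenegE; case: (f x) fx => [r _|//|//]; rewrite -EFinN -fine_max.
(* Where the intensity vanishes, the mean of |f| after a jump may be infinite; the product 0 * +oo =
   0 settles this case. *)
have [l0|l0] := eqVneq (lam x) 0%R.
  rewrite /generator /uniformized l0 mul0r !mul0e !adde0 subr0 !mul1e fE.
  by rewrite subee// mule0.
have lx0 : (0 < lam x)%R by rewrite lt0r l0 lam0.
have w0 : (0 <= 1 - lam x / L)%R by rewrite subr_ge0 ler_pdivrMr// mul1r.
have w2 : (0 < lam x / L)%R by rewrite divr_gt0.
have I0 : 0 <= \int[k x]_y `|f y| by exact: integral_ge0.
have If : (k x).-integrable setT f.
  apply/integrableP; split => //; rewrite ltey; apply/eqP => Iy; move: Kx.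
  rewrite /uniformized Iy gt0_muley ?lte_fin// addey ?ltxx//.
  by rewrite gt_eqF// (lt_le_trans (ltNyr 0))// mule_ge0// lee_fin.
have [Ip Im] : \int[k x]_y f^\+ y \is a fin_num /\ \int[k x]_y f^\- y \is a fin_num.
  split; first exact: integrable_pos_fin_num.
  exact: integrable_neg_fin_num.
have Ic : (k x).-integrable setT (cst (f x)).
  apply/integrableP; split => //=.
  rewrite (integral_cst (k x) measurableT `|f x|) prob_kernel mule1.
  by rewrite -fin_num_abs.
rewrite /generator /uniformized.
have -> : \int[k x]_y (f y - f x) = \int[k x]_y f^\+ y - \int[k x]_y f^\- y - f x.
  have ic : \int[k x]_y (cst (f x) y) = f x by rewrite integral_cst// prob_kernel mule1.
  rewrite -integralE -[X in _ - X]ic.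
  exact: (integralB measurableT If Ic).
rewrite -fE; move: Ip Im fpx fmx.
move: (\int[k x]_y f^\+ y) (\int[k x]_y f^\- y) (f^\+ x) (f^\- x).
move=> [a||//] [b||//] [p||//] [m||//] // _ _ _ _.
suff e : (lam x * (a - b - (p - m)) = L * ((1 - lam x / L) * p + lam x / L * a -
  ((1 - lam x / L) * m + lam x / L * b) - (p - m)))%R by exact: (congr1 EFin e).
by field; rewrite gt_eqF.
Qed.

End generator_uniformized.

Lemma cvg_weighted_fine (R : realType) (c : R^nat) (a : nat -> \bar R) :
  (forall n, 0 <= c n) -> (forall n, 0 <= a n)%E -> (forall n, a n \is a fin_num) ->
  (\sum_(0 <= n <oo) (c n)%:E * a n < +oo)%E ->
  (fun N => \sum_(n < N) c n * fine (a n)) @ \oo -->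
    fine (\sum_(0 <= n <oo) (c n)%:E * a n)%E.
Proof.
move=> c0 a0 af s_oo.
have t0 n : (0 <= (c n)%:E * a n)%E by rewrite mule_ge0// lee_fin.
have cvs := @is_cvg_nneseries _ (fun n => (c n)%:E * a n)%E xpredT 0 (fun n _ _ => t0 n).
have sf : (\sum_(0 <= n <oo) (c n)%:E * a n)%E \is a fin_num.
  by rewrite ge0_fin_numE// nneseries_ge0.
have : (fun N => \sum_(0 <= n < N) (c n)%:E * a n)%E @ \oo -->
    (fine (\sum_(0 <= n <oo) (c n)%:E * a n)%E)%:E.
  by rewrite fineK.
move=> /fine_cvg h.
rewrite (_ : (fun N => _) = fine \o (fun N => \sum_(0 <= n < N) (c n)%:E * a n)%E)//.
apply/funext => N /=.
rewrite -[LHS]/(fine (\sum_(n < N) c n * fine (a n))%:E) -sumEFin big_mkord.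
by congr fine; apply: eq_bigr => n _; rewrite EFinM fineK.
Qed.

Lemma cvg_succ (R : realType) (f : R^nat) (l : R) :
  f @ \oo --> l -> (fun n => f n.+1) @ \oo --> l.
Proof. by rewrite -cvg_shiftS. Qed.

Lemma exp_coeff_sum_shift (R : realType) (b : R^nat) (v : R) N j : 0 < v ->
  \sum_(n < N) exp_coeff v n * `|b (n + j.+1)%N| <=
  v^-1 * \sum_(n < N.+1) exp_coeff (2 * v) n * `|b (n + j)%N|.
Proof.
move=> v0; rewrite big_ord_recl /= mulrDr -[leLHS]add0r; apply: lerD.
  by rewrite mulr_ge0 ?invr_ge0 ?mulr_ge0 ?exp_coeff_ge0 ?mulr_ge0 ?(ltW v0).
rewrite mulr_sumr; apply: ler_sum => n _.
rewrite /bump leq0n add1n addSnnS mulrA ler_wpM2r//.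
exact: exp_coeff_shift.
Qed.

Section poisson_drift.
Context (R : realType) (dT : measure_display) (T : measurableType dT).
Variables (L eps : R) (mu : nat -> {measure set T -> \bar R}) (P : R -> probability T R).
Variables (lam : T -> R) (k : R.-pker T ~> T).
Hypotheses (mlam : measurable_fun setT lam) (lam0 : forall x, 0 <= lam x).
Hypotheses (lamL : forall x, lam x <= L) (L0 : 0 < L) (eps0 : 0 < eps).
Local Open Scope ereal_scope.
Hypothesis mu1 : forall n, mu n setT = 1.
Hypothesis muS : forall n f, measurable_fun setT f -> (forall x, 0 <= f x) ->
  \int[mu n.+1]_x f x = \int[mu n]_x uniformized lam k L f x.
Hypothesis mixP : forall (t : R) f, (0 <= t)%R -> measurable_fun setT f -> (forall x, 0 <= f x) ->
  \int[P t]_x f x = \sum_(0 <= n <oo)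
    (expR (- (L * t)) * exp_coeff (L * t) n)%:E * \int[mu n]_x f x.

Local Notation K f := (uniformized lam k L f).
Local Notation q := ((1 + eps)^-1)%R.

Let exp_coeff0 (v : R) n : (0 <= v)%R -> (0 <= exp_coeff v n)%R.
Proof. exact: exp_coeff_ge0. Qed.

Let weight0 (t : R) n : (0 <= t)%R -> (0 <= expR (- (L * t)) * exp_coeff (L * t) n)%R.
Proof. by move=> t0; rewrite mulr_ge0 ?expR_ge0 ?exp_coeff0 ?mulr_ge0 ?(ltW L0). Qed.

Let weight_le (t : R) n : (0 <= t)%R ->
  (expR (- (L * t)) * exp_coeff (L * t) n <= exp_coeff (L * t) n)%R.
Proof.
move=> t0; have Lt0 : (0 <= L * t)%R by rewrite mulr_ge0// ltW.
by rewrite ler_piMl ?exp_coeff0// -expR0 ler_expR oppr_le0.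
Qed.

Lemma uniformized_le f g x : measurable_fun setT f -> measurable_fun setT g ->
  (forall x, 0 <= f x) -> (forall x, f x <= g x) -> K f x <= K g x.
Proof.
move=> mf mg f0 fg.
have w0 : (0 <= 1 - lam x / L)%R by rewrite subr_ge0 ler_pdivrMr// mul1r.
have w2 : (0 <= lam x / L)%R by rewrite divr_ge0// ltW.
by apply: leeD; apply: lee_wpmul2l; rewrite ?lee_fin//; exact: ge0_le_integral.
Qed.

Lemma integral_uniformized (t : R) f : (0 <= t)%R -> measurable_fun setT f ->
  (forall x, 0 <= f x) -> \int[P t]_x K f x =
  \sum_(0 <= n <oo) (expR (- (L * t)) * exp_coeff (L * t) n)%:E * \int[mu n.+1]_x f x.
Proof.
move=> t0 mf f0; rewrite mixP//.
- by apply: eq_eseriesr => n _; rewrite muS.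
- exact: measurable_uniformized.
- exact: uniformized_ge0.
Qed.

Variables (psi : T -> \bar R) (t B M : R).
Hypothesis mpsi : measurable_fun setT psi.
Hypotheses (t0 : (0 < t)%R) (tB : (t <= B)%R).
Hypothesis momt : \int[P t]_x (`|psi x| `^ (1 + eps)) <= M%:E.

Local Notation absp := (fun x => `|psi x|).
Local Notation beta n := (\int[mu n]_x `|psi x|).
Local Notation b n := (fine (\int[mu n]_x psi x)).

Let mabs : measurable_fun setT absp.
Proof. exact: measurableT_comp. Qed.

Let abs0 x : 0 <= absp x. Proof. exact: abse_ge0. Qed.

Let beta0 n : 0 <= beta n. Proof. exact: integral_ge0. Qed.

Let mK f : measurable_fun setT f -> (forall x, 0 <= f x) -> measurable_fun setT (K f).
Proof. by move=> mf f0; exact: measurable_uniformized. Qed.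

Let M0 : (0 <= M)%R. Proof. exact: (moment_bound_ge0 momt). Qed.

(** The constant of [series_abs_shift]; it depends on t only through the upper bound B' of t and the
    moment bound M'. *)
Definition uniformized_bound (B' M' : R) : R :=
  ((eps * L) `^ (- eps^-1) * expR 1 * expR (L * B' * expR 1) + expR (L * B') * M')%R.

(** The constant of [series_abs], made uniform over t between A' and B'. The lower bound A' sits in
    a denominator, which is why second order estimates hold away from 0 only. *)
Definition series_bound (A' B' M' v : R) : R :=
  (expR (v * (v / (L * A')) `^ eps^-1) + expR (L * B') * M')%R.

Lemma weighted_uniformized_le :
  \sum_(0 <= n <oo) (exp_coeff (L * t) n)%:E * beta n.+1 <=
  (uniformized_bound B M * t `^ (- q))%:E.
Proof. exact: (series_abs_shift L0 eps0 mu1 mixP mpsi t0 momt tB). Qed.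

Lemma integral_uniformized_abs_le :
  \int[P t]_x K absp x <= (uniformized_bound B M * t `^ (- q))%:E.
Proof.
rewrite (integral_uniformized (ltW t0) mabs abs0).
apply: le_trans weighted_uniformized_le.
apply: lee_nneseries => [n _ _|n _]; first by rewrite mule_ge0// lee_fin weight0// ltW.
by apply: lee_wpmul2r => //; rewrite lee_fin weight_le// ltW.
Qed.

Lemma series_abs_lty (v : R) : (0 <= v)%R ->
  \sum_(0 <= n <oo) (exp_coeff v n)%:E * beta n < +oo.
Proof.
move=> v0; have v1 : (0 < v + 1)%R by rewrite addrC; exact: ltr_pwDl.
apply: (@le_lt_trans _ _ (\sum_(0 <= n <oo) (exp_coeff (v + 1) n)%:E * beta n)).
  apply: lee_nneseries => [n _ _|n _]; first by rewrite mule_ge0// lee_fin exp_coeff0.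
  apply: lee_wpmul2r => //; rewrite lee_fin /exp_coeff /= ler_wpM2r ?invr_ge0//.
  by rewrite lerXn2r ?nnegrE ?(ltW v1)// lerDl.
exact: (le_lt_trans (series_abs L0 eps0 mu1 mixP mpsi t0 momt v1) (ltry _)).
Qed.

(** Each [mu n] enters the convergent series at parameter 1 with a positive weight, so a moment at
    one positive time controls all these laws, the initial one included. *)
Lemma integrable_uniform_chain n : (mu n).-integrable setT psi.
Proof.
apply/integrableP; split=> //; rewrite ltey; apply/eqP => by_.
have := series_abs_lty (@ler01 R); apply/negP; rewrite -leNgt.
have h := @nneseries_lim_ge _ (fun n => (exp_coeff 1 n)%:E * beta n) xpredT 0 n.+1.
apply: le_trans (h _); last by move=> m _ _; rewrite mule_ge0// lee_fin exp_coeff0.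
rewrite big_nat_recr//= by_ gt0_muley; last by rewrite lte_fin /exp_coeff /= expr1n mul1r invr_gt0 ltr0n fact_gt0.
rewrite addey// gt_eqF// (lt_le_trans (ltNyr 0))//.
by apply: sume_ge0 => m _; rewrite mule_ge0// lee_fin exp_coeff0.
Qed.

(** This is what allows the potentials of time t to be tested against the laws at any other time
    s. *)
Lemma integrable_time (s : R) : (0 <= s)%R -> (P s).-integrable setT psi.
Proof.
move=> s0; apply/integrableP; split => //; rewrite (mixP s0 mabs abs0).
apply: le_lt_trans (series_abs_lty (mulr_ge0 (ltW L0) s0)).
apply: lee_nneseries => [n _ _|n _]; first by rewrite mule_ge0// lee_fin weight0.
by apply: lee_wpmul2r => //; rewrite lee_fin weight_le.
Qed.

Let pos_le f : f = psi^\+ \/ f = psi^\- ->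
  [/\ measurable_fun setT f, forall x, 0 <= f x & forall x, f x <= `|psi x|].
Proof.
case=> ->; split => //.
- exact: measurable_funepos.
- by move=> x; rewrite -[leRHS]/((abse \o psi) x) fune_abse leeDl.
- exact: measurable_funeneg.
- by move=> x; rewrite -[leRHS]/((abse \o psi) x) fune_abse leeDr.
Qed.

Lemma integral_split_uniform_chain n :
  [/\ \int[mu n]_x psi^\+ x \is a fin_num, \int[mu n]_x psi^\- x \is a fin_num &
   b n = (fine (\int[mu n]_x psi^\+ x)%E - fine (\int[mu n]_x psi^\- x)%E)%R].
Proof.
have hi := integrable_uniform_chain n.
have hp := integrable_pos_fin_num measurableT hi.
have hm := integrable_neg_fin_num measurableT hi.
by split => //; rewrite integralE fineB.
Qed.

Lemma cvg_poisson_sum (s : R) j : (0 <= s)%R ->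
  \sum_(0 <= n <oo) (expR (- (L * s)) * exp_coeff (L * s) n)%:E * beta (n + j) < +oo ->
  (fun N => poisson_sum L (fun n => b n) N j s) @ \oo -->
  (fine (\sum_(0 <= n <oo) (expR (- (L * s)) * exp_coeff (L * s) n)%:E
     * \int[mu (n + j)%N]_x psi^\+ x) -
   fine (\sum_(0 <= n <oo) (expR (- (L * s)) * exp_coeff (L * s) n)%:E
     * \int[mu (n + j)%N]_x psi^\- x))%R.
Proof.
move=> s0 soo.
have pm f : f = psi^\+ \/ f = psi^\- ->
  \sum_(0 <= n <oo) (expR (- (L * s)) * exp_coeff (L * s) n)%:E
     * \int[mu (n + j)%N]_x f x < +oo.
  move=> /pos_le [mf f0 fle]; apply: le_lt_trans soo.
  apply: lee_nneseries => [n _ _|n _].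
    by rewrite mule_ge0// ?lee_fin ?weight0//; exact: integral_ge0.
  apply: lee_wpmul2l; first by rewrite lee_fin weight0.
  exact: ge0_le_integral.
rewrite (_ : (fun N => _) = (fun N =>
  \sum_(n < N) (expR (- (L * s)) * exp_coeff (L * s) n) * fine (\int[mu (n + j)%N]_x psi^\+ x)
  - \sum_(n < N) (expR (- (L * s)) * exp_coeff (L * s) n) *
     fine (\int[mu (n + j)%N]_x psi^\- x))%R); last first.
  apply/funext => N; rewrite /poisson_sum -sumrB mulr_sumr; apply: eq_bigr => n _.
  by have [_ _ ->] := integral_split_uniform_chain (n + j); rewrite mulrBr -!mulrA mulrBr.
apply: cvgB; apply: cvg_weighted_fine.
- by move=> n; exact: weight0.
- by move=> n; exact: integral_ge0.
- by move=> n; have [] := integral_split_uniform_chain (n + j).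
- by apply: pm; left.
- by move=> n; exact: weight0.
- by move=> n; exact: integral_ge0.
- by move=> n; have [] := integral_split_uniform_chain (n + j).
- by apply: pm; right.
Qed.

Lemma cvg_poisson_sum_time (s : R) : (0 <= s)%R ->
  (fun N => poisson_sum L (fun n => b n) N 0 s) @ \oo --> fine (\int[P s]_x psi x).
Proof.
move=> s0; have hi := integrable_time s0.
have hp := integrable_pos_fin_num measurableT hi.
have hm := integrable_neg_fin_num measurableT hi.
rewrite integralE fineB//.
have [mp p0 _] := pos_le (or_introl erefl).
have [mm m0 _] := pos_le (or_intror erefl).
rewrite (mixP s0 mp p0) (mixP s0 mm m0).
have E f : \sum_(0 <= n <oo) (expR (- (L * s)) * exp_coeff (L * s) n)%:E * \int[mu (n + 0)%N]_x f x =
    \sum_(0 <= n <oo) (expR (- (L * s)) * exp_coeff (L * s) n)%:E * \int[mu n]_x f x.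
  by apply: eq_eseriesr => n _; rewrite addn0.
have := @cvg_poisson_sum s 0 s0; rewrite !E -(mixP s0 mabs abs0); apply.
by have /integrableP[] := hi.
Qed.

Let Kabs_lty : \int[P t]_x K absp x < +oo.
Proof. exact: (le_lt_trans integral_uniformized_abs_le (ltry _)). Qed.

Let integrable_K f : f = psi^\+ \/ f = psi^\- \/ f = absp -> (P t).-integrable setT (K f).
Proof.
move=> h.
have [mf f0 fle] : [/\ measurable_fun setT f, forall x, 0 <= f x & forall x, f x <= `|psi x|].
  by case: h => [h|[h| ->]]; first (by apply: pos_le; left); first (by apply: pos_le; right).
have Kf0 := uniformized_ge0 k lam0 lamL L0 f0.
apply/integrableP; split; first exact: mK.
apply: le_lt_trans Kabs_lty; apply: ge0_le_integral => //.
- by apply: measurableT_comp => //; exact: mK.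
- exact: mK.
- by move=> x _; rewrite gee0_abs//; exact: uniformized_le.
Qed.

Lemma ae_fin_uniformized :
  {ae P t, forall x, psi x \is a fin_num /\ K absp x < +oo}.
Proof.
have h1 := integrable_ae measurableT (integrable_time (ltW t0)).
have h2 := integrable_ae measurableT (integrable_K (or_intror (or_intror erefl))).
apply: filterS2 h1 h2 => x h1 h2; split; first exact: h1.
by rewrite -ge0_fin_numE ?h2//; exact: uniformized_ge0.
Qed.

Lemma ae_generator_defined : {ae P t, forall x, generator_defined lam k psi x}.
Proof.
apply: filterS ae_fin_uniformized => x [px Kx].
exact: (generator_defined_uniformized lam0 lamL L0).
Qed.

Lemma integral_abs_generator_le : \int[P t]_x `|generator lam k psi x| <=
  (L * (uniformized_bound B M * t `^ (- q) + (1 + M)))%:E.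
Proof.
have mg := measurable_generator k mlam mpsi.
apply: (@le_trans _ _ (\int[P t]_x (L%:E * (K absp x + absp x)))).
  apply: ge0_le_integral => //.
  - exact: measurableT_comp.
  - by apply: emeasurable_funM => //; apply: emeasurable_funD => //; exact: mK.
  - by move=> x _; exact: (abse_generator_le k lam0 lamL L0).
have K0 := uniformized_ge0 k lam0 lamL L0 abs0.
rewrite ge0_integralZl_EFin ?(ltW L0)//; last 2 first.
- by move=> x _; rewrite adde_ge0.
- by apply: emeasurable_funD => //; exact: mK.
rewrite EFinM; apply: lee_wpmul2l; first by rewrite lee_fin ltW.
rewrite (ge0_integralD (P t) measurableT (fun x _ => K0 x) (mK mabs abs0) (fun x _ => abs0 x) mabs).
by rewrite EFinD; apply: leeD; [exact: integral_uniformized_abs_le|exact: (integral_abs_le eps0 mpsi momt)].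
Qed.

Lemma integrable_generator : (P t).-integrable setT (generator lam k psi).
Proof.
apply/integrableP; split; first exact: measurable_generator.
exact: (le_lt_trans integral_abs_generator_le (ltry _)).
Qed.

Lemma fine_integral_generator : fine (\int[P t]_x generator lam k psi x) =
  (L * (fine (\int[P t]_x K psi^\+ x) - fine (\int[P t]_x K psi^\- x)
     - fine (\int[P t]_x psi x)))%R.
Proof.
have ip := integrable_K (or_introl erefl).
have im := integrable_K (or_intror (or_introl erefl)).
have i0 := integrable_time (ltW t0).
have ipm := integrableB measurableT ip im.
have h := integrableB measurableT ipm i0.
have -> : \int[P t]_x generator lam k psi x =
    \int[P t]_x (L%:E * (K psi^\+ x - K psi^\- x - psi x)).
  apply: ae_eq_integral => //.
  - exact: measurable_generator.
  - by have /integrableP[] := integrableZl measurableT L h.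
  - apply: filterS ae_fin_uniformized => x [px Kx] _.
    exact: (generator_uniformized lam0 lamL L0).
rewrite (integralZl measurableT h) (integralB measurableT ipm i0) (integralB measurableT ip im).
have := integrable_fin_num measurableT ip.
have := integrable_fin_num measurableT im.
have := integrable_fin_num measurableT i0.
move: (\int[P t]_x K psi^\+ x) (\int[P t]_x K psi^\- x) (\int[P t]_x psi x).
by move=> [x||//] [y||//] [z||//].
Qed.

(** The left side is the derivative at t of the truncated mean, as given by [is_derive_poisson_sum];
    its limit identifies the first order term with the integrated generator. *)
Lemma cvg_poisson_sum_generator :
  (fun N => L * (poisson_sum L (fun n => b n) N.+1 1 t - poisson_sum L (fun n => b n) N.+2 0 t))%R
  @ \oo --> fine (\int[P t]_x generator lam k psi x).
Proof.
rewrite fine_integral_generator.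
have [mp p0 _] := pos_le (or_introl erefl).
have [mm m0 _] := pos_le (or_intror erefl).
rewrite (integral_uniformized (ltW t0) mp p0) (integral_uniformized (ltW t0) mm m0).
apply: cvgMr; apply: cvgB; last first.
  exact: (cvg_succ (cvg_succ (cvg_poisson_sum_time (ltW t0)))).
have E f : \sum_(0 <= n <oo) (expR (- (L * t)) * exp_coeff (L * t) n)%:E * \int[mu (n + 1)%N]_x f x =
    \sum_(0 <= n <oo) (expR (- (L * t)) * exp_coeff (L * t) n)%:E * \int[mu n.+1]_x f x.
  by apply: eq_eseriesr => n _; rewrite addn1.
have := @cvg_poisson_sum t 1 (ltW t0); rewrite !E.
rewrite -(integral_uniformized (ltW t0) mabs abs0) => /(_ Kabs_lty) h.
exact: (cvg_succ h).
Qed.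

Let abs_b n : (`|b n|)%:E <= beta n.
Proof.
have hi := integrable_uniform_chain n.
rewrite -abse_EFin fineK; last exact: integrable_fin_num.
exact: le_abse_integral.
Qed.

Lemma partial_sum_le (c : R^nat) j Q N : (forall n, 0 <= c n)%R ->
  \sum_(0 <= n <oo) (c n)%:E * beta (n + j) <= Q%:E ->
  (\sum_(n < N) c n * `|b (n + j)| <= Q)%R.
Proof.
move=> c0 cQ; rewrite -lee_fin; apply: le_trans cQ.
have h := @nneseries_lim_ge _ (fun n => (c n)%:E * beta (n + j)) xpredT 0 N.
apply: le_trans (h _); last by move=> m _ _; rewrite mule_ge0// lee_fin.
rewrite big_mkord -sumEFin; apply: lee_sum => n _; rewrite EFinM.
by apply: lee_wpmul2l; rewrite ?lee_fin.
Qed.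

(** Mean value bound on [0, t] for the truncated means. The weights exp_coeff (L s) n increase with
    s, so the bounds at time t serve on the whole interval. C will be of order t^(-q), which makes
    the increment O(t^(1-q)). *)
Lemma integral_increment_le (C : R) : (0 <= C)%R ->
  (uniformized_bound B M * t `^ (- q) <= C)%R ->
  (expR (L * B) * (1 + M) <= C)%R ->
  (`|fine (\int[P 0%R]_x psi x) - fine (\int[P t]_x psi x)| <= 2 * L * C * t)%R.
Proof.
move=> C0 h1 h2.
have e0 n : (0 <= exp_coeff (L * t) n)%R by rewrite exp_coeff0// mulr_ge0// ltW.
have hc1 : (fun N => `|poisson_sum L (fun n => b n) N.+1 0 0
    - poisson_sum L (fun n => b n) N.+1 0 t|)%R @ \oo -->
    `|fine (\int[P 0%R]_x psi x) - fine (\int[P t]_x psi x)|%R.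
  apply: cvg_norm; apply: cvgB.
    exact: (cvg_succ (cvg_poisson_sum_time (lexx 0%R))).
  exact: (cvg_succ (cvg_poisson_sum_time (ltW t0))).
rewrite -(cvg_lim _ hc1)//; apply: limr_le; first by apply/cvg_ex; eexists; exact: hc1.
near=> N; apply: poisson_sum_increment => //; first exact: ltW.
  apply: (le_trans _ h1); apply: partial_sum_le => //.
  by under eq_eseriesr do rewrite addn1; exact: weighted_uniformized_le.
apply: (le_trans _ h2); apply: partial_sum_le => //.
under eq_eseriesr do rewrite addn0.
have := integral_abs_le eps0 mpsi momt; rewrite (mixP (ltW t0) mabs abs0).
have -> : \sum_(0 <= n <oo) (expR (- (L * t)) * exp_coeff (L * t) n)%:E * beta n =
    (expR (- (L * t)))%:E * \sum_(0 <= n <oo) (exp_coeff (L * t) n)%:E * beta n.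
  rewrite -nneseriesZl; last by move=> n _; rewrite mule_ge0// lee_fin.
  by apply: eq_eseriesr => n _; rewrite EFinM -muleA.
move=> h; have eL := expR_gt0 (L * t).
move: h; rewrite expRN lee_pdivrMl// => h; apply: (le_trans h).
rewrite -EFinM lee_fin ler_wpM2r ?addr_ge0// ler_expR.
by rewrite ler_wpM2l// ltW.
Unshelve. all: by end_near. Qed.

(** The three terms bound the sums with shifts 0, 1 and 2; each shift doubles the parameter, by
    [exp_coeff_shift]. *)
Definition taylor_bound (A' B' M' : R) : R :=
  (series_bound A' B' M' (L * B') + (L * B')^-1 * series_bound A' B' M' (2 * (L * B'))
   + (L * B')^-1 * ((2 * (L * B'))^-1 * series_bound A' B' M' (2 * (2 * (L * B')))))%R.

(** Limit in N of [poisson_sum_taylor]: the bound Q on the partial sums with shifts up to 2 depends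
    neither on N nor on t in [A, B]. *)
Lemma integral_taylor_le (A s : R) : (0 < A)%R -> (A <= t)%R -> (0 <= s <= B)%R ->
  (`|fine (\int[P s]_x psi x) - fine (\int[P t]_x psi x)
     - (s - t) * fine (\int[P t]_x generator lam k psi x)| <=
   4 * L ^+ 2 * taylor_bound A B M * (s - t) ^+ 2)%R.
Proof.
move=> A0 At sB; have s0 : (0 <= s)%R by case/andP: sB.
have B0 : (0 < B)%R by exact: lt_le_trans tB.
have LB0 : (0 < L * B)%R by exact: mulr_gt0.
have bnd v N : (0 < v)%R ->
    (\sum_(n < N) exp_coeff v n * `|b (n + 0)| <= series_bound A B M v)%R.
  move=> v0; apply: partial_sum_le => [n|]; first by rewrite exp_coeff0// ltW.
  under eq_eseriesr do rewrite addn0.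
  apply: (le_trans (series_abs L0 eps0 mu1 mixP mpsi t0 momt v0)).
  rewrite lee_fin; apply: lerD.
    rewrite ler_expR ler_wpM2l ?(ltW v0)//; apply: ge0_ler_powR.
    - by rewrite invr_ge0 ltW.
    - by rewrite nnegrE divr_ge0 ?(ltW v0)// mulr_ge0// ltW.
    - by rewrite nnegrE divr_ge0 ?(ltW v0)// mulr_ge0// ltW.
    - rewrite ler_wpM2l ?(ltW v0)// lef_pV2 ?posrE ?mulr_gt0//.
      by rewrite ler_wpM2l// ltW.
  by rewrite ler_wpM2r// ler_expR ler_wpM2l// ltW.
have sb0 v : (0 <= series_bound A B M v)%R.
  by rewrite addr_ge0 ?expR_ge0// mulr_ge0 ?expR_ge0.
have v2 : (0 < 2 * (L * B))%R by rewrite mulr_gt0.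
have v4 : (0 < 2 * (2 * (L * B)))%R by rewrite mulr_gt0.
have Qb j N : (j <= 2)%N ->
    (\sum_(n < N) exp_coeff (L * B) n * `|b (n + j)| <= taylor_bound A B M)%R.
  have i1 : (0 <= (L * B)^-1)%R by rewrite invr_ge0 ltW.
  have i2 : (0 <= (2 * (L * B))^-1)%R by rewrite invr_ge0 ltW.
  case: j => [|[|[|//]]] _.
  - apply: (le_trans (bnd _ _ LB0)); rewrite /taylor_bound -addrA lerDl.
    by rewrite addr_ge0 ?mulr_ge0.
  - apply: (le_trans (@exp_coeff_sum_shift _ (fun n => b n) _ _ 0 LB0)).
    apply: (@le_trans _ _ ((L * B)^-1 * series_bound A B M (2 * (L * B)))%R).
      by rewrite ler_wpM2l//; exact: bnd.
    by rewrite /taylor_bound addrAC lerDr addr_ge0 ?mulr_ge0.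
  - apply: (le_trans (@exp_coeff_sum_shift _ (fun n => b n) _ _ 1 LB0)).
    apply: (@le_trans _ _ ((L * B)^-1 *
        ((2 * (L * B))^-1 * series_bound A B M (2 * (2 * (L * B)))))%R).
      rewrite ler_wpM2l//.
      apply: (le_trans (@exp_coeff_sum_shift _ (fun n => b n) _ _ 0 v2)).
      by rewrite ler_wpM2l//; exact: bnd.
    by rewrite /taylor_bound lerDr addr_ge0 ?mulr_ge0.
have hc : (fun N => `|poisson_sum L (fun n => b n) N.+2 0 s
    - poisson_sum L (fun n => b n) N.+2 0 t -
    (s - t) * (L * (poisson_sum L (fun n => b n) N.+1 1 t
      - poisson_sum L (fun n => b n) N.+2 0 t))|)%R @ \oo -->
    `|fine (\int[P s]_x psi x) - fine (\int[P t]_x psi x)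
     - (s - t) * fine (\int[P t]_x generator lam k psi x)|%R.
  apply: cvg_norm; apply: cvgB; last first.
    by apply: cvgMr; exact: cvg_poisson_sum_generator.
  apply: cvgB.
    exact: (cvg_succ (cvg_succ (cvg_poisson_sum_time s0))).
  exact: (cvg_succ (cvg_succ (cvg_poisson_sum_time (ltW t0)))).
rewrite -(cvg_lim _ hc)//; apply: limr_le; first by apply/cvg_ex; eexists; exact: hc.
near=> N; apply: (poisson_sum_taylor L0 N Qb sB).
by rewrite (ltW t0) tB.
Unshelve. all: by end_near. Qed.

End poisson_drift.

Section generator_shift.
Context (R : realType) (dT : measure_display) (T : measurableType dT).
Variables (lam : T -> R) (k : R.-pker T ~> T).
Local Open Scope ereal_scope.

Let subB_EFin (x y : \bar R) (a : R) : (x - a%:E) - (y - a%:E) = x - y.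
Proof.
case: x y => [x||] [y||] //=.
by apply: (congr1 EFin); rewrite opprB addrA subrK.
Qed.

(** Additive constants are invisible to the generator, so it is enough to bound the moments of
    centred functions. *)
Lemma generator_shift (f : T -> \bar R) (a : R) x :
  generator lam k (fun y => f y - a%:E) x = generator lam k f x.
Proof.
by rewrite /generator; congr (_ * _); apply: eq_integral => y _; exact: subB_EFin.
Qed.

Lemma generator_defined_shift (f : T -> \bar R) (a : R) x :
  generator_defined lam k (fun y => f y - a%:E) x -> generator_defined lam k f x.
Proof.
move=> [fx h]; split; first by case: (f x) fx.
rewrite (_ : \int[k x]_y `|f y - f x| = \int[k x]_y `|f y - a%:E - (f x - a%:E)|)//.
by apply: eq_integral => y _; rewrite subB_EFin.
Qed.

End generator_shift.

Section drift_estimates.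
Context (R : realType) (dT : measure_display) (T : measurableType dT).
Context (dO : measure_display) (Omega : measurableType dO) (Pr : probability Omega R).
Variables (lam : T -> R) (k : R.-pker T ~> T) (X : R -> {RV Pr >-> T}).
Local Open Scope ereal_scope.

(** Isolated as a predicate because it is applied to both processes, and to the potentials as well
    as to their truncations. Here q stands for 1 / (1 + eps); C controls the singularity at 0, and
    C2 is used from time A on. *)
Definition drift_estimates (q B M A C C2 : R) : Prop :=
  forall (t a : R) (psi : T -> \bar R), (0 < t <= B)%R -> measurable_fun setT psi ->
    \int[marginal X t]_x (`|psi x - a%:E| `^ q^-1) <= M%:E ->
  [/\ {ae marginal X t, forall x, generator_defined lam k psi x},
      (marginal X t).-integrable setT (generator lam k psi),
      \int[marginal X t]_x `|generator lam k psi x| <= (C * t `^ (- q))%:E,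
      (forall s, (0 <= s)%R -> (marginal X s).-integrable setT psi) /\
      (`|fine (\int[marginal X 0%R]_x psi x) - fine (\int[marginal X t]_x psi x)|
        <= C * t `^ (- q) * t)%R &
      (A <= t)%R -> forall s, (0 <= s <= B)%R ->
      (`|fine (\int[marginal X s]_x psi x) - fine (\int[marginal X t]_x psi x)
        - (s - t) * fine (\int[marginal X t]_x generator lam k psi x)|
       <= C2 * (s - t) ^+ 2)%R].

(** C is produced before A: the first order bounds must hold up to time 0 with a constant that does
    not depend on the cut-off. *)
Lemma jump_process_drift_estimates (L q B M : R) : pure_jump_process lam k X ->
  (0 < L)%R -> (forall x, lam x <= L)%R -> (0 < q < 1)%R -> (0 < B)%R -> (0 <= M)%R ->
  exists C, (0 <= C)%R /\ forall A, (0 < A)%R -> exists C2, (0 <= C2)%R /\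
    drift_estimates q B M A C C2.
Proof.
move=> pX L0 lamL /andP[q0 q1] B0 M0.
have [[mlam lam0 _] _] := pX.
have [mu [mu1 [muS mixP]]] := pure_jump_uniformization pX L0 lamL.
pose eps : R := (q^-1 - 1)%R.
have eps0 : (0 < eps)%R by rewrite subr_gt0 invf_gt1.
have qE : (1 + eps = q^-1)%R by rewrite /eps addrC subrK.
have qEV : ((1 + eps)^-1 = q)%R by rewrite qE invrK.
pose ub := uniformized_bound L eps B M.
have ub0 : (0 <= ub)%R.
  by rewrite addr_ge0 ?mulr_ge0 ?powR_ge0 ?expR_ge0.
(* Since t <= B, the product B^q t^(-q) is at least 1, so bounded terms are absorbed into a multiple
   of t^(-q). *)
pose C0 : R := (ub + expR (L * B) * (1 + M) * B `^ q)%R.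
have C00 : (0 <= C0)%R.
  by rewrite addr_ge0// !mulr_ge0 ?powR_ge0 ?expR_ge0 ?addr_ge0.
exists (2 * L * C0)%R; split; first by rewrite !mulr_ge0// ltW.
move=> A A0; pose C2 := (4 * L ^+ 2 * `|taylor_bound L eps A B M|)%R.
exists C2; split; first by rewrite !mulr_ge0// ?exprn_ge0// ltW.
move=> t a psi /andP[t0 tB] mpsi mom.
pose phi x := psi x - a%:E.
have mphi : measurable_fun setT phi by exact: emeasurable_funB.
have momphi : \int[marginal X t]_x (`|phi x| `^ (1 + eps)) <= M%:E by rewrite qE.
have genE x : generator lam k phi x = generator lam k psi x.
  by exact: generator_shift.
have igenE s : \int[marginal X s]_x generator lam k phi x =
    \int[marginal X s]_x generator lam k psi x.
  by apply: eq_integral => x _.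
have iphi s : (0 <= s)%R -> (marginal X s).-integrable setT phi.
  by move=> s0; exact: (integrable_time L0 eps0 mu1 mixP mphi t0 momphi).
have ic s : (marginal X s).-integrable setT (cst a%:E).
  exact: finite_measure_integrable_cst.
have ipsi s : (0 <= s)%R -> (marginal X s).-integrable setT psi.
  move=> s0; rewrite (_ : psi = (fun x => phi x + a%:E)); last first.
    by apply/funext => x; rewrite /phi subeK.
  exact: (integrableD measurableT (iphi _ s0) (ic s)).
have fphi s : (0 <= s)%R -> fine (\int[marginal X s]_x phi x) =
    (fine (\int[marginal X s]_x psi x) - a)%R.
  move=> s0; rewrite (integralB measurableT (ipsi _ s0) (ic s)).
  have -> : \int[marginal X s]_x (cst a%:E x) = a%:E.
    apply: (etrans (integral_cst _ measurableT _)); rewrite -[RHS]mule1.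
    by congr (_ * _); exact: probability_setT.
  rewrite fineB//.
  exact: (integrable_fin_num measurableT (ipsi _ s0)).
have tq : (1 <= B `^ q * t `^ (- q))%R.
  rewrite powRN ler_pdivlMr ?powR_gt0// mul1r ge0_ler_powR ?nnegrE ?(ltW q0) ?(ltW t0)//.
  exact: ltW.
have tq0 : (0 <= t `^ (- q))%R by exact: powR_ge0.
have e1 : (1 <= expR (L * B))%R by rewrite -expR0 ler_expR mulr_ge0// ltW.
have h1 : (uniformized_bound L eps B M * t `^ (- q) <= C0 * t `^ (- q))%R.
  rewrite ler_wpM2r// /C0 lerDl !mulr_ge0 ?powR_ge0 ?expR_ge0 ?addr_ge0//.
have h2 : (expR (L * B) * (1 + M) <= C0 * t `^ (- q))%R.
  apply: (@le_trans _ _ (expR (L * B) * (1 + M) * B `^ q * t `^ (- q))%R).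
    by rewrite -[leRHS]mulrA ler_peMr// mulr_ge0 ?expR_ge0 ?addr_ge0.
  by rewrite ler_wpM2r// /C0 lerDr.
split.
- have h := ae_generator_defined mlam lam0 lamL L0 eps0 mu1 muS mixP mphi t0 tB momphi.
  by apply: filterS h => x; exact: generator_defined_shift.
- rewrite (_ : generator lam k psi = generator lam k phi); last exact/funext.
  exact: (integrable_generator mlam lam0 lamL L0 eps0 mu1 muS mixP mphi t0 tB momphi).
- have h := integral_abs_generator_le mlam lam0 lamL L0 eps0 mu1 muS mixP mphi t0 tB momphi.
  rewrite (_ : \int[marginal X t]_x `|generator lam k psi x| =
    \int[marginal X t]_x `|generator lam k phi x|); last first.
    by apply: eq_integral => x _; rewrite genE.
  apply: (le_trans h); rewrite lee_fin qEV.
  apply: (@le_trans _ _ (L * (C0 * t `^ (- q) + C0 * t `^ (- q)))%R).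
    apply: ler_wpM2l; first exact: ltW.
    apply: lerD => //; apply: le_trans h2; rewrite ler_peMl// addr_ge0//.
  by rewrite le_eqVlt; apply/orP; left; apply/eqP; ring.
- split=> //.
  have h := integral_increment_le L0 eps0 mu1 mixP mphi t0 tB momphi.
  have := h (C0 * t `^ (- q))%R; rewrite qEV => /(_ _ h1 h2).
  rewrite !fphi// ?(ltW t0)// opprB addrA subrK mulrA; apply.
  by rewrite mulr_ge0.
- move=> At s sB.
  have h := integral_taylor_le mlam lam0 lamL L0 eps0 mu1 muS mixP mphi t0 tB momphi A0 At sB.
  have s0 : (0 <= s)%R by case/andP: sB.
  move: h; rewrite !fphi// ?(ltW t0)// igenE opprB addrA subrK => h; apply: (le_trans h).
  by rewrite ler_wpM2r ?sqr_ge0// ler_wpM2l ?ler_norm// mulr_ge0// exprn_ge0// (ltW L0).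
Qed.

End drift_estimates.

(** * One-sided differential inequalities *)

Section monotone_slopes.
Context {R : realType}.
Local Notation leb := (@lebesgue_measure R).

(** Over n + 1 equal steps the right-hand sides telescope to (G b - G a) (b - a) / (n + 1), which
    tends to 0. *)
Lemma quadratic_increment_constant (F G : R -> R) (a b : R) : a <= b ->
  (forall u v, a <= u -> u <= v -> v <= b -> `|F v - F u| <= (G v - G u) * (v - u)) ->
  F a = F b.
Proof.
move=> ab FG; apply/eqP; rewrite -subr_eq0 -normr_eq0; apply/eqP.
have key n : `|F a - F b| * n.+1%:R <= (G b - G a) * (b - a).
  pose u i := a + i%:R * ((b - a) / n.+1%:R).
  have h0 : 0 <= (b - a) / n.+1%:R by rewrite divr_ge0// subr_ge0.
  have u0 : u 0%N = a by rewrite /u mul0r addr0.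
  have un : u n.+1 = b by rewrite /u mulrCA divff ?pnatr_eq0// mulr1 addrC subrK.
  have uS i : u i.+1 - u i = (b - a) / n.+1%:R.
    by rewrite /u opprD addrACA subrr add0r -mulrBl -natrB// subSnn mul1r.
  have au i : a <= u i by rewrite /u lerDl mulr_ge0.
  have ub i : (i < n.+1)%N -> u i.+1 <= b.
    by move=> ni; rewrite -un /u lerD2l ler_wpM2r// ler_nat.
  rewrite -ler_pdivlMr ?ltr0Sn// distrC -u0 -un.
  rewrite -(telescope_sumr (fun i => F (u i)) (leq0n _)).
  rewrite -(telescope_sumr (fun i => G (u i)) (leq0n _)) -mulrA mulr_suml.
  apply: (le_trans (ler_norm_sum _ _ _)); rewrite big_nat [leRHS]big_nat.
  apply: ler_sum => i /andP[_ ni].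
  rewrite un u0 -(uS i); apply: FG => //; last exact: ub.
  by rewrite -subr_ge0 uS.
apply/eqP; rewrite eq_le normr_ge0 andbT leNgt; apply/negP => F0.
set c := (G b - G a) * (b - a) in key.
have := key (Num.truncn (c / `|F a - F b|)).
rewrite -ler_pdivlMl// mulrC leNgt; apply/negP/negPn.
exact: truncnS_gt.
Qed.

Lemma Rintegral_itv_oc_bounds (f : R -> R) (u v m M : R) : u <= v ->
  leb.-integrable `]u, v] (EFin \o f) ->
  (forall r, u <= r -> r <= v -> m <= f r /\ f r <= M) ->
  m * (v - u) <= \int[leb]_(r in `]u, v]) f r /\
  \int[leb]_(r in `]u, v]) f r <= M * (v - u).
Proof.
move=> uv fi mM.
have lv : leb `]u, v] = (v - u)%:E.
  by rewrite lebesgue_measure_itv/= lte_fin; case: ltP => // vu; rewrite (@le_anti _ _ u v) ?uv// subrr.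
have lvoo : (leb `]u, v] < +oo)%E by rewrite lv ltry.
have ic c : leb.-integrable `]u, v] (EFin \o cst c).
  apply: (measurable_bounded_integrable (mu := leb) _ lvoo) => //.
  exact: bounded_cst.
have cE c : \int[leb]_(r in `]u, v]) (cst c r) = c * (v - u).
  rewrite /Rintegral /= integral_cst//=.
  exact: (congr1 (fun x => fine (c%:E * x)%E) lv).
by split; rewrite -cE; apply: le_Rintegral => // r /=;
  rewrite in_itv/= => /andP[/ltW ur rv]; have [] := mM r ur rv.
Qed.

Variables (w D : R -> R) (A B C : R).
Hypotheses (AB : A <= B) (C0 : 0 <= C).
Hypothesis support : forall t s, A <= t <= B -> A <= s <= B ->
  w t - D t * (s - t) - C * (s - t) ^+ 2 <= w s.

Lemma increment_bounds u v : A <= u -> u <= v -> v <= B ->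
  - D u * (v - u) - C * (v - u) ^+ 2 <= w v - w u /\
  w v - w u <= - D v * (v - u) + C * (v - u) ^+ 2.
Proof.
move=> Au uv vB.
have Iu : A <= u <= B by rewrite Au (le_trans uv).
have Iv : A <= v <= B by rewrite vB (le_trans Au).
by have := support Iu Iv; have := support Iv Iu; split; lra.
Qed.

(* Add the two support inequalities, at u and at v. *)
Lemma slope_nondecreasing u v : A <= u -> u <= v -> v <= B ->
  2 * C * u - D u <= 2 * C * v - D v.
Proof.
move=> Au uv vB; have [h1 h2] := increment_bounds Au uv vB.
have [->|uv'] := eqVneq u v; first by [].
have vu : 0 < v - u by rewrite subr_gt0 lt_neqAle uv' uv.
have h : (v - u) * (D v - D u) <= (v - u) * (2 * C * (v - u)) by lra.
by rewrite ler_pM2l// in h; lra.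
Qed.

(** The slopes are monotone on [A, B] only; composing with the projection onto [A, B] gives a
    monotone, hence Borel, function on the whole line. *)
Let clamp (r : R) := Num.max A (Num.min r B).

Let clampE r : A <= r <= B -> clamp r = r.
Proof. by move=> /andP[Ar rB]; rewrite /clamp (min_l rB) (max_r Ar). Qed.

Let clampI r : A <= clamp r <= B.
Proof. by rewrite /clamp le_max lexx ge_max AB ge_min lexx orbT. Qed.

Let clamp_nd : {homo clamp : r s / r <= s}.
Proof.
move=> r s rs; rewrite /clamp ge_max !le_max lexx /= le_min !ge_min lexx rs orbT /= !orbT.
by [].
Qed.

Let slope (r : R) := 2 * C * clamp r - D (clamp r).

Let slope_nd : {homo slope : r s / r <= s}.
Proof.
move=> r s rs; have /andP[h1 h2] := clampI r; have /andP[h3 h4] := clampI s.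
by apply: slope_nondecreasing => //; exact: clamp_nd.
Qed.

Let Dc (r : R) := 2 * C * clamp r - slope r.

Let DcE r : A <= r <= B -> Dc r = D r.
Proof. by move=> rAB; rewrite /Dc /slope clampE// opprB addrC subrK. Qed.

Let mDc : measurable_fun setT Dc.
Proof.
apply: measurable_funB; last exact: nondecreasing_measurable.
by apply: measurable_funM => //; exact: nondecreasing_measurable.
Qed.

Lemma measurable_slope : measurable_fun (`[A, B]%classic : set R) D.
Proof.
apply: (eq_measurable_fun Dc).
  by move=> r; rewrite inE/= in_itv/= => rAB; rewrite DcE.
exact: measurable_funTS.
Qed.

Let Dc_integrable (I : interval R) : (leb [set` I] < +oo)%E ->
  leb.-integrable [set` I] (EFin \o Dc).
Proof.
move=> Ioo; apply: (measurable_bounded_integrable (mu := leb)) => //.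
- exact: measurable_funTS.
- exists (`|2 * C * B| + `|2 * C * A| + `|slope B| + `|slope A|).
  split; first exact: num_real.
  move=> K hK r _ /=; apply: (le_trans _ (ltW hK)); rewrite /Dc.
  have /andP[h1 h2] := clampI r.
  have s1 : slope A <= slope r.
    rewrite {1}/slope /slope clampE ?lexx ?AB//.
    exact: slope_nondecreasing.
  have s2 : slope r <= slope B.
    rewrite {2}/slope /slope [clamp B]clampE ?lexx ?AB//.
    exact: slope_nondecreasing.
  have c1 : 2 * C * A <= 2 * C * clamp r by rewrite ler_wpM2l// mulr_ge0.
  have c2 : 2 * C * clamp r <= 2 * C * B by rewrite ler_wpM2l// mulr_ge0.
  have := ler_norm (2 * C * B); have := ler_norm (- (2 * C * A)); rewrite normrN.
  have := ler_norm (slope B); have := ler_norm (- slope A); rewrite normrN.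
  have := normr_ge0 (2 * C * B); have := normr_ge0 (2 * C * A).
  have := normr_ge0 (slope A); have := normr_ge0 (slope B).
  by rewrite ler_norml => *; apply/andP; split; lra.
Qed.

(** The increments of w and those of the integral of D are squeezed between the same end point
    slopes, up to C times the squared step. Hence w plus this integral satisfies
    [quadratic_increment_constant] with G r = 3 C r - D r, without any differentiability of w. *)
Lemma increment_integral u v : A <= u -> u <= v -> v <= B ->
  w v - w u = - \int[leb]_(r in `[u, v]) D r.
Proof.
move=> Au uv vB.
pose J x := \int[leb]_(r in `[u, x]) Dc r.
have ii x : leb.-integrable `[u, x] (EFin \o Dc).
  apply: Dc_integrable; rewrite lebesgue_measure_itv/=.
  by case: ifP => // _; rewrite -EFinB ltry.
have JE x y : u <= x -> x <= y -> J y - J x = \int[leb]_(r in `]x, y]) Dc r.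
  by move=> ux xy; rewrite /J Rintegral_itvB.
have : w u + J u = w v + J v.
  apply: (@quadratic_increment_constant (fun x => w x + J x) (fun r => 3 * C * r - D r) _ _ uv).
  move=> x y ux xy yv.
  have Ax : A <= x by exact: le_trans ux.
  have yB : y <= B by exact: le_trans yv vB.
  have [h1 h2] := increment_bounds Ax xy yB.
  have hi : leb.-integrable `]x, y] (EFin \o Dc).
    apply: Dc_integrable; rewrite lebesgue_measure_itv/=.
    by case: ifP => // _; rewrite -EFinB ltry.
  have [|h3 h4] := @Rintegral_itv_oc_bounds Dc x y (D y - 2 * C * (y - x)) (D x + 2 * C * (y - x)) xy hi.
    move=> r xr ry.
    have Ar : A <= r by exact: le_trans xr.
    have rB : r <= B by exact: le_trans yB.
    rewrite DcE ?Ar//.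
    have := slope_nondecreasing Ax xr rB; have := slope_nondecreasing Ar ry yB.
    have : 2 * C * x <= 2 * C * r by rewrite ler_wpM2l// mulr_ge0.
    have : 2 * C * r <= 2 * C * y by rewrite ler_wpM2l// mulr_ge0.
    by move=> *; split; lra.
  rewrite (_ : w y + J y - (w x + J x) = (w y - w x) + (J y - J x)); last by ring.
  rewrite (JE x y ux xy) ler_norml.
  by apply/andP; split; lra.
rewrite /J set_itv1 Rintegral_set1 addr0 => ->.
rewrite opprD addNKr; congr (- _); apply: eq_Rintegral => r.
rewrite inE/= in_itv/= => /andP[ur rv].
by rewrite DcE// (le_trans Au ur) (le_trans rv vB).
Qed.

End monotone_slopes.

Section time_analysis.
Context {R : realType}.
Local Notation leb := (@lebesgue_measure R).
Variables (w D : R -> R) (q : R).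
Hypothesis q01 : 0 < q < 1.

Let mitv (I : interval R) : measurable ([set` I] : set (measurableTypeR R)).
Proof. exact: measurable_itv. Qed.

Lemma integral_powRN_le (A B : R) : 0 < A -> 
  (\int[leb]_(t in `[A, B]) (t `^ (- q))%:E <= (B `^ (1 - q) / (1 - q))%:E)%E.
Proof.
move=> A0; have /andP[q0 q1] := q01.
have q2 : 0 < 1 - q by rewrite subr_gt0.
have [AB|BA] := ltP A B; last first.
  rewrite (_ : \int[leb]_(t in `[A, B]) (t `^ (- q))%:E = 0)%E; last first.
    move: BA; rewrite le_eqVlt => /predU1P[->|BA]; first by rewrite set_itv1 integral_set1.
    by rewrite set_itv_ge ?integral_set0//= bnd_simp -ltNge.
  by rewrite lee_fin divr_ge0 ?powR_ge0// ltW.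
have dF (t : R) : 0 < t -> is_derive t (1 : R) (fun r : R => r `^ (1 - q) / (1 - q)) (t `^ (- q)).
  move=> t0; have h := is_derive1_powR (1 - q) t0.
  have hM := is_deriveM h (is_derive_cst ((1 - q)^-1 : R) t (1 : R)).
  apply: (is_derive_eq hM); rewrite scaler0 add0r /GRing.scale/= mulKf ?gt_eqF//.
  by rewrite addrC addKr.
rewrite (@continuous_FTC2 _ _ (fun r : R => r `^ (1 - q) / (1 - q)))//.
- by rewrite -EFinB lee_fin gerBl divr_ge0 ?powR_ge0// ltW.
- apply: continuous_in_subspaceT => r; rewrite inE/= in_itv/= => /andP[Ar _].
  apply: differentiable_continuous; apply/derivable1_diffP.
  by have [] := is_derive1_powR (- q) (lt_le_trans A0 Ar).
- have cF r : 0 < r -> {for r, continuous (fun r : R => r `^ (1 - q) / (1 - q))}.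
    move=> r0; apply: differentiable_continuous; apply/derivable1_diffP.
    by have [] := dF r r0.
  split.
  - by move=> r; rewrite in_itv/= => /andP[Ar _]; have [] := dF r (lt_trans A0 Ar).
  - by apply: cvg_at_right_filter; exact: cF.
  - by apply: cvg_at_left_filter; apply: cF; exact: lt_trans AB.
- move=> r; rewrite in_itv/= => /andP[Ar _]; rewrite derive1E.
  by have := dF r (lt_trans A0 Ar) => h; apply: derive_val.
Qed.

(** Monotone exhaustion by the intervals [1/(n+1), B], on which the primitive is regular and gives a
    bound that does not depend on n because q < 1. *)
Lemma powRN_integrable (B : R) :
  leb.-integrable `]0, B] (EFin \o (fun t : R => t `^ (- q))).
Proof.
have mpow : measurable_fun setT (fun t : R => (t `^ (- q))%:E).
  by apply/measurable_EFinP; exact: measurable_powR.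
apply/integrableP; split; first exact: measurable_funTS.
pose F (n : nat) : set R := `[n.+1%:R^-1, B]%classic.
have FU : `]0, B]%classic = \bigcup_n F n.
  apply/seteqP; split => [r|r [n _]]; rewrite /F /= !in_itv/=.
    move=> /andP[r0 rB]; exists (Num.truncn r^-1) => //; rewrite /F/= in_itv/= rB andbT.
    by rewrite -[leRHS]invrK lef_pV2 ?posrE ?invr_gt0// ltW// truncnS_gt.
  by move=> /andP[nr ->]; rewrite andbT (lt_le_trans _ nr).
under eq_integral do rewrite gee0_abs ?lee_fin ?powR_ge0//.
rewrite FU.
have h : (\int[leb]_(x in F n) (x `^ (- q))%:E)%E @[n --> \oo] -->
    (\int[leb]_(x in \bigcup_n F n) (x `^ (- q))%:E)%E.
  apply: ge0_nondecreasing_set_cvg_integral.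
  - move=> m n mn; apply/subsetPset => r; rewrite /F /= !in_itv/= => /andP[mr ->]; rewrite andbT.
    by apply: le_trans mr; rewrite lef_pV2 ?posrE// ler_nat ltnS.
  - by move=> n; exact: measurable_itv.
  - by move=> n; exact: measurable_funTS.
  - by move=> n r _; rewrite lee_fin powR_ge0.
apply: (@le_lt_trans _ _ (B `^ (1 - q) / (1 - q))%:E); last exact: ltry.
rewrite -(cvg_lim _ h)//; apply: lime_le; first by apply/cvg_ex; eexists; exact: h.
near=> n; apply: integral_powRN_le.
by rewrite invr_gt0.
Unshelve. all: by end_near. Qed.

Hypothesis Dbound : forall B, 0 < B ->
  exists C, 0 <= C /\ forall t, 0 < t <= B -> `|D t| <= C * t `^ (- q).
Hypothesis support : forall A B, 0 < A -> A <= B -> exists C, 0 <= C /\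
  forall t s, A <= t <= B -> A <= s <= B -> w t - D t * (s - t) - C * (s - t) ^+ 2 <= w s.
Hypothesis w_cvg0 : w x @[x --> 0^'+] --> w 0.

Lemma drift_measurable (B : R) : measurable_fun (`]0, B]%classic : set R) D.
Proof.
have [B0|B0] := leP B 0.
  rewrite set_itv_ge; first exact: measurable_fun_set0.
  by rewrite bnd_simp -leNgt.
pose F (n : nat) : set R := `[B / n.+1%:R, B]%classic.
have -> : `]0, B]%classic = \bigcup_n F n.
  apply/seteqP; split => [r|r [n _]]; rewrite /F /= !in_itv/=.
    move=> /andP[r0 rB]; exists (Num.truncn (B / r)) => //; rewrite /F/= in_itv/= rB andbT.
    by rewrite ler_pdivrMr// mulrC -ler_pdivrMr// ltW// truncnS_gt.
  by move=> /andP[nr ->]; rewrite andbT (lt_le_trans _ nr)// divr_gt0.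
apply/measurable_fun_bigcup => n; first exact: measurable_itv.
have n0 : 0 < B / n.+1%:R by rewrite divr_gt0.
have nB : B / n.+1%:R <= B by rewrite ler_pdivrMr// ler_peMr ?(ltW B0)// ler1n.
by have [C [_ h]] := support n0 nB; exact: (measurable_slope nB h).
Qed.

Lemma drift_integrable (B : R) : leb.-integrable `[0, B] (EFin \o D).
Proof.
have [B0|B0] := ltP B 0.
  by rewrite set_itv_ge ?bnd_simp -?ltNge//; exact: integrable_set0.
have mD : measurable_fun (`[0, B]%classic : set R) D.
  rewrite -(@setU1itv _ R (BRight B) 0 false) ?bnd_simp//; apply/measurable_funU => //; split.
    exact: measurable_fun_set1.
  exact: drift_measurable.
have m0 : measurable ([set 0] : set (measurableTypeR R)) by exact: measurable_set1.
have mI : measurable (`[0, B]%classic : set (measurableTypeR R)) by exact: measurable_itv.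
have mED : measurable_fun (`[0, B]%classic : set (measurableTypeR R)) (EFin \o D).
  exact/measurable_EFinP.
(* [Dbound] says nothing about D at 0; the origin is removed as a null set. *)
apply: (negligible_integrable m0 mI mED (lebesgue_measure_set1 0)).2.
have -> : `[0, B]%classic `\` [set (0 : R)] = `]0, B]%classic.
  apply/seteqP; split => r /=; rewrite !in_itv/=.
    by move=> [/andP[r0 ->] /eqP r1]; rewrite andbT lt0r r1.
  move=> /andP[r0 ->]; rewrite (ltW r0); split => // r1.
  by rewrite r1 ltxx in r0.
have B1 : 0 < B + 1 by rewrite ltr_wpDl.
have [C [C0 hC]] := Dbound B1.
have mJ : measurable (`]0, B]%classic : set (measurableTypeR R)) by exact: measurable_itv.
have hi := integrableZl mJ C (powRN_integrable B).
apply: (le_integrable mJ _ _ hi).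
- by apply/measurable_EFinP; exact: drift_measurable.
- move=> r /=; rewrite in_itv/= => /andP[r0 rB].
  rewrite lee_fin (le_trans (hC r _)) ?ler_norm// r0/= (le_trans rB)// lerDl//.
Qed.

Lemma increment_eq (s t : R) : 0 < s -> s <= t ->
  w t - w s = - \int[leb]_(r in `[s, t]) D r.
Proof.
move=> s0 st; have [C [C0 h]] := support s0 st.
exact: (increment_integral st C0 h).
Qed.

(** [increment_eq] holds on [s, t] for s > 0; then s tends to 0, using the right continuity of w at
    0 and the smallness of the integral of D near 0. *)
Lemma evolution_eq (t : R) : 0 <= t -> w t = w 0 - \int[leb]_(r in `[0, t]) D r.
Proof.
rewrite le_eqVlt => /predU1P[<-|t0]; first by rewrite set_itv1 Rintegral_set1 subr0.
have it := drift_integrable t.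
apply/eqP; rewrite -subr_eq0 -normr_le0; apply/ler_addgt0Pr => e e0; rewrite add0r.
have e2 : 0 < e / 2 by rewrite divr_gt0.
have near1 : \forall s \near (0 : R)^'+, `|w 0 - w s| < e / 2.
  by move/cvgrPdist_lt : w_cvg0; exact.
have near2 : \forall s \near (0 : R)^'+, `|\int[leb]_(r in `[0, s]) D r| < e / 2.
  have := parameterized_integral_near_left t0 e2 it.
  move=> h; rewrite near_withinE; apply: filterS h => s hs s0.
  exact: (hs (ltW s0)).
have [s [s0 st h1 h2]] : exists s, [/\ 0 < s, s < t, `|w 0 - w s| < e / 2 &
    `|\int[leb]_(r in `[0, s]) D r| < e / 2].
  near (0 : R)^'+ => s; exists s; split; near: s => //.
  - exact: nbhs_right_gt.
  - exact: nbhs_right_lt.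
have h3 := increment_eq s0 (ltW st).
have h4 : \int[leb]_(r in `[0, t]) D r - \int[leb]_(r in `[0, s]) D r
    = \int[leb]_(r in `[s, t]) D r.
  rewrite Rintegral_itvB ?bnd_simp ?ltW// Rintegral_itv_obnd_cbnd//.
  apply: (integrableS (mitv _) (mitv _) _ it).
  by move=> r /=; rewrite !in_itv/= => /andP[/(lt_trans s0)/ltW -> ->].
rewrite (_ : w t - (w 0 - \int[leb]_(r in `[0, t]) D r) =
  (w s - w 0) + \int[leb]_(r in `[0, s]) D r); last by lra.
rewrite (le_trans (ler_normD _ _))// distrC.
by move: h1 h2; lra.
Unshelve. all: by end_near. Qed.

Lemma evolution_lipschitz : locally_lipschitz_on `]0, +oo[ w.
Proof.
move=> a b ab.
have [ba|a_b] := ltP b a.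
  exists 0; split; first exact: num_real.
  by move=> K _ [x y] /= [+ _]; rewrite in_itv/= => /andP[/le_trans /[apply]]; rewrite leNgt ba.
have a0 : 0 < a.
  have : a \in `]0, +oo[ by apply: ab; rewrite /= in_itv/= lexx a_b.
  by rewrite in_itv/= andbT.
have [C [C0 h]] := support a0 a_b.
have b0 : 0 < b by exact: lt_le_trans a_b.
have [K [K0 hK]] := Dbound b0.
have Db t : a <= t <= b -> `|D t| <= K * a `^ (- q).
  move=> /andP[at_ tb]; have t0 : 0 < t by exact: lt_le_trans at_.
  rewrite (le_trans (hK t _)) ?t0// ler_wpM2l// !powRN lef_pV2 ?posrE ?powR_gt0//.
  have /andP[q0 q1] := q01.
  by rewrite ge0_ler_powR ?nnegrE// ltW.
have lip x y : a <= x -> x <= y -> y <= b -> `|w y - w x| <= (K * a `^ (- q) + C * (b - a)) * (y - x).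
  move=> ax xy yb; have [h1 h2] := increment_bounds h ax xy yb.
  have hyx : 0 <= y - x by rewrite subr_ge0.
  have e1 : C * (y - x) ^+ 2 <= C * (b - a) * (y - x).
    by rewrite expr2 mulrA ler_wpM2r// ler_wpM2l//; lra.
  have xb : x <= b by exact: le_trans yb.
  have ay : a <= y by exact: le_trans xy.
  have dx : D x <= K * a `^ (- q) by rewrite (le_trans (ler_norm _))// Db// ax xb.
  have dy : - D y <= K * a `^ (- q).
    by rewrite (le_trans (ler_norm _))// normrN Db// ay yb.
  have d1 := ler_wpM2r hyx dx; have d2 := ler_wpM2r hyx dy.
  by rewrite ler_norml; apply/andP; split; lra.
exists (K * a `^ (- q) + C * (b - a)); split; first exact: num_real.
move=> M hM [x y] /= []; rewrite !in_itv/= => /andP[ax xb] /andP[ay yb].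
have hxy z : 0 <= z -> (K * a `^ (- q) + C * (b - a)) * z <= M * z.
  by move=> z0; rewrite ler_wpM2r// ltW.
have [xy|/ltW yx] := leP x y.
  apply: (le_trans _ (hxy _ (normr_ge0 _))); rewrite (distrC (w x)) (distrC x).
  by rewrite (ger0_norm (_ : 0 <= y - x)) ?subr_ge0//; exact: lip.
apply: (le_trans _ (hxy _ (normr_ge0 _))).
by rewrite (ger0_norm (_ : 0 <= x - y)) ?subr_ge0//; exact: lip.
Qed.

(** Almost everywhere differentiation of the integral in [evolution_eq]. The function D is cut off
    at n to be integrable on the line, and the countably many exceptional null sets are gathered at
    the end. *)
Lemma evolution_derive : {ae leb, forall t : R, 0 < t -> is_derive t 1 w (- D t)}.
Proof.
have key n : {ae leb, forall t : R, 0 < t -> t < n%:R -> is_derive t 1 w (- D t)}.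
  pose f := (fun t => - D t) \_ `[0, n%:R].
  have iN : leb.-integrable `[0, n%:R] (EFin \o (fun t => - D t)).
    rewrite (_ : EFin \o _ = (fun t => - (EFin \o D) t)%E)//.
    by apply: integrableN; exact: drift_integrable.
  have fT : leb.-integrable setT (EFin \o f).
    by rewrite -restrict_EFin; apply/integrable_restrict => //=; rewrite setTI.
  have := @FTC1 _ f (BLeft 0) _ (integrable_locally (measurable_itv _) iN).
  move=> /(_ (fun y => integrableS measurableT (mitv _) (@subsetT _ _) fT)).
  apply: filterS; first exact: (ae_filter_ringOfSetsType leb).
  move=> t h t0 tn; have [|d1 d2] := h; first by rewrite lte_fin.
  have wE : \forall y \near t, w y = w 0 + \int[leb]_(r in `[0, y]) f r.
    near=> y.
    have y0 : 0 < y by near: y; exact: lt_nbhsr.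
    have yn : y < n%:R by near: y; exact: lt_nbhsl.
    rewrite (evolution_eq (ltW y0)); congr (_ + _).
    rewrite -mulN1r -(RintegralZl (-1) (mitv _) (drift_integrable y)).
    apply: eq_Rintegral => r; rewrite mulN1r inE/= in_itv/= => /andP[r0 ry].
    by rewrite /f patchE ifT// inE/= in_itv/= r0 (le_trans ry)// ltW.
  have ft : f t = - D t by rewrite /f patchE ifT// inE/= in_itv/= !ltW.
  have hF : is_derive t (1 : R) (fun y => \int[leb]_(r in `[0, y]) f r) (- D t).
    by apply: (DeriveDef d1); rewrite -derive1E d2.
  have wE' : \forall y \near t, w 0 + \int[leb]_(r in `[0, y]) f r = w y.
    by apply: filterS wE => y ->.
  apply: (near_eq_is_derive wE').
  have hD := is_deriveD (is_derive_cst (w 0) t (1 : R)) hF.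
  by apply: (is_derive_eq hD); rewrite add0r.
have /ae_foralln := key.
apply: filterS => t h t0; apply: (h (Num.truncn t).+1) => //; exact: truncnS_gt.
Unshelve. all: by end_near. Qed.

End time_analysis.

(** * From Borel to Lebesgue measurability in time, and domination by a power *)

Section completed_transfer.
Context {R : realType}.
Local Notation leb := (@lebesgue_measure R).
Local Notation cleb := (@completed_lebesgue_measure R).
Local Notation CT := (caratheodory_type (R := R) (wlength idfun)^*%mu).
Local Open Scope ereal_scope.

Lemma borel_caratheodory (A : set R) :
  measurable (A : set (measurableTypeR R)) -> measurable (A : set CT).
Proof. exact: sub_caratheodory. Qed.

Lemma borel_lebesgue_measurable (A : set R) (f : R -> \bar R) :
  measurable (A : set (measurableTypeR R)) ->
  measurable_fun (A : set (measurableTypeR R)) f -> measurable_fun (A : set CT) f.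
Proof. by move=> mA mf _ Y mY; apply: borel_caratheodory; exact: mf. Qed.

(** The identity map from the completed to the Borel sigma-algebra is measurable and pushes the
    completed measure to the Borel one. *)
Lemma ge0_completed_integral (A : set R) (f : R -> \bar R) :
  measurable (A : set (measurableTypeR R)) ->
  measurable_fun (A : set (measurableTypeR R)) f -> (forall x, A x -> 0 <= f x) ->
  \int[cleb]_(x in A) f x = \int[leb]_(x in A) f x.
Proof.
move=> mA mf f0.
have mid : @measurable_fun _ _ CT (measurableTypeR R) setT id.
  by move=> _ Y mY; rewrite setTI; exact: borel_caratheodory.
have := @ge0_integral_pushforward _ _ CT (measurableTypeR R) R id mid cleb A f mA mf.
rewrite -/(\int[cleb]_(x in A) f x) => <-; last by move=> x; rewrite inE; exact: f0.
by apply: eq_measure_integral => B mB BA.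
Qed.

Lemma completed_integrable (A : set R) (f : R -> \bar R) :
  measurable (A : set (measurableTypeR R)) ->
  leb.-integrable A f -> cleb.-integrable A f.
Proof.
move=> mA /integrableP[mf fi]; apply/integrableP; split.
  exact: borel_lebesgue_measurable.
have mabs : measurable_fun (A : set (measurableTypeR R)) (fun x => `|f x|).
  exact: measurableT_comp.
by rewrite (ge0_completed_integral mA mabs).
Qed.

Lemma completed_integral (A : set R) (f : R -> \bar R) :
  measurable (A : set (measurableTypeR R)) ->
  measurable_fun (A : set (measurableTypeR R)) f ->
  \int[cleb]_(x in A) f x = \int[leb]_(x in A) f x.
Proof.
move=> mA mf; rewrite integralE [RHS]integralE.
rewrite (ge0_completed_integral mA (measurable_funepos mf) (fun x _ => funepos_ge0 f x)).
by rewrite (ge0_completed_integral mA (measurable_funeneg mf) (fun x _ => funeneg_ge0 f x)).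
Qed.

Lemma integrable_locally_on0 (f : R -> \bar R) :
  (forall b, leb.-integrable `[0%R, b] f) -> locally_integrable_on `[0%R, +oo[ f.
Proof.
move=> fi a b ab.
have mI (I : interval R) : measurable ([set` I] : set (measurableTypeR R)).
  exact: measurable_itv.
have [ba|a_b] := ltP b a.
  by rewrite set_itv_ge ?bnd_simp -?ltNge//; exact: integrable_set0.
have a0 : (0 <= a)%R.
  have : a \in `[0%R, +oo[ by apply: ab; rewrite /= in_itv/= lexx a_b.
  by rewrite in_itv/= andbT.
apply: completed_integrable => //; apply: (integrableS (mI _) (mI _) _ (fi b)).
by move=> r /=; rewrite !in_itv/= => /andP[ar ->]; rewrite (le_trans a0 ar).
Qed.

Section domination.
Variables (q : R) (F : R -> \bar R).
Hypothesis q01 : (0 < q < 1)%R.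
Hypothesis Fbound : forall B : R, (0 < B)%R -> exists C : R, (0 <= C)%R /\
  forall t : R, (0 < t <= B)%R -> `|F t| <= (C * t `^ (- q))%:E.

Let bound i : R := sval (cid (Fbound (ltr0Sn R i))).

Let bound_ge0 i : (0 <= bound i)%R.
Proof. by rewrite /bound; case: cid => C []. Qed.

Let boundP i (t : R) : (0 < t <= i.+1%:R)%R -> `|F t| <= (bound i * t `^ (- q))%:E.
Proof. by rewrite /bound; case: cid => C [/= _ h]; exact: h. Qed.

(** The constants of [Fbound] depend on the time horizon in an arbitrary way; summing them makes
    them nondecreasing in t, so the dominating function is measurable even if F is not. *)
Let H (t : R) : R := (\sum_(i < (Num.truncn t).+1) bound i)%R.

Let H_nd : {homo H : s t / (s <= t)%R}.
Proof.
move=> s t st; rewrite /H -!(big_mkord xpredT bound).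
have st1 : ((Num.truncn s).+1 <= (Num.truncn t).+1)%N by rewrite ltnS le_truncn.
by rewrite [leRHS](big_cat_nat (leq0n _) st1)//= lerDl sumr_ge0.
Qed.

Let H_ge0 t : (0 <= H t)%R. Proof. exact: sumr_ge0. Qed.

Let bound_le t : (bound (Num.truncn t) <= H t)%R.
Proof. by rewrite /H big_ord_recr/= lerDr sumr_ge0. Qed.

(* Nothing is known about F 0, hence the value +oo. *)
Let G (t : R) : \bar R := if (t <= 0)%R then +oo else (H t * t `^ (- q))%:E.

Let G_pos (t : R) : (0 < t)%R -> G t = (H t * t `^ (- q))%:E.
Proof. by move=> t0; rewrite /G leNgt t0. Qed.

Let FG (t : R) : (0 <= t)%R -> `|F t| <= G t.
Proof.
rewrite le_eqVlt => /predU1P[<-|t0]; first by rewrite /G lexx leey.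
rewrite G_pos//; apply: (le_trans (@boundP (Num.truncn t) t _)).
  by rewrite t0 ltW// truncnS_gt.
by rewrite lee_fin ler_wpM2r ?powR_ge0.
Qed.

Let G_integrable (b : R) : leb.-integrable `[0%R, b] G.
Proof.
have mI (I : interval R) : measurable ([set` I] : set (measurableTypeR R)).
  exact: measurable_itv.
have [b0|b0] := ltP b 0%R.
  by rewrite set_itv_ge ?bnd_simp -?ltNge//; exact: integrable_set0.
have mGp : measurable_fun (`]0%R, b]%classic : set (measurableTypeR R)) G.
  apply: (eq_measurable_fun (fun t => (H t * t `^ (- q))%:E)).
    by move=> t; rewrite inE/= in_itv/= => /andP[t0 _]; rewrite G_pos.
  apply/measurable_EFinP; apply: measurable_funM.
    by apply: nondecreasing_measurable => //; exact: mI.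
  by apply: measurable_funTS; exact: measurable_powR.
have mG : measurable_fun (`[0%R, b]%classic : set (measurableTypeR R)) G.
  rewrite -(@setU1itv _ R (BRight b) 0%R false) ?bnd_simp//; apply/measurable_funU => //.
  by split => //; exact: measurable_fun_set1.
have m0 : measurable ([set 0%R] : set (measurableTypeR R)) by exact: measurable_set1.
apply: (negligible_integrable m0 (mI _) mG (lebesgue_measure_set1 0%R)).2.
have -> : `[0%R, b]%classic `\` [set (0%R : R)] = `]0%R, b]%classic.
  apply/seteqP; split => r /=; rewrite !in_itv/=.
    by move=> [/andP[r0 ->] /eqP r1]; rewrite andbT lt0r r1.
  move=> /andP[r0 ->]; rewrite (ltW r0); split => // r1.
  by rewrite r1 ltxx in r0.
have hi := integrableZl (mI _) (H b) (powRN_integrable q01 b).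
apply: (le_integrable (mI _) mGp _ hi) => t /=; rewrite in_itv/= => /andP[t0 tb].
rewrite G_pos// lee_fin ger0_norm ?mulr_ge0 ?powR_ge0//.
apply: le_trans (ler_norm _); rewrite ler_wpM2r ?powR_ge0//; exact: H_nd.
Qed.

Let G_local : locally_integrable_on `[0%R, +oo[ G.
Proof. exact: integrable_locally_on0. Qed.

Lemma power_bound_dominated : locally_dominated_on `[0%R, +oo[ F.
Proof.
exists G; split; first exact: G_local.
by move=> t; rewrite /= in_itv/= andbT; exact: FG.
Qed.

Lemma power_bound_integrable : lebesgue_measurable_on `[0%R, +oo[ F ->
  locally_integrable_on `[0%R, +oo[ F.
Proof.
move=> mF a b ab.
have mA (A : set R) : measurable (A : set (measurableTypeR R)) -> measurable (A : set CT).
  exact: borel_caratheodory.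
have mI (I : interval R) : measurable ([set` I] : set CT).
  by apply: mA; exact: measurable_itv.
apply: (le_integrable (mI _) _ _ (G_local ab)).
  exact: (measurable_funS (mI _) ab mF).
move=> t /ab /=; rewrite in_itv/= andbT => t0.
by apply: (le_trans (FG t0)); rewrite lee_abs.
Qed.

End domination.

End completed_transfer.

(** * Moments of Kantorovich potentials *)

Lemma powRD_le2 (R : realType) (a b p : R) : 0 <= a -> 0 <= b -> 0 <= p ->
  (a + b) `^ p <= 2 `^ p * (a `^ p + b `^ p).
Proof.
move=> a0 b0 p0; wlog ab : a b a0 b0 / a <= b.
  by move=> h; have [|/ltW ba] := leP a b; [exact: h|rewrite addrC [in leRHS]addrC; exact: h].
apply: (@le_trans _ _ ((2 * b) `^ p)).
  by rewrite ge0_ler_powR ?nnegrE ?addr_ge0 ?mulr_ge0// mulr_natl mulr2n lerD2r.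
by rewrite powRM// ler_wpM2l ?powR_ge0// lerDr powR_ge0.
Qed.

Lemma le_1D_powR (R : realType) (a p : R) : 0 <= a -> 1 <= p -> a <= 1 + a `^ p.
Proof.
move=> a0 p1; have [a1|a1] := leP a 1.
  by rewrite (le_trans a1)// lerDl powR_ge0.
rewrite -[leLHS](powRr1 a0) -[leLHS]add0r lerD//.
by rewrite ler_powR// ltW.
Qed.

Section coupled_moment.
Context (R : realType) (dT dZ : measure_display) (T : measurableType dT) (Z : measurableType dZ).
Local Open Scope ereal_scope.

Lemma pushforward_integral (pi : {measure set Z -> \bar R}) (nu : {measure set T -> \bar R})
    (pr : Z -> T) (f : T -> \bar R) : measurable_fun setT pr ->
  (forall A, measurable A -> pi (pr @^-1` A) = nu A) ->
  measurable_fun setT f -> (forall x, 0 <= f x) ->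
  \int[pi]_z f (pr z) = \int[nu]_x f x.
Proof.
move=> mpr piE mf f0.
have := ge0_integral_pushforward mpr pi measurableT mf (fun x _ => f0 x).
rewrite preimage_setT => <-.
by apply: eq_measure_integral => A mA _; exact: piE.
Qed.

Lemma pushforward_integrable (pi : {measure set Z -> \bar R}) (nu : {measure set T -> \bar R})
    (pr : Z -> T) (f : T -> \bar R) : measurable_fun setT pr ->
  (forall A, measurable A -> pi (pr @^-1` A) = nu A) -> nu.-integrable setT f ->
  pi.-integrable setT (f \o pr) /\ \int[pi]_z f (pr z) = \int[nu]_x f x.
Proof.
move=> mpr piE /integrableP[mf fi]; split.
  apply/integrableP; split; first exact: measurableT_comp.
  rewrite (pushforward_integral (f := fun x => `|f x|) mpr piE)//.
  exact: measurableT_comp.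
rewrite integralE [RHS]integralE.
rewrite -(pushforward_integral mpr piE (measurable_funepos mf) (fun x => funepos_ge0 f x)).
rewrite -(pushforward_integral mpr piE (measurable_funeneg mf) (fun x => funeneg_ge0 f x)).
by congr (_ - _); apply: eq_integral => z _; rewrite ?funeposE ?funenegE.
Qed.

(** Since s <= N, s is also at most min(g, N) + h, and min(g, N)^p <= N^(p-1) g: the bound is linear
    in g, of which only the mean will be known. *)
Lemma truncated_power_le (s g : \bar R) (h p N : R) : (1 <= p)%R -> (0 < N)%R -> 0 <= s ->
  0 <= g -> (0 <= h)%R -> s <= N%:E -> s <= g + h%:E ->
  s `^ p <= (2 `^ p)%:E * ((N `^ (p - 1))%:E * g + (h `^ p)%:E).
Proof.
move=> p1 N0; have p0 : (0 <= p)%R by exact: le_trans p1.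
have N10 : (0 < N `^ (p - 1))%R by exact: powR_gt0.
case: s => [s| |//] s0; last by rewrite leye_eq.
case: g => [g| |//] g0 h0 sN sg; last first.
  rewrite gt0_muley ?lte_fin// addye// gt0_muley ?lte_fin ?powR_gt0// leey.
  by [].
suff e : (s `^ p <= 2 `^ p * (N `^ (p - 1) * g + h `^ p))%R by rewrite poweR_EFin; exact: e.
rewrite lee_fin in s0; rewrite lee_fin in g0; rewrite lee_fin in sN; rewrite -EFinD lee_fin in sg.
pose m := Num.min g N.
have m0 : (0 <= m)%R by rewrite le_min g0 ltW.
have sm : (s <= m + h)%R.
  rewrite /m; have [gN//|Ng] := leP g N.
  by rewrite (le_trans sN)// lerDl.
apply: (@le_trans _ _ ((m + h) `^ p)%R).
  by rewrite ge0_ler_powR ?nnegrE// addr_ge0.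
apply: (le_trans (powRD_le2 m0 h0 p0)); rewrite ler_wpM2l ?powR_ge0// lerD2r.
have -> : (m `^ p = m `^ (p - 1) * m)%R.
  rewrite -[X in _ = (_ * X)%R](powRr1 m0) -powRD ?subrK//.
  by rewrite gt_eqF// (lt_le_trans ltr01).
rewrite ler_pM ?powR_ge0//; last by rewrite ge_min lexx.
by rewrite ge0_ler_powR ?nnegrE ?subr_ge0 ?(ltW N0)// ge_min lexx orbT.
Qed.

Variables (nu : probability T R) (s : T -> \bar R) (p M : R).
Hypotheses (p1 : (1 <= p)%R) (ms : measurable_fun setT s).
Hypothesis sfin : {ae nu, forall x, s x \is a fin_num}.
Hypothesis approx : forall delta : R, (0 < delta)%R ->
  exists (pi : {measure set Z -> \bar R}) (pr : Z -> T) (g : Z -> \bar R) (h : Z -> R),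
  [/\ measurable_fun setT pr, forall A, measurable A -> pi (pr @^-1` A) = nu A,
    [/\ measurable_fun setT g, (forall z, 0 <= g z) & \int[pi]_z g z <= delta%:E],
    [/\ measurable_fun setT h, (forall z, 0 <= h z)%R & \int[pi]_z (h z `^ p)%:E <= M%:E] &
    forall z, `|s (pr z)| <= g z + (h z)%:E].

Let p0 : (0 <= p)%R. Proof. exact: le_trans p1. Qed.

Let spow := (fun x => `|s x| `^ p).

Let mspow : measurable_fun setT spow.
Proof. by apply: (measurableT_comp (measurable_poweR _)); exact: measurableT_comp. Qed.

Let trunc (n : nat) : set T := [set x | `|s x| <= n.+1%:R%:E].

Let mtrunc n : measurable (trunc n).
Proof.
rewrite -[trunc n]setTI; apply: emeasurable_fun_le => //.
exact: measurableT_comp.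
Qed.

Let trunc_le n : \int[nu]_(x in trunc n) spow x <= (2 `^ p * M)%:E.
Proof.
pose N : R := n.+1%:R.
have N0 : (0 < N)%R by rewrite ltr0n.
have NP : (0 < N `^ (p - 1))%R by exact: powR_gt0.
apply/lee_addgt0Pr => e e0.
(* delta is chosen after N, so that 2^p N^(p-1) delta = e. *)
have d0 : (0 < e / (2 `^ p * N `^ (p - 1)))%R by rewrite divr_gt0// mulr_gt0// powR_gt0.
have [pi [pr [g [h [mpr piE [mg g0 gd] [mh h0 hM] sgh]]]]] := approx d0.
rewrite integral_mkcond.
have mres : measurable_fun setT (spow \_ (trunc n)).
  by apply/(measurable_restrictT _ (mtrunc n)).1; exact: measurable_funTS.
have res0 x : 0 <= (spow \_ (trunc n)) x.
  by rewrite patchE; case: ifP => // _; exact: poweR_ge0.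
rewrite -(pushforward_integral mpr piE mres res0).
have hp0 z : 0 <= (h z `^ p)%:E by rewrite lee_fin powR_ge0.
have mhp : measurable_fun setT (fun z => (h z `^ p)%:E).
  by apply/measurable_EFinP; apply: (measurableT_comp (measurable_powR _)).
have Ng0 z : 0 <= (N `^ (p - 1))%:E * g z by rewrite mule_ge0// lee_fin ltW.
have mNg : measurable_fun setT (fun z => (N `^ (p - 1))%:E * g z) by exact: emeasurable_funM.
apply: (@le_trans _ _ (\int[pi]_z ((2 `^ p)%:E * ((N `^ (p - 1))%:E * g z + (h z `^ p)%:E)))).
  apply: ge0_le_integral => //.
  - exact: measurableT_comp.
  - by apply: emeasurable_funM => //; exact: emeasurable_funD.
  - move=> z _; rewrite patchE; case: ifP => [|_]; last first.
      by rewrite mule_ge0 ?adde_ge0// lee_fin powR_ge0.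
    by rewrite inE => zt; exact: truncated_power_le.
rewrite ge0_integralZl_EFin ?powR_ge0//; last 2 first.
- by move=> z _; rewrite adde_ge0.
- exact: emeasurable_funD.
rewrite (ge0_integralD pi measurableT (fun z _ => Ng0 z) mNg (fun z _ => hp0 z) mhp).
rewrite (ge0_integralZl_EFin pi measurableT (fun z _ => g0 z) mg (ltW NP)).
apply: (@le_trans _ _ ((2 `^ p)%:E * ((N `^ (p - 1))%:E * (e / (2 `^ p * N `^ (p - 1)))%:E + M%:E))).
  apply: lee_wpmul2l; first by rewrite lee_fin powR_ge0.
  by apply: leeD => //; apply: lee_wpmul2l => //; rewrite lee_fin ltW.
suff e1 : (2 `^ p * (N `^ (p - 1) * (e / (2 `^ p * N `^ (p - 1))) + M) = 2 `^ p * M + e)%R.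
  by rewrite le_eqVlt; apply/orP; left; apply/eqP; exact: (congr1 EFin e1).
have P2 : (2 `^ p != 0 :> R)%R by rewrite gt_eqF// powR_gt0.
have P3 : (N `^ (p - 1) != 0 :> R)%R by rewrite gt_eqF.
by move: (2 `^ p)%R (N `^ (p - 1))%R P2 P3 => a b a0 b0; field; rewrite a0 b0.
Qed.

(* g is small in the mean only, so s is truncated at N: the cost N^(p-1) of the
   truncation is beaten by letting delta tend to 0 before N tends to infinity. *)
Lemma coupled_moment_le : \int[nu]_x spow x <= (2 `^ p * M)%:E.
Proof.
have sp0 x : 0 <= spow x by exact: poweR_ge0.
have cvgU : (\int[nu]_(x in trunc n) spow x) @[n --> \oo] --> \int[nu]_(x in \bigcup_n trunc n) spow x.
  apply: ge0_nondecreasing_set_cvg_integral => //.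
  - move=> m n mn; apply/subsetPset => x; rewrite /trunc /= => h; apply: (le_trans h).
    by rewrite lee_fin ler_nat ltnS.
  - by move=> n; exact: measurable_funTS.
have <- : \int[nu]_(x in \bigcup_n trunc n) spow x = \int[nu]_x spow x.
  rewrite [in RHS](_ : setT = (\bigcup_n trunc n) `|` ~` (\bigcup_n trunc n)); last by rewrite setUv.
  have mU : measurable (\bigcup_n trunc n) by exact: bigcup_measurable.
  rewrite ge0_integral_setU//; last 3 first.
  - exact: measurableC.
  - by rewrite setUv; exact: mspow.
  - by apply/disj_setPLR; rewrite setCK.
  rewrite [X in _ = _ + X](_ : _ = 0) ?adde0//.
  apply: null_set_integral => //.
  - exact: measurableC.
  - exact: measurable_funTS.
  - move: sfin => [N [mN N0 hN]]; apply: (@subset_measure0 _ _ _ nu _ N) => //.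
      exact: measurableC.
    move=> x hx; apply: hN => /= sx; apply: hx.
    exists (Num.truncn (fine `|s x|)) => //; rewrite /trunc /=.
    rewrite -[leLHS]fineK ?fin_num_abs -?fin_num_abs ?abse_fin_num//.
    by rewrite lee_fin ltW// truncnS_gt.
rewrite -(cvg_lim _ cvgU)//; apply: lime_le; first by apply/cvg_ex; eexists; exact: cvgU.
by near=> n; exact: trunc_le.
Unshelve. all: by end_near. Qed.

End coupled_moment.

(** * Weak duality and moments of dual potentials for a general cost *)

Section transport_duality.
Context (R : realType) (dT : measure_display) (T : measurableType dT).
Variable c : T -> T -> R.
Hypotheses (mc : measurable_fun setT (fun z : T * T => c z.1 z.2)) (c0 : forall x y, 0 <= c x y).
Local Open Scope ereal_scope.
Implicit Types (P Q : probability T R) (f g : T -> \bar R) (pi : probability (T * T)%type R).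

Definition coupled P Q pi :=
  (forall A, measurable A -> pi (fst @^-1` A) = P A) /\
  (forall A, measurable A -> pi (snd @^-1` A) = Q A).

Definition nearly_attained P Q (w : R) := forall delta : R, (0 < delta)%R ->
  exists2 pi, coupled P Q pi & \int[pi]_z (c z.1 z.2)%:E <= (w + delta)%:E.

Definition gap f g (z : T * T) := (c z.1 z.2)%:E + (f z.1 + g z.2).

(** Sign convention opposite to the usual one: the constraint is c + f + g >= 0 and the dual value
    is minus the sum of the integrals. Excluding -oo keeps sums with +oo meaningful. *)
Definition feasible f g :=
  [/\ forall x, f x != -oo, forall y, g y != -oo & forall z, 0 <= gap f g z].

Let mce : measurable_fun setT (fun z : T * T => (c z.1 z.2)%:E).
Proof. exact/measurable_EFinP. Qed.

(** For potentials whose dual value is w and a coupling of cost at most w + delta, the mean of the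
    gap is at most delta. *)
Lemma integral_gap P Q pi f g : coupled P Q pi -> \int[pi]_z (c z.1 z.2)%:E < +oo ->
  P.-integrable setT f -> Q.-integrable setT g ->
  measurable_fun setT (gap f g) /\
  \int[pi]_z gap f g z = \int[pi]_z (c z.1 z.2)%:E + (\int[P]_x f x + \int[Q]_y g y).
Proof.
move=> [piP piQ] coo fi gi.
have [fi1 fE] := pushforward_integrable measurable_fst piP fi.
have [gi1 gE] := pushforward_integrable measurable_snd piQ gi.
have ci : pi.-integrable setT (fun z => (c z.1 z.2)%:E).
  apply/integrableP; split => //.
  by under eq_integral do rewrite gee0_abs ?lee_fin//.
have fgi := integrableD measurableT fi1 gi1.
split.
  by have /integrableP[] := integrableD measurableT ci fgi.
rewrite -fE -gE -(integralD measurableT fi1 gi1).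
exact: (integralD measurableT ci fgi).
Qed.

Lemma weak_duality P Q (w : R) f g : nearly_attained P Q w ->
  P.-integrable setT f -> Q.-integrable setT g -> feasible f g ->
  (- (fine (\int[P]_x f x) + fine (\int[Q]_y g y)) <= w)%R.
Proof.
move=> near_w fi gi [_ _ g0]; apply/ler_addgt0Pr => e e0.
have [pi cpi cw] := near_w _ e0.
have [_ gE] := integral_gap cpi (le_lt_trans cw (ltry _)) fi gi.
have : 0 <= \int[pi]_z gap f g z by exact: integral_ge0.
rewrite gE -(fineK (integrable_fin_num measurableT fi)) -(fineK (integrable_fin_num measurableT gi)).
move=> h; have := le_trans h (leeD2r _ cw).
by rewrite -!EFinD lee_fin /=; lra.
Qed.

Section potentials.
Variables (P Q : probability T R) (psi phi : T -> \bar R) (u : T -> R) (p K : R).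
Hypotheses (mu_ : measurable_fun setT u) (u0 : forall x, (0 <= u x)%R).
Hypothesis cu : forall x y, (c x y <= u x + u y)%R.
Hypotheses (p1 : (1 <= p)%R) (K0 : (0 <= K)%R).
Hypotheses (uP : \int[P]_x (u x `^ p)%:E <= K%:E) (uQ : \int[Q]_x (u x `^ p)%:E <= K%:E).
Hypotheses (psi_int : P.-integrable setT psi) (phi_int : Q.-integrable setT phi).
Hypothesis fpp : feasible psi phi.

Local Notation a := (fine (\int[P]_x psi x)).
Local Notation b := (fine (\int[Q]_y phi y)).

Hypothesis near_w : nearly_attained P Q (- a - b).

Let p0 : (0 <= p)%R. Proof. exact: le_trans p1. Qed.

Let mup : measurable_fun setT (fun x => (u x `^ p)%:E).
Proof. by apply/measurable_EFinP; apply: (measurableT_comp (measurable_powR _)). Qed.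

Let up0 x : 0 <= (u x `^ p)%:E. Proof. by rewrite lee_fin powR_ge0. Qed.

Let u_int (m : probability T R) : \int[m]_x (u x `^ p)%:E <= K%:E ->
  m.-integrable setT (EFin \o u) /\ (fine (\int[m]_x (u x)%:E) <= 1 + K)%R.
Proof.
move=> um.
have le : \int[m]_x (u x)%:E <= (1 + K)%:E.
  apply: (@le_trans _ _ (\int[m]_x (cst 1 x + (u x `^ p)%:E))).
    apply: ge0_le_integral => //.
    - by move=> x _; rewrite lee_fin.
    - exact/measurable_EFinP.
    - exact: emeasurable_funD.
    - by move=> x _; rewrite -EFinD lee_fin; exact: le_1D_powR.
  rewrite (ge0_integralD m measurableT (fun x _ => lee01) (measurable_cst _) (fun x _ => up0 x) mup).
  rewrite EFinD; apply: leeD => //.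
  by rewrite integral_cst// mul1e; exact: probability_le1.
have ge : 0 <= \int[m]_x (u x)%:E by apply: integral_ge0 => x _; rewrite lee_fin.
split.
  apply/integrableP; split; first exact/measurable_EFinP.
  under eq_integral do rewrite gee0_abs ?lee_fin//.
  exact: (le_lt_trans le (ltry _)).
rewrite -lee_fin fineK// ge0_fin_numE//; exact: (le_lt_trans le (ltry _)).
Qed.

(** The constraint is integrated in y against the other marginal; 1 + K bounds the mean of u. *)
Let lower_bound (m : probability T R) (h : T -> \bar R) (s : \bar R) (v : R) :
  \int[m]_x (u x `^ p)%:E <= K%:E ->
  m.-integrable setT h -> s != -oo -> (forall y, h y != -oo) ->
  (forall y, 0 <= (v + u y)%:E + (s + h y)) ->
  (- v - (1 + K) - fine (\int[m]_y h y))%:E <= s.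
Proof.
move=> um hi; case: s => [s| |//] _ hN sh; last by rewrite leey.
have [ui uK] := u_int um.
have ci : m.-integrable setT (cst (- v - s)%:E).
  exact: finite_measure_integrable_cst.
have := le_integral measurableT ci (integrableD measurableT ui hi).
have -> : \int[m]_x (cst (- v - s)%:E x) = (- v - s)%:E.
  apply: (etrans (integral_cst _ measurableT _)); rewrite -[RHS]mule1.
  by congr (_ * _); exact: probability_setT.
rewrite (integralD measurableT ui hi).
rewrite -(fineK (integrable_fin_num measurableT ui)) -(fineK (integrable_fin_num measurableT hi)).
rewrite -EFinD !lee_fin => H; have {}H : (- v - s <= fine (\int[m]_x (EFin \o u) x)%E
    + fine (\int[m]_x h x)%E)%R.
  apply: H => y _ /=; have := sh y; case: (h y) (hN y) => [r| |//] _ /=; last by move=> _; rewrite addey ?leey.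
  by rewrite -!EFinD !lee_fin; lra.
by move: H uK => /=; lra.
Qed.

Let psi_lower x : (- u x - (1 + K) - b)%:E <= psi x.
Proof.
have [h1 h2 h3] := fpp.
apply: lower_bound => // y.
by apply: le_trans (h3 (x, y)) _; rewrite /gap /= leeD2r// lee_fin.
Qed.

Let phi_lower y : (- u y - (1 + K) - a)%:E <= phi y.
Proof.
have [h1 h2 h3] := fpp.
apply: lower_bound => // x.
apply: le_trans (h3 (x, y)) _; rewrite /gap /= [phi y + _]addeC leeD2r// lee_fin.
by rewrite [leRHS]addrC.
Qed.

Let w_ge0 : (0 <= - a - b)%R.
Proof.
apply/ler_addgt0Pr => e e0; have [pi _ h] := near_w e0.
rewrite -lee_fin; apply: le_trans h; apply: integral_ge0 => z _.
by rewrite lee_fin.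
Qed.

(** Lower side: the lower bound on x, and a' + b' <= 0. Upper side: x is the gap minus cxy minus y,
    where cxy >= 0 and y has its own lower bound. *)
Let dist_le (x y : \bar R) (a' b' cxy ux uy : R) : x != -oo -> y != -oo ->
  (0 <= - a' - b')%R -> (0 <= cxy)%R -> (0 <= ux)%R -> (0 <= uy)%R ->
  0 <= cxy%:E + (x + y) -> (- ux - (1 + K) - b')%:E <= x -> (- uy - (1 + K) - a')%:E <= y ->
  `|x - a'%:E| <= cxy%:E + (x + y) + (ux + uy + (1 + K))%:E.
Proof.
case: x => [x| |//] _; case: y => [y| |//] _ w0 cxy0 ux0 uy0 //=;
  try by move=> _ _ _; exact: leey.
rewrite -!EFinD !lee_fin => h1 h2 h3.
by rewrite ler_norml; apply/andP; split; lra.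
Qed.

Let hbound (z : T * T) : R := (u z.1 + u z.2 + (1 + K))%R.

(** One factor 2^p comes from [coupled_moment_le], the other two from splitting the p-th power of
    the three terms of [hbound]. *)
Definition moment_constant (p' K' : R) : R :=
  (2 `^ p' * (2 `^ p' * (2 `^ p' * (K' + K') + (1 + K') `^ p')))%R.

Let Kpow : R := (2 `^ p * (2 `^ p * (K + K) + (1 + K) `^ p))%R.

Let hbound_ge0 z : (0 <= hbound z)%R.
Proof. by rewrite /hbound !addr_ge0. Qed.

Let mhbound : measurable_fun setT hbound.
Proof.
apply: measurable_funD => //; apply: measurable_funD.
  exact: (measurableT_comp mu_ measurable_fst).
exact: (measurableT_comp mu_ measurable_snd).
Qed.

Let hbound_moment pi : coupled P Q pi -> \int[pi]_z (hbound z `^ p)%:E <= Kpow%:E.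
Proof.
move=> [piP piQ].
have i1 := pushforward_integral measurable_fst piP mup up0.
have i2 := pushforward_integral measurable_snd piQ mup up0.
have m1 : measurable_fun setT (fun z : T * T => (u z.1 `^ p)%:E).
  exact: (measurableT_comp mup measurable_fst).
have m2 : measurable_fun setT (fun z : T * T => (u z.2 `^ p)%:E).
  exact: (measurableT_comp mup measurable_snd).
have P2 : (0 <= 2 `^ p :> R)%R by exact: powR_ge0.
pose C1 : \bar R := ((1 + K) `^ p)%:E.
have C10 : 0 <= C1 by rewrite lee_fin powR_ge0.
have m12 : measurable_fun setT (fun z : T * T => (u z.1 `^ p)%:E + (u z.2 `^ p)%:E).
  exact: emeasurable_funD.
have m12' : measurable_fun setT (fun z : T * T => (2 `^ p)%:E * ((u z.1 `^ p)%:E + (u z.2 `^ p)%:E)).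
  exact: emeasurable_funM.
have z12 z : 0 <= (u z.1 `^ p)%:E + (u z.2 `^ p)%:E by rewrite adde_ge0.
have z12' z : 0 <= (2 `^ p)%:E * ((u z.1 `^ p)%:E + (u z.2 `^ p)%:E) by rewrite mule_ge0.
apply: (@le_trans _ _ (\int[pi]_z ((2 `^ p)%:E *
   ((2 `^ p)%:E * ((u z.1 `^ p)%:E + (u z.2 `^ p)%:E) + cst C1 z)))).
  apply: ge0_le_integral => //.
  - by move=> z _; rewrite lee_fin powR_ge0.
  - by apply/measurable_EFinP; apply: (measurableT_comp (measurable_powR _)).
  - by apply: emeasurable_funM => //; exact: emeasurable_funD.
  - move=> z _.
    suff e : (hbound z `^ p <= 2 `^ p * (2 `^ p * (u z.1 `^ p + u z.2 `^ p) + (1 + K) `^ p))%R.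
      exact: e.
    apply: (le_trans (powRD_le2 _ _ p0)); rewrite ?addr_ge0//.
    by rewrite ler_wpM2l// lerD2r; exact: powRD_le2.
rewrite ge0_integralZl_EFin//; last 2 first.
- by move=> z _; rewrite adde_ge0.
- exact: emeasurable_funD.
rewrite /Kpow EFinM; apply: lee_wpmul2l => //.
rewrite (ge0_integralD pi measurableT (fun z _ => z12' z) m12' (fun z _ => C10) (measurable_cst _)).
rewrite EFinD; apply: leeD; last first.
  rewrite (integral_cst pi measurableT C1) -[leRHS]mule1.
  by apply: lee_wpmul2l => //; exact: probability_le1.
rewrite (ge0_integralZl_EFin pi measurableT (fun z _ => z12 z) m12 P2).
rewrite EFinM; apply: lee_wpmul2l => //.
rewrite (ge0_integralD pi measurableT (fun z _ => up0 z.1) m1 (fun z _ => up0 z.2) m2).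
by rewrite EFinD; apply: leeD; rewrite ?i1 ?i2.
Qed.

Let moment (nu : probability T R) (s : T -> \bar R) (pr : T * T -> T) :
  measurable_fun setT pr ->
  (forall pi, coupled P Q pi -> forall A, measurable A -> pi (pr @^-1` A) = nu A) ->
  nu.-integrable setT s ->
  (forall z, `|s (pr z) - (fine (\int[nu]_x s x))%:E| <= gap psi phi z + (hbound z)%:E) ->
  \int[nu]_x (`|s x - (fine (\int[nu]_x s x))%:E| `^ p) <= (moment_constant p K)%:E.
Proof.
move=> mpr prE si sh; have /integrableP[ms _] := si.
apply: (@coupled_moment_le _ _ _ T (T * T)%type nu
  (fun x => s x - (fine (\int[nu]_x s x))%:E) p Kpow p1).
- exact: emeasurable_funB.
- have h := integrable_ae measurableT si.
  apply: filterS h => x /(_ Logic.I) sx; by rewrite fin_numB sx.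
- move=> delta d0; have [pi cpi piw] := near_w d0.
  have [mg gE] := integral_gap cpi (le_lt_trans piw (ltry _)) psi_int phi_int.
  have [_ _ g0] := fpp.
  exists pi, pr, (gap psi phi), hbound; split => //.
  - by move=> A mA; exact: prE.
  - split => //; rewrite gE.
    rewrite -(fineK (integrable_fin_num measurableT psi_int)).
    rewrite -(fineK (integrable_fin_num measurableT phi_int)).
    apply: (le_trans (leeD2r _ piw)).
    by rewrite -!EFinD lee_fin; lra.
  - by split => //; exact: hbound_moment.
Qed.

Lemma potential_moment_l :
  \int[P]_x (`|psi x - a%:E| `^ p) <= (moment_constant p K)%:E.
Proof.
have [h1 h2 h3] := fpp.
apply: (@moment P psi fst) => //; first by move=> pi [].
move=> [x y]; apply: (@dist_le _ _ _ b) => //.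
exact: (h3 (x, y)).
Qed.

Lemma potential_moment_r :
  \int[Q]_y (`|phi y - b%:E| `^ p) <= (moment_constant p K)%:E.
Proof.
have [h1 h2 h3] := fpp.
apply: (@moment Q phi snd) => //; first by move=> pi [].
move=> [x y]; rewrite /gap /= [psi x + _]addeC /hbound /= [(u x + _)%R]addrC.
apply: (@dist_le _ _ _ a) => //; first by move: w_ge0; lra.
by rewrite [phi y + _]addeC; exact: (h3 (x, y)).
Qed.

End potentials.
End transport_duality.

(** * The Euclidean cost and its Kantorovich potentials *)

Section euclidean_cost.
Context (R : realType) (d : nat).
Local Notation E := (d.-tuple R).
Variable rho : R.
Hypothesis rho1 : 1 <= rho.

Let rho0 : 0 < rho. Proof. exact: lt_le_trans ltr01 rho1. Qed.

(** From |x - y|^2 <= 2 |x|^2 + 2 |y|^2 <= 4 max(|x|, |y|)^2, coordinate by coordinate. *)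
Lemma enorm_tsub_le (x y : E) : enorm (tsub x y) <= 2 * Num.max (enorm x) (enorm y).
Proof.
wlog xy : x y / enorm x <= enorm y.
  move=> h; have [xy|/ltW yx] := leP (enorm x) (enorm y).
    by have := h x y xy; rewrite (max_r xy).
  have := h y x yx; rewrite (max_r yx) (_ : enorm (tsub y x) = enorm (tsub x y))//.
  rewrite /enorm; congr Num.sqrt; apply: eq_bigr => i _.
  by rewrite !tnth_mktuple -sqrrN opprB.
rewrite (max_r xy) -(ler_pXn2r (ltn0Sn 1)) ?nnegrE ?mulr_ge0 ?sqrtr_ge0//.
have s0 (z : E) : 0 <= \sum_(i < d) tnth z i ^+ 2.
  by apply: sumr_ge0 => i _; exact: sqr_ge0.
rewrite exprMn !sqr_sqrtr//.
have xy2 : \sum_(i < d) tnth x i ^+ 2 <= \sum_(i < d) tnth y i ^+ 2.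
  by rewrite -(ler_sqrt _ (s0 y)).
apply: (@le_trans _ _ (\sum_(i < d) (2 * tnth x i ^+ 2 + 2 * tnth y i ^+ 2))).
  apply: ler_sum => i _; rewrite tnth_mktuple.
  by have := sqr_ge0 (tnth x i + tnth y i); rewrite !expr2; lra.
by rewrite big_split/= -!mulr_sumr; lra.
Qed.

Definition cost_bound (x : E) : R := 2 `^ rho * enorm x `^ rho.

Lemma cost_bound_ge0 x : 0 <= cost_bound x.
Proof. by rewrite mulr_ge0 ?powR_ge0. Qed.

Lemma cost_ge0 (x y : E) : 0 <= cost rho x y :> R.
Proof. exact: powR_ge0. Qed.

Lemma cost_le (x y : E) : cost rho x y <= cost_bound x + cost_bound y.
Proof.
apply: (@le_trans _ _ ((2 * Num.max (enorm x) (enorm y)) `^ rho)).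
  rewrite ge0_ler_powR ?nnegrE ?sqrtr_ge0 ?(ltW rho0)//; last exact: enorm_tsub_le.
  by rewrite mulr_ge0// le_max sqrtr_ge0.
rewrite powRM// ?le_max ?sqrtr_ge0// /cost_bound -mulrDr ler_wpM2l ?powR_ge0//.
have [_|_] := leP (enorm x) (enorm y); first by rewrite lerDr powR_ge0.
by rewrite lerDl powR_ge0.
Qed.

Lemma measurable_enorm : measurable_fun setT (@enorm R d).
Proof.
apply: (measurableT_comp (f := @Num.sqrt R)).
  by apply: continuous_measurable_fun; exact: sqrt_continuous.
apply: measurable_sum => i; apply: (measurableT_comp (exprn_measurable 2)).
exact: measurable_tnth.
Qed.

Lemma measurable_cost : measurable_fun setT (fun z : E * E => cost rho z.1 z.2).
Proof.
apply: (measurableT_comp (measurable_powR _)).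
apply: (measurableT_comp (f := @Num.sqrt R)).
  by apply: continuous_measurable_fun; exact: sqrt_continuous.
apply: measurable_sum => i; apply: (measurableT_comp (exprn_measurable 2)).
rewrite (_ : (fun z : E * E => _) = (fun z => tnth z.1 i - tnth z.2 i)); last first.
  by apply/funext => z; rewrite tnth_mktuple.
by apply: measurable_funB; apply: (measurableT_comp (measurable_tnth i)).
Qed.

Lemma measurable_cost_bound : measurable_fun setT cost_bound.
Proof.
apply: measurable_funM => //; apply: (measurableT_comp (measurable_powR _)).
exact: measurable_enorm.
Qed.

Lemma cost_bound_powR (p : R) x : cost_bound x `^ p = 2 `^ (rho * p) * enorm x `^ (rho * p).
Proof. by rewrite powRM ?powR_ge0// -!powRrM. Qed.

Local Open Scope ereal_scope.

Section potentials.
Variables (P Q : probability E R) (psi phi : E -> \bar R).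
Hypothesis pot : kantorovich_potentials rho P Q psi phi.

Local Notation w := (wasserstein rho P Q `^ rho).

Lemma potentials_cost : fine w = (- fine (\int[P]_x psi x) - fine (\int[Q]_y phi y))%R.
Proof.
rewrite (kp_dual pot).
have f1 := integrable_fin_num measurableT (kp_integrable_l pot).
have f2 := integrable_fin_num measurableT (kp_integrable_r pot).
by rewrite fineB ?fin_numN// fineN.
Qed.

Lemma potentials_feasible : feasible (cost rho) psi phi.
Proof.
have h1 := kp_ninfty_l pot; have h2 := kp_ninfty_r pot.
split => // -[x y]; rewrite /gap /=.
have : - ((cost rho x y)%:E + phi y) <= psi x.
  rewrite (kp_conj_l pot x) leeN2; apply: ereal_inf_lbound; by exists y.
case: (psi x) (h1 x) => [r| |//] _; case: (phi y) (h2 y) => [s| |//] _ //=;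
  try by move=> _; exact: leey.
by rewrite -!EFinD -?EFinN !lee_fin; lra.
Qed.

Lemma potentials_nearly_attained : nearly_attained (cost rho) P Q (fine w).
Proof.
have wfin : w \is a fin_num.
  rewrite (kp_dual pot).
  have f1 := integrable_fin_num measurableT (kp_integrable_l pot).
  have f2 := integrable_fin_num measurableT (kp_integrable_r pot).
  by rewrite fin_numB fin_numN f1 f2.
set S := [set \int[pi]_z (cost rho z.1 z.2)%:E | pi in [set pi | is_coupling P Q pi]].
(* The powers 1/rho and rho cancel, since the infimum of the costs is nonnegative. *)
have wE : w = ereal_inf S.
  move: wfin; rewrite /wasserstein -/S.
  have : 0 <= ereal_inf S.
    by apply: le_ereal_inf_tmp => _ [pi _ <-]; apply: integral_ge0 => z _; rewrite lee_fin cost_ge0.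
  case: (ereal_inf S) => [s| |//] s0 //.
    by rewrite !poweR_EFin -powRrM mulVf ?gt_eqF// powRr1.
  by rewrite !poweRyr ?invr_eq0 ?gt_eqF.
move=> delta d0; rewrite wE.
have Sfin : ereal_inf S \is a fin_num by rewrite -wE.
have [_ [pi [piP piQ] <-] h] := lb_ereal_inf_adherent d0 Sfin.
exists pi; last by rewrite EFinD fineK// ltW.
split=> A mA.
  by rewrite -piP//; congr (pi _); apply/seteqP; split => z /=; [|case].
by rewrite -piQ//; congr (pi _); apply/seteqP; split => z /=; [|case].
Qed.

End potentials.
End euclidean_cost.

(** * Truncation of dual potentials *)

Section clamp.
Context (R : realType).
Local Open Scope ereal_scope.

Definition clampe (m : R) (x : \bar R) : \bar R := maxe (- m)%:E (mine x m%:E).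

Lemma clampe_id (m : R) (x : R) : (`|x| <= m)%R -> clampe m x%:E = x%:E.
Proof.
rewrite ler_norml => /andP[h1 h2]; rewrite /clampe (min_l (_ : x%:E <= m%:E)) ?lee_fin//.
by rewrite max_r// lee_fin.
Qed.

Lemma clampe_abs (m : R) x : (0 <= m)%R -> `|clampe m x| <= m%:E.
Proof.
move=> m0; case: x => [x| |].
- rewrite /clampe -EFin_min -EFin_max abse_EFin lee_fin ler_norml le_max lexx /=.
  by rewrite ge_max ge_min lexx orbT andbT (le_trans _ m0)// oppr_le0.
- by rewrite /clampe min_r ?leey// max_r ?lee_fin ?ger0_norm// (le_trans _ m0)// oppr_le0.
- by rewrite /clampe min_l ?leNye// max_l ?leNye// abse_EFin normrN ger0_norm.
Qed.

Lemma clampe_abs_le (m : R) x : (0 <= m)%R -> `|clampe m x| <= `|x|.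
Proof.
move=> m0; case: x => [x| |] /=; try by rewrite leey.
have [xm|mx] := leP `|x|%R m; first by rewrite clampe_id.
by apply: (le_trans (clampe_abs _ m0)); rewrite lee_fin ltW.
Qed.

Lemma clampe_ge (m : R) x : x < m%:E -> x <= clampe m x.
Proof. by move=> xm; rewrite /clampe (min_l (ltW xm)) le_max lexx orbT. Qed.

Lemma clampe_top (m : R) x : (0 <= m)%R -> m%:E <= x -> clampe m x = m%:E.
Proof.
move=> m0 mx; rewrite /clampe (min_r mx) max_r// lee_fin.
by rewrite (le_trans _ m0)// oppr_le0.
Qed.

Lemma clampe_bot (m : R) x : (- m)%:E <= clampe m x.
Proof. by rewrite /clampe le_max lexx. Qed.

Context (dT : measure_display) (T : measurableType dT).

Lemma measurable_clampe (m : R) (f : T -> \bar R) : measurable_fun setT f ->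
  measurable_fun setT (fun x => clampe m (f x)).
Proof.
move=> mf; apply: measurable_maxe => //; exact: measurable_mine.
Qed.

(** If one of the two functions reaches the level m, the other is at least - m and the cost is
    nonnegative; otherwise truncation can only increase both. *)
Lemma clampe_feasible (c : T -> T -> R) (m : R) (f g : T -> \bar R) :
  (forall x y, 0 <= c x y)%R -> (0 <= m)%R -> feasible c f g ->
  feasible c (fun x => clampe m (f x)) (fun y => clampe m (g y)).
Proof.
move=> c0 m0 [hf hg h].
have N x : clampe m x != -oo.
  by rewrite gt_eqF// (lt_le_trans _ (clampe_bot m x))// ltNyr.
split => // -[x y]; rewrite /gap /=; have := h (x, y); rewrite /gap /= => {}h.
have cxy : 0 <= (c x y)%:E by rewrite lee_fin.
have [fm|mf] := ltP (f x) m%:E; last first.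
  rewrite (clampe_top m0 mf) adde_ge0//.
  apply: (@le_trans _ _ (m%:E + (- m)%:E)); first by rewrite -EFinD subrr.
  by apply: leeD => //; exact: clampe_bot.
have [gm|mg] := ltP (g y) m%:E; last first.
  rewrite (clampe_top m0 mg) adde_ge0//.
  apply: (@le_trans _ _ ((- m)%:E + m%:E)); first by rewrite -EFinD addNr.
  by apply: leeD => //; exact: clampe_bot.
apply: (le_trans h); apply: leeD => //; apply: leeD; exact: clampe_ge.
Qed.

Lemma clampe_integral_cvg (P : probability T R) (f : T -> \bar R) : P.-integrable setT f ->
  (fun n => fine (\int[P]_x clampe n%:R (f x))) @ \oo --> fine (\int[P]_x f x).
Proof.
move=> fi; apply: fine_cvg; rewrite fineK; last exact: integrable_fin_num.
have mf : measurable_fun setT f by have /integrableP[] := fi.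
have [] := @dominated_convergence _ _ _ P setT measurableT
  (fun n x => clampe n%:R (f x)) f (fun x => `|f x|).
- by move=> n; exact: measurable_clampe.
- exact: mf.
- have h := integrable_ae measurableT fi.
  apply: filterS h => x /(_ Logic.I) fx _.
  rewrite -(fineK fx); apply: cvg_near_cst; near=> n.
  apply: clampe_id; near: n; exact: nbhs_infty_ger.
- exact: integrable_abse.
- by apply: aeW => x n _; exact: clampe_abs_le.
by move=> _ _ h; exact: h.
Unshelve. all: by end_near. Qed.

End clamp.

(** * Evolution of the Wasserstein cost *)

Lemma powR_near0 (R : realType) (r e : R) : 0 < r -> 0 < e ->
  \forall t \near 0^'+, t `^ r < e.
Proof.
move=> r0 e0; near=> t.
have t0 : 0 < t by near: t; exact: nbhs_right_gt.
have te : t < e `^ r^-1 by near: t; apply: nbhs_right_lt; exact: powR_gt0.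
rewrite -[ltRHS](powRr1 (ltW e0)) -(mulVf (lt0r_neq0 r0)) powRrM.
by rewrite gt0_ltr_powR ?nnegrE ?powR_ge0// ltW.
Unshelve. all: by end_near. Qed.

Section wasserstein_evolution.
Context (R : realType) (rho : R) (d : nat).
Context (d1 : measure_display) (Omega : measurableType d1) (Pr : probability Omega R).
Context (d2 : measure_display) (Omega' : measurableType d2) (Pr' : probability Omega' R).
Local Notation E := (d.-tuple R).
Variables (lam lam' : E -> R) (k k' : R.-pker E ~> E).
Variables (X : R -> {RV Pr >-> E}) (X' : R -> {RV Pr' >-> E}).
Variables (eps : R) (psi psi' : R -> E -> \bar R).
Hypothesis rho1 : 1 <= rho.
Hypotheses (pX : pure_jump_process lam k X) (pX' : pure_jump_process lam' k' X').
Hypothesis lam_bound : has_ubound (range (fun x => Num.max (lam x) (lam' x))).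
Hypothesis eps0 : 0 < eps.
Hypothesis moments : locally_bounded_on `[0, +oo[
    (fun t => \int[Pr]_w (enorm (X t w) `^ (rho * (1 + eps)))%:E
            + \int[Pr']_w (enorm (X' t w) `^ (rho * (1 + eps)))%:E)%E.
Hypothesis pot : forall t, 0 <= t ->
  kantorovich_potentials rho (marginal X t) (marginal X' t) (psi t) (psi' t).

Local Notation P := (marginal X).
Local Notation P' := (marginal X').
Local Notation w := (fun t => fine (wasserstein rho (P t) (P' t) `^ rho)%E).
Local Notation absdrift := (fun t =>
  (\int[P t]_x `|generator lam k (psi t) x| + \int[P' t]_x `|generator lam' k' (psi' t) x|)%E).
Local Notation drift := (fun t => fine (\int[P t]_x generator lam k (psi t) x)%E
  + fine (\int[P' t]_x generator lam' k' (psi' t) x)%E).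
Local Notation p := (1 + eps).
Local Notation q := (1 + eps)^-1.
Local Notation u := (@cost_bound R d rho).

Let p1 : 1 < p. Proof. by rewrite ltrDl. Qed.

Let p0 : 0 < p. Proof. exact: lt_trans p1. Qed.

Let q01 : 0 < q < 1. Proof. by rewrite invr_gt0 p0 invf_lt1. Qed.

Let intensity_bound : exists L : R, [/\ 0 < L, forall x, lam x <= L & forall x, lam' x <= L].
Proof.
(* The maximum with 1 provides a positive rate for the Poisson clock, even if both intensities
   vanish. *)
have [b hb] := lam_bound; exists (Num.max 1 b); split.
- by rewrite lt_max ltr01.
- move=> x; rewrite le_max; apply/orP; right.
  by apply: le_trans (hb _ _); last (by exists x); rewrite le_max lexx.
- move=> x; rewrite le_max; apply/orP; right.
  by apply: le_trans (hb _ _); last (by exists x); rewrite le_max lexx orbT.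
Qed.

Let cost_moment (dO : measure_display) (O : measurableType dO) (Q : probability O R)
    (Y : {RV Q >-> E}) (M : R) :
  (\int[Q]_w (enorm (Y w) `^ (rho * p))%:E <= M%:E)%E ->
  (\int[distribution Q Y]_x (u x `^ p)%:E <= (2 `^ (rho * p) * M)%:E)%E.
Proof.
move=> h.
have mu_ : measurable_fun setT (fun x => (u x `^ p)%:E).
  apply/measurable_EFinP; apply: (measurableT_comp (measurable_powR _)).
  exact: measurable_cost_bound.
have m1 : measurable_fun setT (fun w => (enorm (Y w) `^ (rho * p))%:E).
  apply/measurable_EFinP; apply: (measurableT_comp (measurable_powR _)).
  by apply: (measurableT_comp (@measurable_enorm R d)).
have u0 x : (0 <= (u x `^ p)%:E)%E by rewrite lee_fin powR_ge0.
have mY : measurable_fun setT Y by [].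
rewrite -(@pushforward_integral _ _ _ _ _ Q (distribution Q Y) Y _ mY _ mu_ u0)//.
under eq_integral do rewrite cost_bound_powR EFinM.
have e0 w : setT w -> (0 <= (enorm (Y w) `^ (rho * p))%:E)%E by rewrite lee_fin powR_ge0.
rewrite (ge0_integralZl_EFin Q measurableT e0 m1 (powR_ge0 _ _)) EFinM.
by apply: lee_wpmul2l => //; rewrite lee_fin powR_ge0.
Qed.

Let cost_moments B : 0 < B -> exists K, 0 <= K /\ forall t, 0 <= t <= B ->
  (\int[P t]_x (u x `^ p)%:E <= K%:E)%E /\ (\int[P' t]_x (u x `^ p)%:E <= K%:E)%E.
Proof.
move=> B0; have [|M hM] := @moments 0 B.
  by move=> r /=; rewrite !in_itv/= => /andP[-> _].
exists (2 `^ (rho * p) * `|M|); split; first by rewrite mulr_ge0 ?powR_ge0.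
move=> t tB.
have i0 : (0 <= \int[Pr]_w (enorm (X t w) `^ (rho * p))%:E)%E.
  by apply: integral_ge0 => w _; rewrite lee_fin powR_ge0.
have i0' : (0 <= \int[Pr']_w (enorm (X' t w) `^ (rho * p))%:E)%E.
  by apply: integral_ge0 => w _; rewrite lee_fin powR_ge0.
have : (\int[Pr]_w (enorm (X t w) `^ (rho * p))%:E
            + \int[Pr']_w (enorm (X' t w) `^ (rho * p))%:E <= `|M|%:E)%E.
  apply: (le_trans (lee_abs _)); apply: (le_trans (hM t _)); first by rewrite in_itv/=.
  by rewrite lee_fin ler_norm.
move=> h; split; apply: cost_moment; apply: le_trans h; first by rewrite leeDl.
by rewrite leeDr.
Qed.

Let psi_moments B : 0 < B -> exists M, 0 <= M /\ forall t, 0 <= t <= B ->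
  (\int[P t]_x (`|psi t x - (fine (\int[P t]_x psi t x))%:E| `^ p) <= M%:E)%E /\
  (\int[P' t]_x (`|psi' t x - (fine (\int[P' t]_x psi' t x))%:E| `^ p) <= M%:E)%E.
Proof.
move=> B0; have [K [K0 hK]] := cost_moments B0.
exists (moment_constant p K); split.
  by rewrite /moment_constant !(mulr_ge0, addr_ge0, powR_ge0).
move=> t tB; have t0 : 0 <= t by case/andP: tB.
have [h1 h2] := hK t tB; have pt := pot t0.
have near_w := potentials_nearly_attained rho1 pt.
rewrite (potentials_cost pt) in near_w.
have fp := potentials_feasible pt.
have i1 := kp_integrable_l pt; have i2 := kp_integrable_r pt.
have mc := @measurable_cost R d rho.
have c0 := @cost_ge0 R d rho.
have cu := @cost_le R d rho rho1.
have mu_ := @measurable_cost_bound R d rho.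
have u0 := @cost_bound_ge0 R d rho.
split.
  exact: (potential_moment_l mc c0 mu_ u0 cu (ltW p1) K0 h1 h2 i1 i2 fp near_w).
exact: (potential_moment_r mc c0 mu_ u0 cu (ltW p1) K0 h1 h2 i1 i2 fp near_w).
Qed.

Let estimates B : 0 < B -> exists C, 0 <= C /\ forall A, 0 < A -> exists C2, 0 <= C2 /\
  forall t, 0 < t <= B ->
  [/\ {ae P t, forall x, generator_defined lam k (psi t) x} /\
      {ae P' t, forall x, generator_defined lam' k' (psi' t) x},
      (P t).-integrable setT (generator lam k (psi t)) /\
      (P' t).-integrable setT (generator lam' k' (psi' t)),
      (absdrift t <= (C * t `^ (- q))%:E)%E,
      w t <= w 0 + C * t `^ (1 - q) &
      A <= t -> forall s, 0 <= s <= B ->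
        w t - drift t * (s - t) - C2 * (s - t) ^+ 2 <= w s].
Proof.
move=> B0; have [L [L0 lamL lamL']] := intensity_bound.
have [M [M0 hM]] := psi_moments B0.
have [C [C0 hC]] := jump_process_drift_estimates pX L0 lamL q01 B0 M0.
have [C' [C0' hC']] := jump_process_drift_estimates pX' L0 lamL' q01 B0 M0.
exists (C + C'); split; first exact: addr_ge0.
move=> A A0; have [C2 [C20 hD]] := hC A A0; have [C2' [C20' hD']] := hC' A A0.
exists (C2 + C2'); split; first exact: addr_ge0.
move=> t tB; have /andP[t0 tleB] := tB.
have [|m1 m2] := hM t; first by rewrite (ltW t0).
have pt := pot (ltW t0).
have mpsi : measurable_fun setT (psi t) by have /integrableP[] := kp_integrable_l pt.
have mpsi' : measurable_fun setT (psi' t) by have /integrableP[] := kp_integrable_r pt.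
have [|a1 a2 a3 [a4 a5] a6] := hD t (fine (\int[P t]_x psi t x)%E) (psi t) tB mpsi.
  by rewrite invrK.
have [|b1 b2 b3 [b4 b5] b6] := hD' t (fine (\int[P' t]_x psi' t x)%E) (psi' t) tB mpsi'.
  by rewrite invrK.
have fp := potentials_feasible pt.
have dual s : 0 <= s -> - (fine (\int[P s]_x psi t x)%E + fine (\int[P' s]_x psi' t x)%E) <= w s.
  move=> s0; apply: (weak_duality (@measurable_cost R d rho) (@cost_ge0 R d rho)
    (potentials_nearly_attained rho1 (pot s0)) (a4 _ s0) (b4 _ s0) fp).
have wt := potentials_cost pt.
split => //.
- by rewrite mulrDl EFinD; exact: leeD.
- have := dual 0 (lexx 0).
  have tq : t `^ (- q) * t = t `^ (1 - q).
    rewrite -[X in _ * X](powRr1 (ltW t0)) -powRD ?(gt_eqF t0) ?implybT//.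
    by rewrite addrC.
  move: a5 b5; rewrite -!mulrA tq !ler_norml => /andP[_ a5] /andP[_ b5].
  by rewrite /= wt; lra.
- move=> At s sB; have s0 : 0 <= s by case/andP: sB.
  have := dual s s0; have := a6 At s sB; have := b6 At s sB.
  rewrite !ler_norml => /andP[_ h1] /andP[_ h2] h3.
  by rewrite /= wt; lra.
Qed.

(** The upper bound on w t is in [estimates]. For the lower bound the potentials of time 0 are
    tested at time t; the drift estimates would need their moments under the law at t, so they are
    clamped at a level n, which gives the moment bound n^p at every time. *)
Let w_cvg0 : w t @[t --> 0^'+] --> w 0.
Proof.
have [L [L0 lamL lamL']] := intensity_bound.
apply/cvgrPdist_le => e e0.
have q1 : 0 < 1 - q by rewrite subr_gt0; case/andP: q01.
have [C [C0 hC]] := estimates ltr01.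
(* The cut-off 1 is arbitrary: the bounds used here do not depend on it. *)
have [C2 [_ {}hC]] := hC 1 ltr01.
have pt := pot (lexx 0).
have i1 := kp_integrable_l pt; have i2 := kp_integrable_r pt.
(* Four errors in the lower bound: for each of the two processes, one from the truncation and one
   from the increment between 0 and t. *)
have e4 : 0 < e / 4 by rewrite divr_gt0.
have [n [n1 n2]] : exists n : nat,
    `|fine (\int[P 0]_x psi 0 x)%E - fine (\int[P 0]_x clampe n%:R (psi 0 x))%E| < e / 4 /\
    `|fine (\int[P' 0]_x psi' 0 x)%E - fine (\int[P' 0]_x clampe n%:R (psi' 0 x))%E| < e / 4.
  have /cvgrPdist_lt/(_ _ e4) h1 := clampe_integral_cvg i1.
  have /cvgrPdist_lt/(_ _ e4) h2 := clampe_integral_cvg i2.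
  near \oo => n; exists n; split; near: n => //.
have n0 : 0 <= n%:R :> R by [].
have np0 : 0 <= n%:R `^ p by exact: powR_ge0.
have [K [K0 /(_ 1 ltr01)[K2 [_ hK]]]] := jump_process_drift_estimates pX L0 lamL q01 ltr01 np0.
have [K' [K0' /(_ 1 ltr01)[K2' [_ hK']]]] := jump_process_drift_estimates pX' L0 lamL' q01 ltr01 np0.
have mpsi : measurable_fun setT (psi 0) by have /integrableP[] := i1.
have mpsi' : measurable_fun setT (psi' 0) by have /integrableP[] := i2.
have mom (Q : probability E R) (f : E -> \bar R) : measurable_fun setT f ->
    (\int[Q]_x (`|clampe n%:R (f x) - 0%:E| `^ q^-1) <= (n%:R `^ p)%:E)%E.
  move=> mf; apply: (@le_trans _ _ (\int[Q]_x (cst (n%:R `^ p)%:E x))%E).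
    apply: ge0_le_integral => //.
    - by move=> x _; exact: poweR_ge0.
    - apply: (measurableT_comp (measurable_poweR _)); apply: measurableT_comp => //.
      by apply: emeasurable_funB => //; exact: measurable_clampe.
    - move=> x _; rewrite invrK sube0 -poweR_EFin; apply: gt0_ler_poweR.
      + exact: ltW.
      + by rewrite in_itv/= leey abse_ge0.
      + by rewrite in_itv/= leey lee_fin n0.
      + exact: clampe_abs.
  rewrite (integral_cst Q measurableT) -[leRHS]mule1.
  by apply: lee_wpmul2l; [rewrite lee_fin|exact: probability_le1].
pose Ct := C + K + K' + 1.
have Ct0 : 0 < Ct by rewrite ltr_pwDr// !addr_ge0.
have small : 0 < e / 4 / Ct by rewrite divr_gt0.
near=> t.
have t0 : 0 < t by near: t; exact: nbhs_right_gt.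
have t1 : 0 < t <= 1 by rewrite t0 ltW//; near: t; exact: nbhs_right_lt.
have ts : t `^ (1 - q) < e / 4 / Ct by near: t; exact: powR_near0.
have tq : t `^ (- q) * t = t `^ (1 - q).
  rewrite -[X in _ * X](powRr1 (ltW t0)) -powRD ?(gt_eqF t0) ?implybT//.
  by rewrite addrC.
have ts0 : 0 <= t `^ (1 - q) by exact: powR_ge0.
have bnd x : 0 <= x -> x <= Ct -> x * t `^ (1 - q) <= e / 4.
  move=> x0 xC; apply: (@le_trans _ _ (Ct * t `^ (1 - q))); first by rewrite ler_wpM2r.
  by rewrite mulrC -ler_pdivlMr// ltW.
have bC := bnd C C0; have bK := bnd K K0; have bK' := bnd K' K0'.
have [_ _ _ up _] := hC t t1.
have [_ _ _ [j4 j5] _] := hK t 0 (fun x => clampe n%:R (psi 0 x)) t1 (measurable_clampe _ mpsi) (mom _ _ mpsi).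
have [_ _ _ [l4 l5] _] := hK' t 0 (fun x => clampe n%:R (psi' 0 x)) t1 (measurable_clampe _ mpsi') (mom _ _ mpsi').
have fp := clampe_feasible (@cost_ge0 R d rho) n0 (potentials_feasible pt).
have dual := weak_duality (@measurable_cost R d rho) (@cost_ge0 R d rho)
    (potentials_nearly_attained rho1 (pot (ltW t0))) (j4 _ (ltW t0)) (l4 _ (ltW t0)) fp.
have w0E := potentials_cost pt.
move: j5 l5 n1 n2; rewrite -!mulrA tq !ler_norml !ltr_norml.
move=> /andP[j5 _] /andP[l5 _] /andP[n1 _] /andP[n2 _].
have {}bC : C * t `^ (1 - q) <= e / 4 by apply: bC; rewrite /Ct; lra.
have {}bK : K * t `^ (1 - q) <= e / 4 by apply: bK; rewrite /Ct; lra.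
have {}bK' : K' * t `^ (1 - q) <= e / 4 by apply: bK'; rewrite /Ct; lra.
move: dual up; rewrite w0E /= => dual up.
by apply/andP; split; lra.
Unshelve. all: by end_near. Qed.

Let absdrift_ge0 t : (0 <= absdrift t)%E.
Proof. by rewrite adde_ge0//; exact: integral_ge0. Qed.

Lemma absdrift_bound B : 0 < B -> exists C : R, 0 <= C /\
  forall t : R, 0 < t <= B -> (`|absdrift t| <= (C * t `^ (- q))%:E)%E.
Proof.
move=> B0; have [C [C0 hC]] := estimates B0.
exists C; split => // t tB; have [C2 [_ {}hC]] := hC 1 ltr01.
by have [_ _ h _ _] := hC t tB; rewrite gee0_abs.
Qed.

Let drift_bound B : 0 < B -> exists C : R, 0 <= C /\
  forall t : R, 0 < t <= B -> `|drift t| <= C * t `^ (- q).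
Proof.
move=> B0; have [C [C0 hC]] := estimates B0.
exists C; split => // t tB; have [C2 [_ {}hC]] := hC 1 ltr01.
have [_ [i1 i2] h _ _] := hC t tB.
have abs_fine (Q : probability E R) (f : E -> \bar R) : Q.-integrable setT f ->
    (`|fine (\int[Q]_x f x)%E|%:E <= \int[Q]_x `|f x|)%E.
  move=> fi; rewrite -abse_EFin fineK; last exact: integrable_fin_num.
  by apply: le_abse_integral => //; have /integrableP[] := fi.
rewrite -lee_fin; apply: le_trans h.
apply: (@le_trans _ _ (`|fine (\int[P t]_x generator lam k (psi t) x)%E|%:E
  + `|fine (\int[P' t]_x generator lam' k' (psi' t) x)%E|%:E)%E).
  by rewrite -EFinD lee_fin ler_normD.
by apply: leeD; exact: abs_fine.
Qed.

Let drift_support A B : 0 < A -> A <= B -> exists C, 0 <= C /\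
  forall t s, A <= t <= B -> A <= s <= B -> w t - drift t * (s - t) - C * (s - t) ^+ 2 <= w s.
Proof.
move=> A0 AB; have B0 := lt_le_trans A0 AB.
have [C1 [_ /(_ A A0)[C [C0 hC]]]] := estimates B0.
exists C; split => // t s /andP[At tB] /andP[As sB].
have [|_ _ _ _ h] := hC t; first by rewrite (lt_le_trans A0 At).
by apply: h => //; rewrite sB (le_trans (ltW A0) As).
Qed.

Lemma drift_facts t : 0 < t ->
  [/\ {ae P t, forall x, generator_defined lam k (psi t) x},
      {ae P' t, forall x, generator_defined lam' k' (psi' t) x},
      (P t).-integrable setT (generator lam k (psi t)) &
      (P' t).-integrable setT (generator lam' k' (psi' t))].
Proof.
move=> t0; have [C [_ /(_ 1 ltr01)[C2 [_ h]]]] := estimates t0.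
by have [|[h1 h2] [h3 h4] _ _ _] := h t; first by rewrite t0 lexx.
Qed.

Lemma absdrift_locally_bounded : locally_bounded_on `]0, +oo[ absdrift.
Proof.
move=> a b ab; have [ba|a_b] := ltP b a.
  exists 0 => t; rewrite in_itv/= => /andP[/le_trans /[apply]]; by rewrite leNgt ba.
have a0 : 0 < a.
  have : a \in `]0, +oo[ by apply: ab; rewrite /= in_itv/= lexx a_b.
  by rewrite in_itv/= andbT.
have [C [C0 hC]] := absdrift_bound (lt_le_trans a0 a_b).
exists (C * a `^ (- q)) => t; rewrite in_itv/= => /andP[at_ tb].
have t0 : 0 < t by exact: lt_le_trans at_.
apply: (le_trans (hC t _)); first by rewrite t0.
rewrite lee_fin ler_wpM2l// !powRN lef_pV2 ?posrE ?powR_gt0//.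
by rewrite ge0_ler_powR ?nnegrE// ?ltW//; case/andP: q01.
Qed.

Lemma wasserstein_lipschitz : locally_lipschitz_on `]0, +oo[ w.
Proof. exact: (evolution_lipschitz q01 drift_bound drift_support). Qed.

Lemma wasserstein_derive :
  {ae @lebesgue_measure R, forall t : R, 0 < t -> is_derive t 1 w (- drift t)}.
Proof. exact: (evolution_derive q01 drift_bound drift_support w_cvg0). Qed.

Let leb_drift_integrable B : lebesgue_measure.-integrable `[0, B] (EFin \o drift).
Proof. exact: (drift_integrable q01 drift_bound drift_support). Qed.

Lemma drift_locally_integrable : locally_integrable_on `[0, +oo[ (EFin \o drift).
Proof. by apply: integrable_locally_on0 => b; exact: leb_drift_integrable. Qed.

Lemma wasserstein_integral t : 0 <= t ->
  w t = w 0 - \int[completed_lebesgue_measure]_(r in `[0, t]) drift r.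
Proof.
move=> t0; have := evolution_eq q01 drift_bound drift_support w_cvg0 t0.
have mI : measurable (`[0, t]%classic : set (measurableTypeR R)) by exact: measurable_itv.
have /integrableP[mD _] := leb_drift_integrable t.
by rewrite /Rintegral (completed_integral mI mD).
Qed.

(** A statement that needs no measurability in t: nothing relates the potentials chosen at different
    times, while the power bound on [absdrift] holds at every t > 0. *)
Lemma absdrift_dominated : locally_dominated_on `[0, +oo[ absdrift.
Proof. exact: (power_bound_dominated q01 absdrift_bound). Qed.

Lemma absdrift_integrable : lebesgue_measurable_on `[0, +oo[ absdrift ->
  locally_integrable_on `[0, +oo[ absdrift.
Proof. exact: (power_bound_integrable q01 absdrift_bound). Qed.

End wasserstein_evolution.

Theorem theorem3p1 (R : realType) (rho : R) (d : nat)
  (d1 : measure_display) (Omega : measurableType d1) (Pr : probability Omega R)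
  (d2 : measure_display) (Omega' : measurableType d2) (Pr' : probability Omega' R)
  (lam lam' : d.-tuple R -> R)
  (k k' : R.-pker (d.-tuple R) ~> (d.-tuple R))
  (X : R -> {RV Pr >-> (d.-tuple R)}) (X' : R -> {RV Pr' >-> (d.-tuple R)})
  (eps : R) (psi psi' : R -> d.-tuple R -> \bar R) :
  1 <= rho -> (0 < d)%N ->
  pure_jump_process lam k X -> pure_jump_process lam' k' X' ->
  has_ubound (range (fun x => Num.max (lam x) (lam' x))) ->
  0 < eps ->
  locally_bounded_on `[0, +oo[
    (fun t => \int[Pr]_w (enorm (X t w) `^ (rho * (1 + eps)))%:E
            + \int[Pr']_w (enorm (X' t w) `^ (rho * (1 + eps)))%:E)%E ->
  (forall t, 0 <= t ->
     kantorovich_potentials rho (marginal X t) (marginal X' t)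
       (psi t) (psi' t)) ->
  let P := marginal X in
  let P' := marginal X' in
  let L := generator lam k in
  let L' := generator lam' k' in
  let w t := fine (wasserstein rho (P t) (P' t) `^ rho)%E in
  let absdrift t :=
    (\int[P t]_x `|L (psi t) x| + \int[P' t]_x `|L' (psi' t) x|)%E in
  let drift t :=
    fine (\int[P t]_x L (psi t) x)%E + fine (\int[P' t]_x L' (psi' t) x)%E in
  ((forall t, 0 < t ->
      [/\ {ae P t, forall x, generator_defined lam k (psi t) x},
          {ae P' t, forall x, generator_defined lam' k' (psi' t) x},
          (P t).-integrable setT (L (psi t)) &
          (P' t).-integrable setT (L' (psi' t))]) /\
   locally_bounded_on `]0, +oo[ absdrift) /\
  (locally_lipschitz_on `]0, +oo[ w /\
   {ae @lebesgue_measure R, forall t : R, 0 < t ->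
      is_derive t 1 w (- drift t)}) /\
  ([/\ locally_dominated_on `[0, +oo[ absdrift,
       lebesgue_measurable_on `[0, +oo[ absdrift ->
         locally_integrable_on `[0, +oo[ absdrift,
       locally_integrable_on `[0, +oo[ (EFin \o drift) &
       forall t, 0 <= t ->
         w t = w 0 -
           \int[completed_lebesgue_measure]_(r in `[0, t]) drift r]).
Proof.
move=> rho1 _ pX pX' lam_bound eps0 moments pot P P' L L' w absdrift drift.
split; [split|split; split].
- by move=> t; exact: (drift_facts rho1 pX pX' lam_bound eps0 moments pot).
- exact: (absdrift_locally_bounded rho1 pX pX' lam_bound eps0 moments pot).
- exact: (wasserstein_lipschitz rho1 pX pX' lam_bound eps0 moments pot).
- exact: (wasserstein_derive rho1 pX pX' lam_bound eps0 moments pot).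
- exact: (absdrift_dominated rho1 pX pX' lam_bound eps0 moments pot).
- exact: (absdrift_integrable rho1 pX pX' lam_bound eps0 moments pot).
- exact: (drift_locally_integrable rho1 pX pX' lam_bound eps0 moments pot).
- exact: (wasserstein_integral rho1 pX pX' lam_bound eps0 moments pot).
Qed.
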